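(* Let $X:g=0$ be a reduced hypersurface of degree $d\ge 2$ in $\mathbb{C}^n$, and let $D:f=0$ be its closure in $\mathbb{P}^n$, where $f$ is the degree $d$ homogenization of $g$. Assume that $D$ has only isolated singularities. Then $$d-1-\frac{\tau(D)}{(d-1)^{n-1}}\le mdr(g)=mdr(f)\le d-1.$$ In particular, if in addition $\tau(D)<(d-1)^{n-1}$, then $mdr(g)=mdr(f)=d-1$.
   Context: $R=\mathbb{C}[x_1,\ldots,x_n]$, $S=\mathbb{C}[x_0,\ldots,x_n]$; $g\in R$ is reduced of degree $d$, and $f=x_0^dg(x_1/x_0,\ldots,x_n/x_0)\in S$. Subscripts on $f,g$ denote partial derivatives. $\tau(D)$ is the total Tjurina number, i.e. the sum over the singular points $p$ of $D$ of the local Tjurina numbers $\tau(D,p)=\dim_{\mathbb{C}}\mathcal{O}_n/(h,\partial_1h,\ldots,\partial_nh)$, where $h=0$ is a local equation of $D$ at $p$ and $\mathcal{O}_n$ is the ring of analytic germs at the origin of $\mathbb{C}^n$. $AR(f)=\{(a_0,\ldots,a_n)\in S^{n+1} : \sum_{j=0}^na_jf_j=0\}$, graded so that $AR(f)_s$ consists of the syzygies with entries homogeneous of degree $s$; $mdr(f)=\min\{r : AR(f)_r\ne0\}$. $AR(g)=\{(\alpha_0,\ldots,\alpha_n)\in R^{n+1} : \alpha_0g+\sum_{j=1}^n\alpha_jg_j=0\}$; for nonzero $\rho'=(\alpha_0,\ldots,\alpha_n)\in AR(g)$, $sdeg(\rho')=\max\{\deg\alpha_0,\ \deg(d\alpha_j+x_j\alpha_0)\text{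 for }1\le j\le n\}$ with $\deg 0=-\infty$; $mdr(g)$ is the minimal value of $sdeg$ on nonzero elements of $AR(g)$. *)

(* Defs.v *)
From mathcomp Require Import all_boot all_order all_algebra.
From mathcomp Require Import boolp classical_sets functions cardinality fsbigop.
From mathcomp Require Import reals complex mpoly.

Set Implicit Arguments.
Unset Strict Implicit.
Unset Printing Implicit Defensive.

Import Order.TTheory GRing.Theory Num.Theory.

Local Open Scope classical_set_scope.
Local Open Scope complex_scope.
Local Open Scope ring_scope.

(* The complex field is [R[i]] for [R : realType].  A number of [R] is compared
   with a norm, which has type [R[i]], through the embedding [_%:C]. *)

(* 0 if [A] is empty. *)
Definition least (A : set nat) : nat :=
  xget 0%N [set k | A k /\ forall j, A j -> (k <= j)%N].

Section Polynomials.
Variable K : fieldType.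

(* A polynomial is reduced when it is nonzero without multiple factors. *)
Definition reduced n (g : {mpoly K[n]}) : Prop :=
  g != 0 /\ forall h q : {mpoly K[n]}, g = q * h ^+ 2 -> (msize h <= 1)%N.

(* x_0^d g(x_1/x_0, ..., x_n/x_0), expanded monomial by monomial; this is a
   polynomial as soon as [deg g <= d].  The variable x_j, j >= 1, has index
   [j - 1] in [g] and [j] in [homogenize d g]. *)
Definition homogenize n (d : nat) (g : {mpoly K[n]}) : {mpoly K[n.+1]} :=
  \sum_(m <- msupp g)
     g@_m *: ('X_ord0 ^+ (d - mdeg m) * \prod_(j < n) 'X_(lift ord0 j) ^+ m j).

Definition AR_hom n (f : {mpoly K[n.+1]}) (s : nat)
    (a : 'I_n.+1 -> {mpoly K[n.+1]}) : Prop :=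
  (forall j, a j \is s.-homog) /\ \sum_(j < n.+1) a j * f^`M(j) = 0.

Definition mdr_hom n (f : {mpoly K[n.+1]}) : nat :=
  least [set s | exists a, AR_hom f s a /\ exists j, a j != 0].

Definition AR_aff n (g : {mpoly K[n]}) (a : 'I_n.+1 -> {mpoly K[n]}) : Prop :=
  a ord0 * g + \sum_(j < n) a (lift ord0 j) * g^`M(j) = 0.

(* [msize p] is [deg p + 1], with [msize 0 = 0], so that taking the maximum
   before the predecessor implements [deg 0 = -oo]; for [a != 0] and [d != 0]
   in characteristic 0 the maximum is positive. *)
Definition sdeg n (d : nat) (a : 'I_n.+1 -> {mpoly K[n]}) : nat :=
  (maxn (msize (a ord0))
     (\max_(j < n) msize (d%:R * a (lift ord0 j) + 'X_j * a ord0))).-1.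

Definition mdr_aff n (d : nat) (g : {mpoly K[n]}) : nat :=
  least [set s | exists a, [/\ AR_aff g a, exists j, a j != 0 & s = sdeg d a]].

End Polynomials.

Section AnalyticGerms.
Variables (R : realType) (n : nat).

Definition series : Type := 'X_{1..n} -> R[i].

(* The ring O_n of analytic germs at the origin of C^n, as the ring of power
   series that converge absolutely on some polydisc around the origin. *)
Definition germ (u : series) : Prop :=
  exists2 e : R, 0 < e & exists M : R, forall N : nat,
    \sum_(m : 'X_{1..n < N}) `|u m| * e%:C ^+ mdeg m <= M%:C.

Definition mul_series (u v : series) : series := fun m =>
  \sum_(k : 'X_{1..n < (mdeg m).+1, (mdeg m).+1} | m == (k.1 + k.2)%MM)
     u k.1 * v k.2.

Definition series_of (h : {mpoly R[i][n]}) : series := fun m => h@_m.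

(* The ideal (h, d_1 h, ..., d_n h) of O_n. *)
Definition tjurina_ideal (h : {mpoly R[i][n]}) : set series :=
  [set u | exists (c0 : series) (c : 'I_n -> series),
     [/\ germ c0, forall j, germ (c j) &
         forall m, u m = mul_series c0 (series_of h) m
           + \sum_(j < n) mul_series (c j) (series_of h^`M(j)) m]].

(* The dimension of O_n / (h, d_1 h, ..., d_n h): the size of a family of germs
   whose classes form a basis; 0 if the quotient is infinite-dimensional. *)
Definition tjurina (h : {mpoly R[i][n]}) : nat :=
  xget 0%N [set k | exists b : 'I_k -> series,
    (forall i, germ (b i)) /\
    forall u, germ u ->
      exists! c : 'rV[R[i]]_k,
        tjurina_ideal h (fun m => u m - \sum_(i < k) c 0 i * b i m)].

End AnalyticGerms.

Section ProjectiveHypersurfaces.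
Variables (R : realType) (n : nat).
Implicit Types (f : {mpoly R[i][n.+1]}) (p : 'rV[R[i]]_n.+1).

(* [p] holds homogeneous coordinates of a singular point of f = 0. *)
Definition singular f p : Prop :=
  [/\ p != 0, f.@[p 0] = 0 & forall j, (f^`M(j)).@[p 0] = 0].

(* Every singular point [p] has a neighbourhood for the classical topology of
   P^n, the image of a ball of C^{n+1}, with no other singular point. *)
Definition isolated_singularities f : Prop :=
  forall p, singular f p ->
    exists2 e : R, 0 < e & forall q, singular f q ->
      (forall j, `|q 0 j - p 0 j| < e%:C) -> exists c : R[i], q = c *: p.

(* The least index of a nonzero coordinate (of [p != 0]). *)
Definition pivot p : 'I_n.+1 := [arg min_(i < ord0 | p 0%R i != 0%R) i]%N.

(* Every point of P^n has exactly one normalized vector of coordinates. *)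
Definition normalized p : Prop := p 0 (pivot p) = 1.

(* The equation of f = 0 in the affine chart of P^n where the coordinate of
   index [pivot p] is 1, translated so that [p] (normalized) is the origin. *)
Definition local_equation f p : {mpoly R[i][n]} :=
  f \mPo [tuple (p 0 j)%:MP + (if unlift (pivot p) j is Some k then 'X_k else 0)
         | j < n.+1].

(* The sum ranges over the singular points of the hypersurface; it is 0 by
   convention if infinitely many terms are nonzero. *)
Definition total_tjurina f : nat :=
  \big[addn/0%N]_(p \in [set p | normalized p /\ singular f p])
     tjurina (local_equation f p).

End ProjectiveHypersurfaces.

(* Main.v *)
(** Let [J] be the Jacobian ideal of [f], [r = mdr f], [e = d - 1].  The inequality
    [e ^ n <= tau(D) + r * e ^ (n - 1)] follows from two estimates of the Hilbert
    function of [S/J] in large degree.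

    It is at most [tau(D)]: if a linear form [l] misses the singular points, the
    multiplications by [x_i / l] on a high graded piece of [S/J] commute, hence are
    simultaneously triangular.  Their joint eigenvalues are singular points, and a form
    lies in [J] in large degree as soon as its germs at the singular points lie in the
    Tjurina ideals.

    It is at least [e ^ n - r * e ^ (n - 1)]: [n] generic combinations of the partial
    derivatives form with [l] a regular sequence, so the ideal [I] they generate has
    Hilbert function eventually [e ^ n].  A syzygy of degree [r] yields [b g \in I] with
    [b != 0] of degree at most [r], where [J = I + (g)].  If [b] has minimal degree, it
    is prime to [l], so [b] and [n - 1] generic elements of [I] form a regular sequence
    inside [I : g], and the Hilbert function of [S/(I : g)], which is the difference of
    those of [S/I] and [S/J], is eventually at most [r * e ^ (n - 1)].

    Regular sequences are obtained from the coordinates by replacing one member at a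
    time: the eigenvalue argument, applied to the ideal of the other members, gives the
    finitely many points that the new member has to avoid. *)

Require Import Defs.
From mathcomp Require Import all_boot all_order all_algebra.
From mathcomp Require Import boolp classical_sets functions cardinality fsbigop.
From mathcomp Require Import reals complex mpoly.
From mathcomp Require Import topology normedtype spectral ring lra zify.

Set Implicit Arguments.
Unset Strict Implicit.
Unset Printing Implicit Defensive.

Import Order.TTheory GRing.Theory Num.Theory.
Import numFieldNormedType.Exports.
Local Open Scope complex_scope.
Local Open Scope ring_scope.

(** * Dimensions of quotients of vector spaces *)

(** The two [mdr] values are linked by Euler's relation: at [x_0 = 1] it replaces [f_0] by
    [d g - sum x_j g_j], so a syzygy [(a_j)] of [f] becomes [(d a_0, a_j - x_j a_0)] for [g], and
    [sdeg] is the degree needed to go back. The bound [d - 1] is the degree of the Koszul syzygies.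

    The eigenvalues stand in for the Nullstellensatz, primary decomposition and Bezout's theorem:
    multiplicities appear as repetitions of a point, and the work is linear algebra on one high
    graded piece. The Tjurina ideals, in contrast, consist of germs. Truncation joins the two: a
    form that does not vanish at the singular point [p] and multiplies all local monomials of large
    order into [J] makes the tails of the series irrelevant.

    The lower bound is proved for [r < d - 1], the case [r = d - 1] being trivial. The generic
    combinations of the derivatives form a regular sequence in degree [d - 1], so they have no
    syzygy of degree [r]; this forces [b != 0]. Isolated singular points are finitely many by
    compactness, so some [l] misses them all. *)

Section RelativeDimension.
Variable K : fieldType.

Definition subspace (E : lmodType K) (W : E -> Prop) :=
  W 0 /\ forall a u v, W u -> W v -> W (a *: u + v).

(* [G / (G :&: W)] has dimension [k], expressed as in [tjurina]. *)
Definition qdim (E : lmodType K) (G W : E -> Prop) (k : nat) :=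
  exists b : 'I_k -> E, (forall i, G (b i)) /\
    forall u, G u -> exists! c : 'rV[K]_k, W (u - \sum_(i < k) c 0 i *: b i).

Section OneSpace.
Variables (E : lmodType K) (W : E -> Prop).
Hypothesis sW : subspace W.

Lemma subspace0 : W 0. Proof. by case: sW. Qed.

Lemma subspaceD u v : W u -> W v -> W (u + v).
Proof. by case: sW => _ h Wu Wv; rewrite -[u]scale1r; apply: h. Qed.

Lemma subspaceZ a u : W u -> W (a *: u).
Proof. by case: sW => W0 h Wu; rewrite -[_ *: _]addr0; apply: h. Qed.

Lemma subspaceN u : W u -> W (- u).
Proof. by move=> Wu; rewrite -scaleN1r; apply: subspaceZ. Qed.

Lemma subspaceB u v : W u -> W v -> W (u - v).
Proof. by move=> Wu Wv; apply: subspaceD => //; apply: subspaceN. Qed.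

Lemma subspace_sum (I : Type) (r : seq I) (P : pred I) (F : I -> E) :
  (forall i, P i -> W (F i)) -> W (\sum_(i <- r | P i) F i).
Proof. by move=> h; apply: (big_ind W) => //; [exact: subspace0|exact: subspaceD]. Qed.

Lemma subspace_subr u v : W u -> W (u - v) -> W v.
Proof. by move=> Wu Wuv; rewrite -[v](subKr u); apply: subspaceB. Qed.

Lemma subspace_subl u v : W v -> W (u - v) -> W u.
Proof. by move=> Wu Wuv; rewrite -[u](subrK v); apply: subspaceD. Qed.

Lemma subspace_subC u v : W (u - v) -> W (v - u).
Proof. by move=> Wuv; rewrite -opprB; apply: subspaceN. Qed.

End OneSpace.

(** A left-kernel vector of the coefficient matrix is a relation modulo [W]. Independence modulo [W]
    thus makes this matrix [row_free], which bounds dimensions by ranks. *)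
Lemma lincomb_ker (E : lmodType K) (W : E -> Prop) k m (w : 'I_m -> E) (g : 'I_k -> E)
    (s : 'I_m -> 'rV[K]_k) (x : 'rV[K]_m) : subspace W ->
    (forall i, W (w i - \sum_j s i 0 j *: g j)) -> x *m (\matrix_i s i) = 0 ->
  W (\sum_i x 0 i *: w i).
Proof.
move=> sW hs xs0.
have -> : \sum_i x 0 i *: w i = \sum_i x 0 i *: (w i - \sum_j s i 0 j *: g j)
    + \sum_j (x *m \matrix_i s i) 0 j *: g j.
  under [X in _ = X + _]eq_bigr do rewrite scalerBr.
  rewrite sumrB -addrA; apply/esym.
  rewrite -[RHS]addr0; congr (_ + _); apply/eqP.
  rewrite addrC subr_eq0; apply/eqP.
  under [RHS]eq_bigr do rewrite scaler_sumr.
  rewrite exchange_big /=; apply: eq_bigr => j _.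
  rewrite mxE scaler_suml; apply: eq_bigr => i _.
  by rewrite scalerA !mxE.
rewrite xs0 [X in _ + X]big1 ?addr0; last by move=> j _; rewrite mxE scale0r.
by apply: (subspace_sum sW) => i _; apply: (subspaceZ sW).
Qed.

Lemma linear_lincomb (E E' : lmodType K) (T : E -> E') m (b : 'I_m -> E) (x : 'rV[K]_m) :
  linear T -> T (\sum_i x 0 i *: b i) = \sum_i x 0 i *: T (b i).
Proof.
move=> lT; apply/esym; elim/big_rec2: _ => [|i y z _ ->]; last by rewrite lT.
by have := lT (-1) 0 0; rewrite scaler0 addr0 scaleN1r addNr => ->.
Qed.

Section TwoSpaces.
Variables (E : lmodType K) (G W : E -> Prop).
Hypotheses (sG : subspace G) (sW : subspace W).

Lemma qdim_indep k (b : 'I_k -> E) : (forall i, G (b i)) ->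
    (forall u, G u -> exists! c : 'rV[K]_k, W (u - \sum_(i < k) c 0 i *: b i)) ->
  forall x : 'rV[K]_k, W (\sum_i x 0 i *: b i) -> x = 0.
Proof.
move=> Gb hb x Wx.
have Gx : G (\sum_i x 0 i *: b i).
  by apply: subspace_sum => // i _; apply: subspaceZ.
have [c [_ hc]] := hb _ Gx.
have -> : x = c by apply/esym/hc; rewrite subrr; apply: subspace0 sW.
by apply: hc; rewrite [X in _ - X]big1 ?subr0 // => i _; rewrite mxE scale0r.
Qed.

Lemma indep_leq k m (v : 'I_m -> E) : qdim G W k -> (forall i, G (v i)) ->
  (forall x : 'rV[K]_m, W (\sum_i x 0 i *: v i) -> x = 0) -> (m <= k)%N.
Proof.
case=> b [Gb hb] Gv vfree.
have /choice[r hr] : forall i, exists c : 'rV[K]_k,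
    W (v i - \sum_(j < k) c 0 j *: b j).
  by move=> i; have [c [hc _]] := hb _ (Gv i); exists c.
pose M := \matrix_(i < m) r i.
have : row_free M.
  rewrite -kermx_eq0; apply/rowV0P => x /sub_kermxP xM0.
  exact/vfree/(lincomb_ker sW hr).
by rewrite /row_free => /eqP <-; apply: rank_leq_col.
Qed.

Lemma indep_span_qdim m (v : 'I_m -> E) : (forall i, G (v i)) ->
    (forall u, G u -> exists c : 'rV[K]_m, W (u - \sum_i c 0 i *: v i)) ->
    (forall x : 'rV[K]_m, W (\sum_i x 0 i *: v i) -> x = 0) ->
  qdim G W m.
Proof.
move=> Gv vspan vfree; exists v; split=> // u Gu.
have [c hc] := vspan u Gu; exists c; split=> // c' hc'.
apply/eqP; rewrite -subr_eq0; apply/eqP/vfree.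
rewrite (eq_bigr (fun i => c 0 i *: v i - c' 0 i *: v i)); last first.
  by move=> i _; rewrite !mxE scalerBl.
rewrite sumrB.
have -> : \sum_i c 0 i *: v i - \sum_i c' 0 i *: v i =
  (u - \sum_i c' 0 i *: v i) - (u - \sum_i c 0 i *: v i) by rewrite opprB [RHS]addrC addrA subrK.
exact: subspaceB.
Qed.

Lemma span_qdim m (v : 'I_m -> E) : (forall i, G (v i)) ->
    (forall u, G u -> exists c : 'rV[K]_m, W (u - \sum_i c 0 i *: v i)) ->
  exists k, qdim G W k.
Proof.
elim: m v => [|m IHm] v Gv vspan.
  by exists 0%N; apply: (indep_span_qdim (v := v)) => // x _; apply/rowP => -[].
have [vfree|] := pselect
    (forall x : 'rV[K]_m.+1, W (\sum_i x 0 i *: v i) -> x = 0).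
  by exists m.+1; apply: indep_span_qdim vspan vfree.
move=> /existsNP[x /not_implyP[Wx /eqP/rV0Pn[i0 xi0]]].
apply: (IHm (v \o lift i0)) => [i|u Gu]; first exact: Gv.
have [c hc] := vspan u Gu.
exists (\row_j (c 0 (lift i0 j) - c 0 i0 / x 0 i0 * x 0 (lift i0 j))).
suff -> : u - \sum_(i < m) (\row_j (c 0 (lift i0 j) - c 0 i0 / x 0 i0 *
    x 0 (lift i0 j))) 0 i *: (v \o lift i0) i =
    (u - \sum_i c 0 i *: v i) + (c 0 i0 / x 0 i0) *: (\sum_i x 0 i *: v i).
  by apply: subspaceD => //; apply: subspaceZ.
rewrite -addrA; congr (_ + _); rewrite !(bigD1_ord i0) //=.
rewrite scalerDr scalerA divfK // opprD addrACA addNr add0r scaler_sumr -!sumrN -big_split /=.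
apply: eq_bigr => j _.
by rewrite mxE scalerBl opprB scalerA addrC.
Qed.

End TwoSpaces.

Lemma qdim_inj (E E' : lmodType K) (G W : E -> Prop) (G' W' : E' -> Prop)
    (T : E -> E') k k' :
  subspace G -> subspace W -> subspace G' -> subspace W' -> linear T ->
  (forall u, G u -> G' (T u)) -> (forall u, G u -> W' (T u) -> W u) ->
  qdim G W k -> qdim G' W' k' -> (k <= k')%N.
Proof.
move=> sG sW sG' sW' lT TG TW [b [Gb hb]] q'.
apply: (indep_leq sW' (v := T \o b) q') => [i|x]; first exact/TG.
rewrite /= -(linear_lincomb _ _ lT) => /TW Wx; apply: (qdim_indep sG sW Gb hb); apply: Wx.
by apply: subspace_sum => // i _; apply: subspaceZ.
Qed.

Lemma qdim_surj (E E' : lmodType K) (G W : E -> Prop) (G' W' : E' -> Prop)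
    (T : E -> E') k k' :
  subspace G -> subspace W -> subspace G' -> subspace W' -> linear T ->
  (forall u, G u -> W u -> W' (T u)) ->
  (forall u, G' u -> exists2 v, G v & W' (u - T v)) ->
  qdim G W k -> qdim G' W' k' -> (k' <= k)%N.
Proof.
move=> sG sW sG' sW' lT TW TG q [b [Gb hb]].
have /choice[v hv] : forall i, exists v, G v /\ W' (b i - T v).
  by move=> i; have [v] := TG _ (Gb i); exists v.
apply: (indep_leq sW q (v := v)) => [i|x Wx]; first by case: (hv i).
apply: (qdim_indep sG' sW' Gb hb).
have Gx : G (\sum_i x 0 i *: v i).
  by apply: subspace_sum => // i _; apply: subspaceZ; case: (hv i).
apply: (subspace_subl sW' (TW _ Gx Wx)).
rewrite (linear_lincomb _ _ lT) -sumrB; apply: subspace_sum => // i _.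
by rewrite -scalerBr; apply: subspaceZ => //; case: (hv i).
Qed.

Lemma linear_id (E : lmodType K) : linear (@id E). Proof. by []. Qed.

Lemma qdim_uniq (E : lmodType K) (G W : E -> Prop) k k' :
  subspace G -> subspace W -> qdim G W k -> qdim G W k' -> k = k'.
Proof.
move=> sG sW q q'; apply/eqP; rewrite eqn_leq.
by rewrite (qdim_inj sG sW sG sW (@linear_id E) _ _ q q') //
           (qdim_inj sG sW sG sW (@linear_id E) _ _ q' q).
Qed.

Lemma qdimD (E : lmodType K) (G H W : E -> Prop) k l :
  subspace G -> subspace H -> subspace W ->
  (forall u, H u -> G u) -> (forall u, W u -> H u) ->
  qdim G H k -> qdim H W l -> qdim G W (k + l).
Proof.
move=> sG sH sW HG WH [b [Gb hb]] [b' [Gb' hb']].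
pose v (i : 'I_(k + l)) := match fintype.split i with inl j => b j | inr j => b' j end.
have sumv (x : 'rV[K]_k) (y : 'rV[K]_l) : \sum_i (row_mx x y) 0 i *: v i =
    \sum_i x 0 i *: b i + \sum_i y 0 i *: b' i.
  rewrite big_split_ord /=; congr (_ + _); apply: eq_bigr => i _.
    rewrite row_mxEl /v; case: split_ordP => j /eqP;
    by rewrite ?eq_lshift ?eq_lrshift // => /eqP ->.
  by rewrite row_mxEr /v; case: split_ordP => j /eqP; rewrite ?eq_rshift ?eq_rlshift // => /eqP ->.
apply: (indep_span_qdim sW (v := v)).
- by move=> i; rewrite /v; case: fintype.split => j; [exact: Gb|exact/HG].
- move=> u Gu; have [c [hc _]] := hb u Gu; have [c' [hc' _]] := hb' _ hc.
  by exists (row_mx c c'); rewrite sumv opprD addrA.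
- move=> x; rewrite -[x]hsubmxK sumv => Wx.
  have Hb' : H (\sum_i rsubmx x 0 i *: b' i).
    by apply: subspace_sum => // i _; apply: subspaceZ.
  have x0 : lsubmx x = 0.
    apply: (qdim_indep sG sH Gb hb).
    by rewrite -[X in H X](addrK (\sum_i rsubmx x 0 i *: b' i));
       apply: subspaceB => //; apply: WH.
  have y0 : rsubmx x = 0.
    apply: (qdim_indep sH sW Gb' hb'); move: Wx; rewrite x0 big1 ?add0r // => i _.
    by rewrite mxE scale0r.
  by rewrite x0 y0 row_mx0.
Qed.

Lemma qdim_ext (E : lmodType K) (G W W' : E -> Prop) k :
  (forall u, G u -> W u <-> W' u) -> subspace G -> qdim G W k -> qdim G W' k.
Proof.
move=> WW' sG [b [Gb hb]]; exists b; split=> // u Gu.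
have Gc (c : 'rV[K]_k) : G (u - \sum_i c 0 i *: b i).
  apply: subspaceB => //; apply: subspace_sum => // i _.
  exact: subspaceZ.
have [c [hc cu]] := hb u Gu; exists c; split; first exact/WW'.
by move=> c' /WW' hc'; apply: cu; apply: hc'.
Qed.

Lemma subspaceI (E : lmodType K) (G H : E -> Prop) :
  subspace G -> subspace H -> subspace (fun u => G u /\ H u).
Proof.
move=> [G0 hG] [H0 hH]; split=> // a u v [Gu Hu] [Gv Hv].
by split; [apply: hG|apply: hH].
Qed.

(** The map from [u] to the pair [(u, phi u)] embeds the quotient by both conditions in the direct
    sum of the two quotients. It serves to impose the local conditions one singular point at a
    time. *)
Lemma qdim_meet_leq (E E' : lmodType K) (G W : E -> Prop) (G' W' : E' -> Prop)
    (phi : E -> E') a b m :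
  subspace G -> subspace W -> subspace G' -> subspace W' -> linear phi ->
  (forall u, G u -> G' (phi u)) -> qdim G W a -> qdim G' W' b ->
  qdim G (fun u => W u /\ W' (phi u)) m -> (m <= a + b)%N.
Proof.
move=> sG sW sG' sW' lphi Gphi [e [Ge he]] [e' [Ge' he']] [v [Gv hv]].
have sM : subspace (fun u => W u /\ W' (phi u)).
  split=> [|t x y [Wx Wx'] [Wy Wy']].
    split; first exact: subspace0.
    have := lphi (-1) 0 0; rewrite scaler0 addr0 scaleN1r addNr => ->; exact: subspace0.
  by split; [apply: sW.2|rewrite lphi; apply: sW'.2].
have /choice[r hr] : forall i, exists c : 'rV[K]_a, W (v i - \sum_(j < a) c 0 j *: e j).
  by move=> i; have [c [hc _]] := he _ (Gv i); exists c.
have /choice[r' hr'] : forall i, exists c : 'rV[K]_b,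
    W' (phi (v i) - \sum_(j < b) c 0 j *: e' j).
  by move=> i; have [c [hc _]] := he' _ (Gphi _ (Gv i)); exists c.
pose M := row_mx (\matrix_(i < m) r i) (\matrix_(i < m) r' i).
have : row_free M.
  rewrite -kermx_eq0; apply/rowV0P => x /sub_kermxP.
  rewrite mul_mx_row -row_mx0 => /eq_row_mx[x1 x2].
  apply: (qdim_indep sG sM Gv hv); split; first exact: lincomb_ker sW hr x1.
  by rewrite (linear_lincomb _ _ lphi); apply: lincomb_ker sW' hr' x2.
by rewrite /row_free => /eqP <-; apply: rank_leq_col.
Qed.

End RelativeDimension.

(** * Graded ideals and their Hilbert functions *)

Section GradedIdeals.
Variables (K : fieldType) (n : nat).
Notation S := {mpoly K[n]}.
Implicit Types (p q g : S) (I : S -> Prop).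

Definition homogs k : S -> Prop := fun p => p \is k.-homog.

Definition is_ideal I :=
  [/\ I 0, forall p q, I p -> I q -> I (p + q) & forall p q, I q -> I (p * q)].

Definition hom_ideal I :=
  is_ideal I /\ forall k p, I p -> I (pihomog mdeg k p).

Definition addI I g : S -> Prop := fun p => exists q, I (p - q * g).
Definition colon I g : S -> Prop := fun p => I (p * g).
Definition nzd I g := forall p, I (p * g) -> I p.

Lemma subspace_homogs k : subspace (homogs k).
Proof.
split; first exact: dhomog0.
by move=> a u v hu hv; apply: dhomogD => //; apply: dhomogZ.
Qed.

Lemma ideal_subspace I : is_ideal I -> subspace I.
Proof.
case=> I0 ID IM; split=> // a u v Iu Iv; apply: ID => //.
by rewrite -mul_mpolyC; apply: IM.
Qed.

Lemma hom_ideal_subspace I : hom_ideal I -> subspace I.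
Proof. by case=> /ideal_subspace. Qed.

Lemma idealM I p q : is_ideal I -> I q -> I (p * q).
Proof. by case=> _ _; apply. Qed.

Lemma idealMr I p q : is_ideal I -> I p -> I (p * q).
Proof. by rewrite mulrC; apply: idealM. Qed.

Lemma pihomogM e g k p : g \is e.-homog ->
  pihomog mdeg (k + e) (p * g) = pihomog mdeg k p * g.
Proof.
move=> hg; rewrite {1}(pihomog_partitionE (leqnn (msize p))) mulr_suml raddf_sum /=.
have homM (d : nat) : pihomog mdeg d p * g \is (d + e).-homog.
  by apply: dhomogM => //; apply: pihomogP.
have [ltk|gek] := ltnP k (msize p).
  rewrite (bigD1 (Ordinal ltk)) //= pihomog_dE; last exact: homM.
  rewrite big1 ?addr0 // => d; rewrite -val_eqE /= => dk.
  by apply: pihomog_ne0 (homM d); rewrite eqn_add2r.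
rewrite big1 => [|d _]; last first.
  apply: pihomog_ne0 (homM d); rewrite eqn_add2r.
  by rewrite neq_ltn (leq_trans (ltn_ord d)).
rewrite pihomogE big_seq_cond big1 ?mul0r // => m /andP[m_in /eqP mk].
by have := msize_mdeg_lt m_in; rewrite ltnNge mk gek.
Qed.

Lemma pihomogM0 e g k p : g \is e.-homog -> (k < e)%N ->
  pihomog mdeg k (p * g) = 0.
Proof.
move=> hg ke; rewrite (pihomog_partitionE (leqnn (msize p))) mulr_suml raddf_sum /=.
rewrite big1 // => d _; apply: (@pihomog_ne0 _ _ _ (d + e)%N).
  by rewrite neq_ltn (leq_trans ke) ?leq_addl ?orbT.
by apply: dhomogM => //; apply: pihomogP.
Qed.

Lemma addI_ideal I g : is_ideal I -> is_ideal (addI I g).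
Proof.
move=> iI; have sI := ideal_subspace iI; split.
- by exists 0; rewrite mul0r subr0; apply: subspace0.
- move=> p q [p' hp] [q' hq]; exists (p' + q').
  by rewrite mulrDl opprD addrACA; apply: subspaceD.
- by move=> p q [q' hq]; exists (p * q'); rewrite -mulrA -mulrBr; apply: idealM.
Qed.

Lemma addI_hom I e g : hom_ideal I -> g \is e.-homog -> hom_ideal (addI I g).
Proof.
move=> [iI hI] hg; split; first exact: addI_ideal.
move=> k p [q hq]; have [ke|ek] := ltnP k e.
  exists 0; rewrite mul0r subr0 -[X in I X]subr0 -(pihomogM0 q hg ke) -raddfB /=.
  exact: hI.
exists (pihomog mdeg (k - e) q); rewrite -(pihomogM _ _ hg) subnK // -raddfB /=.
exact: hI.
Qed.

Lemma addI_sub I g p : is_ideal I -> I p -> addI I g p.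
Proof. by move=> iI Ip; exists 0; rewrite mul0r subr0. Qed.

Lemma addI_gen I g p : is_ideal I -> addI I g (p * g).
Proof. by case=> I0 _ _; exists p; rewrite subrr. Qed.

Lemma colon_ideal I g : is_ideal I -> is_ideal (colon I g).
Proof.
move=> [I0 ID IM]; split; rewrite /colon ?mul0r // => p q.
  by rewrite mulrDl; apply: ID.
by rewrite -mulrA; apply: IM.
Qed.

Lemma colon_hom I e g : hom_ideal I -> g \is e.-homog -> hom_ideal (colon I g).
Proof.
move=> [iI hI] hg; split; first exact: colon_ideal.
by move=> k p /(hI (k + e)%N); rewrite (pihomogM _ _ hg).
Qed.

Lemma nzd_homog I e g : hom_ideal I -> g \is e.-homog ->
  (forall k p, p \is k.-homog -> I (p * g) -> I p) -> nzd I g.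
Proof.
move=> [iI hI] hg h p Ipg; rewrite (pihomog_partitionE (leqnn (msize p))).
apply: (subspace_sum (ideal_subspace iI)) => i _.
apply: (h i); first exact: pihomogP.
by rewrite -(pihomogM _ _ hg); apply: hI.
Qed.

(* The graded Nakayama argument: [x] has positive degree, so divisibility by [x] can
   be iterated only finitely often. *)
Lemma nzd_descend I c x b y : hom_ideal I -> x \is c.-homog -> (0 < c)%N ->
  y \is b.-homog -> nzd I x -> nzd (addI I x) y -> nzd I y.
Proof.
move=> hI hx c0 hy nx ny; apply: nzd_homog hy _ => // k p.
have iI := hI.1; have sI := ideal_subspace iI.
elim/ltn_ind: k p => k IHk p hp Ipy.
have [q hq] := ny _ (addI_sub x iI Ipy).
have [kc|ck] := ltnP k c.
  move: (hI.2 k _ hq); rewrite raddfB /= (pihomogM0 _ hx) // subr0.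
  by rewrite pihomog_dE.
pose q' := pihomog mdeg (k - c) q.
have hq' : I (p - q' * x).
  move: (hI.2 k _ hq); rewrite raddfB /= -{2}(subnK ck) (pihomogM _ _ hx).
  by rewrite pihomog_dE.
apply: (subspace_subl sI _ hq'); apply: idealMr => //.
apply: (IHk (k - c)%N); [by rewrite ltn_subrL c0 (leq_trans c0)|exact: pihomogP|].
apply: nx; rewrite mulrAC; apply: (subspace_subr sI Ipy).
by rewrite -mulrBl; apply: idealMr.
Qed.

(** This half of the permutability of the regular sequence [x, y] needs no grading; the other half,
    the regularity of [y] modulo [I] alone, is [nzd_descend]. *)
Lemma nzd_swap I x y : is_ideal I -> nzd I x -> nzd (addI I x) y -> nzd (addI I y) x.
Proof.
move=> iI nx ny p [q hq]; have sI := ideal_subspace iI.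
have [r hr] : addI I x q.
  by apply: ny; exists p; apply: (subspace_subC sI).
exists r; apply: nx.
have -> : (p - r * y) * x = (p * x - q * y) + (q - r * x) * y by ring.
by apply: subspaceD => //; apply: idealMr.
Qed.

End GradedIdeals.

(** * Hilbert functions *)

Section HilbertFunction.
Variables (K : fieldType) (n : nat).
Notation S := {mpoly K[n]}.
Implicit Types (p q g : S) (I : S -> Prop).

(* The dimension of the degree [k] part of [S / I], for a subspace [I]. *)
Definition HF I k : nat := xget 0%N [set j | qdim (@homogs K n k) I j]%classic.

Lemma homogs_span k : exists N (b : 'I_N -> S), (forall i, homogs k (b i)) /\
  forall p, homogs k p -> exists c : 'rV[K]_N, p = \sum_i c 0 i *: b i.
Proof.
exists #|{: 'X_{1..n < k.+1}}|, (fun i => pihomog mdeg k 'X_[bmnm (enum_val i)]).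
split=> [i|p hp]; first exact: pihomogP.
exists (\row_i p@_(bmnm (enum_val i))).
have psz : (msize p <= k.+1)%N.
  by rewrite msizeE; apply/bigmax_leqP_seq => m /(dhomogP _ _ _ hp) ->.
rewrite -[LHS](pihomog_dE hp) [in LHS](mpolywE psz) raddf_sum /=.
rewrite (reindex _ (onW_bij _ (enum_val_bij _))) /=.
by apply: eq_bigr => i _; rewrite mxE linearZ.
Qed.

Lemma HFP I k : subspace I -> qdim (@homogs K n k) I (HF I k).
Proof.
move=> sI; have [N [b [hb bspan]]] := homogs_span k.
have [j hj] : exists j, qdim (@homogs K n k) I j.
  apply: (span_qdim sI hb) => p /bspan[c ->]; exists c.
  by rewrite subrr; apply: subspace0.
by rewrite /HF; case: xgetP => [? -> //|/(_ j)].
Qed.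

Lemma HF_qdim I k j : subspace I -> qdim (@homogs K n k) I j -> HF I k = j.
Proof.
move=> sI; apply: qdim_uniq => //; [exact: subspace_homogs|exact: HFP].
Qed.

Lemma HF_le I I' k : subspace I -> subspace I' ->
  (forall p, p \is k.-homog -> I p -> I' p) -> (HF I' k <= HF I k)%N.
Proof.
move=> sI sI' II'; have sh := subspace_homogs K n k.
apply: (qdim_surj sh sI sh sI' (@linear_id _ _) _ _ (HFP k sI) (HFP k sI')) => //.
by move=> u hu; exists u; rewrite // subrr; apply: subspace0.
Qed.

Lemma HF_eq I I' k : subspace I -> subspace I' ->
  (forall p, p \is k.-homog -> I p <-> I' p) -> HF I' k = HF I k.
Proof.
by move=> sI sI' II'; apply/eqP; rewrite eqn_leq !HF_le // => p hp /(II' p hp).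
Qed.

Lemma HF_eq0 I k : subspace I ->
  HF I k = 0%N <-> (forall p, p \is k.-homog -> I p).
Proof.
move=> sI; split=> [h p hp|h].
  have [b [_ hb]] := HFP k sI; have [c [+ _]] := hb p hp.
  rewrite big1 ?subr0 // => i _.
  by have := ltn_ord i; rewrite [X in (_ < X)%N]h.
apply: HF_qdim => //; exists (fun=> 0); split=> [i|u hu].
  exact: subspace0 (subspace_homogs _ _ _).
exists 0; split=> [|c _]; last by apply/rowP => -[].
by rewrite big_ord0 subr0; apply: h.
Qed.

(** If [p] were in [I'] but not in [I], then [p] and a basis modulo [I'] would together be
    independent modulo [I], one vector too many. *)
Lemma HF_eq_sub I I' k p : subspace I -> subspace I' ->
  (forall p, p \is k.-homog -> I p -> I' p) -> (HF I k <= HF I' k)%N ->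
  p \is k.-homog -> I' p -> I p.
Proof.
move=> sI sI' II' le_HF hp I'p; apply: contrapT => nIp.
have sh := subspace_homogs K n k.
have [b [hb bspan]] := HFP k sI'.
pose v (i : 'I_(1 + HF I' k)) := match fintype.split i with inl _ => p | inr j => b j end.
have hv i : homogs k (v i) by rewrite /v; case: fintype.split.
suff /(indep_leq sI (HFP k sI) hv) : forall x : 'rV[K]_(1 + HF I' k),
    I (\sum_i x 0 i *: v i) -> x = 0.
  by rewrite add1n ltnNge le_HF.
move=> x; rewrite big_split_ord /= big_ord1.
have -> : v (lshift _ 0) = p.
  by rewrite /v; case: split_ordP => // j /eqP; rewrite eq_lrshift.
have vr j : v (rshift _ j) = b j.
  by rewrite /v; case: split_ordP => i /eqP; rewrite ?eq_rlshift ?eq_rshift // => /eqP ->.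
under eq_bigr do rewrite vr.
move=> Ix.
have hbx : homogs k (\sum_i x 0 (rshift 1 i) *: b i).
  by apply: (subspace_sum sh) => i _; apply: (subspaceZ sh).
have r0 : rsubmx x = 0.
  apply: (qdim_indep sh sI' hb bspan).
  under eq_bigr do rewrite mxE.
  rewrite -[X in I' X](addKr (x 0 (lshift _ 0) *: p)) addrC.
  apply: (subspaceB sI'); last exact: subspaceZ.
  apply: II' => //; apply: (subspaceD sh) => //; exact: (subspaceZ sh).
have xr j : x 0 (rshift 1 j) = 0.
  by have /rowP/(_ j) := r0; rewrite !mxE.
move: Ix; rewrite [X in _ + X]big1 ?addr0; last by move=> j _; rewrite xr scale0r.
move=> Ix.
have [x0|nx0] := eqVneq (x 0 (lshift _ 0)) 0.
  rewrite -[x]hsubmxK r0.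
  have -> : lsubmx x = 0 by apply/rowP => i; rewrite !mxE ord1.
  exact: row_mx0.
by case: nIp; rewrite -[p](scalerK nx0); apply: subspaceZ.
Qed.

(* Rank-nullity for multiplication by [g] into [S/I]. *)
Lemma HF_addI I e g k : hom_ideal I -> g \is e.-homog ->
  HF I (k + e) = (HF (addI I g) (k + e) + HF (colon I g) k)%N.
Proof.
move=> hI hg; have iI := hI.1; have sI := ideal_subspace iI.
have sh j := subspace_homogs K n j.
have sA := hom_ideal_subspace (addI_hom hI hg).
have sC := hom_ideal_subspace (colon_hom hI hg).
pose H p := homogs (k + e) p /\ addI I g p.
pose W p := homogs (k + e) p /\ I p.
have sH : subspace H by apply: subspaceI.
have sW : subspace W by apply: subspaceI.
apply: HF_qdim => //; apply: (@qdim_ext _ _ _ W) => //.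
  by move=> u hu; rewrite /W; split=> [[]|].
apply: (@qdimD _ _ _ H) => //.
- by move=> u [].
- by move=> u [hu Iu]; split => //; apply: addI_sub.
- by apply: (@qdim_ext _ _ _ (addI I g)) => //; [move=> u hu; rewrite /H; split=> [|[]]|exact: HFP].
have [b [hb bspan]] := HFP k sC.
apply: (indep_span_qdim sW (v := fun i => b i * g)).
- move=> i; split; last exact: addI_gen.
  by apply: dhomogM => //; apply: hb.
- move=> u [hu [q hq]].
  have [c [hc _]] := bspan (pihomog mdeg k q) (pihomogP _ _ _).
  exists c.
  have E : \sum_i c 0 i *: (b i * g) = (\sum_i c 0 i *: b i) * g.
    by rewrite mulr_suml; apply: eq_bigr => i _; rewrite scalerAl.
  have hs : homogs k (\sum_i c 0 i *: b i).
    by apply: (subspace_sum (sh k)) => i _; apply: subspaceZ.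
  split.
    apply: (subspaceB (sh _)) => //; rewrite E.
    exact: dhomogM.
  rewrite E; set r := \sum_i _ in hc *; set q' := pihomog mdeg k q in hc *.
  have -> : u - r * g = (u - q' * g) + (q' - r) * g by ring.
  apply: (subspaceD sI) => //.
  move: (hI.2 (k + e)%N _ hq); rewrite raddfB /= (pihomogM _ _ hg) pihomog_dE //.
- move=> x [_ Wx]; apply: (qdim_indep (sh k) sC hb bspan).
  rewrite /colon mulr_suml; move: Wx; under eq_bigr do rewrite scalerAl.
  by [].
Qed.

Lemma HF_nzd I e g k : hom_ideal I -> g \is e.-homog -> nzd I g ->
  HF I (k + e) = (HF (addI I g) (k + e) + HF I k)%N.
Proof.
move=> hI hg ng; rewrite (HF_addI k hI hg); congr (_ + _)%N; apply: HF_eq.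
- exact: hom_ideal_subspace.
- exact: hom_ideal_subspace (colon_hom hI hg).
- by move=> p _; split=> [|/ng //]; rewrite /colon => Ip; apply: idealMr hI.1 _.
Qed.

Lemma HF_addI_low I e g k : hom_ideal I -> g \is e.-homog -> (k < e)%N ->
  HF (addI I g) k = HF I k.
Proof.
move=> hI hg ke; apply: HF_eq.
- exact: hom_ideal_subspace.
- exact: hom_ideal_subspace (addI_hom hI hg).
move=> p hp; split=> [|[q /(hI.2 k)]]; first exact: addI_sub hI.1.
by rewrite raddfB /= (pihomogM0 _ hg) // subr0 pihomog_dE.
Qed.

End HilbertFunction.

(** * Joint eigenvalues of the multiplication operators *)

Lemma mul_ideal_homog (K : fieldType) (n : nat) (I : {mpoly K[n]} -> Prop) e g k p :
  hom_ideal I -> g \is e.-homog -> p \is (k + e).-homog -> addI I g p ->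
  exists2 q, q \is k.-homog & I (p - q * g).
Proof.
move=> hI hg hp [q hq]; exists (pihomog mdeg k q); first exact: pihomogP.
by move: (hI.2 (k + e)%N _ hq); rewrite raddfB /= (pihomogM _ _ hg) pihomog_dE.
Qed.

(** Where [S/(I + l)] vanishes, multiplication by [l] on [S/I] is onto, so the Hilbert function no
    longer increases. From a degree where it takes its minimal value it is constant, and then the
    surjections are also injective. *)
Lemma HF_stable (K : fieldType) (n : nat) (I : {mpoly K[n]} -> Prop) l k0 :
  hom_ideal I -> l \is 1.-homog ->
  (forall k, (k0 <= k)%N -> HF (addI I l) k = 0%N) ->
  exists2 k1, (k0 <= k1)%N & forall k, (k1 <= k)%N ->
    [/\ HF I k = HF I k1,
        forall p, p \is k.+1.-homog -> exists2 q, q \is k.-homog & I (p - q * l) &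
        forall p, p \is k.-homog -> I (p * l) -> I p].
Proof.
move=> hI hl h0.
have sI := hom_ideal_subspace hI.
have sC := hom_ideal_subspace (colon_hom hI hl).
have step k : (k0 <= k)%N -> HF I k.+1 = HF (colon I l) k.
  by move=> hk; rewrite -addn1 (HF_addI k hI hl) h0 // addn1 ltnW.
have le_step k : (k0 <= k)%N -> (HF I k.+1 <= HF I k)%N.
  by move=> hk; rewrite step //; apply: HF_le => // p _ Ip; apply: idealMr hI.1 Ip.
have exm : exists m, `[< exists2 k, (k0 <= k)%N & HF I k = m >].
  by exists (HF I k0); apply/asboolP; exists k0.
case: (ex_minnP exm) => m /asboolP[k1 k01 m_def] minm.
exists k1 => //.
have HFk k : (k1 <= k)%N -> HF I k = m.
  move=> hk; apply/eqP; rewrite eqn_leq; apply/andP; split; last first.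
    by apply: minm; apply/asboolP; exists k => //; apply: leq_trans hk.
  rewrite -m_def -(subnK hk); elim: (k - k1)%N => // j IH.
  by apply: leq_trans IH; apply: le_step; rewrite (leq_trans k01) ?leq_addl.
move=> k hk; have k0k := leq_trans k01 hk; split; first by rewrite !HFk.
- move=> p hp; apply: (mul_ideal_homog hI hl); first by rewrite addn1.
  have /(HF_eq0 _ (hom_ideal_subspace (addI_hom hI hl))) : HF (addI I l) k.+1 = 0%N.
    by rewrite h0 // ltnW.
  exact.
- move=> p hp Ip; apply: (HF_eq_sub (k := k) sI sC) => //.
    by move=> q _ Iq; apply: idealMr hI.1 Iq.
  by rewrite -step // !HFk // ltnW.
Qed.

(** * Simultaneous triangularization of the multiplications by [x_i / l] *)

Section TriangularBasis.
Variables (K : numClosedFieldType) (n : nat).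
Notation S := {mpoly K[n]}.
Variables (I : S -> Prop) (l : S) (k : nat).
Hypotheses (hI : hom_ideal I) (hl : l \is 1.-homog).
Hypothesis ldiv : forall p, p \is k.+1.-homog ->
  exists2 q, q \is k.-homog & I (p - q * l).
Hypothesis lreg : forall e p, p \is k.-homog -> I (p * l ^+ e) -> I p.

Let sI : subspace I := hom_ideal_subspace hI.
Notation c := (HF I k).

Definition lincomb (b : 'I_c -> S) (x : 'rV[K]_c) : S := \sum_j x 0 j *: b j.

Definition quotient_basis (b : 'I_c -> S) :=
  [/\ forall i, b i \is k.-homog,
      forall p, p \is k.-homog -> exists x, I (p - lincomb b x) &
      forall x, I (lincomb b x) -> x = 0].

Lemma lincomb_linear b : linear (lincomb b).
Proof.
move=> a x y; rewrite /lincomb scaler_sumr -big_split; apply: eq_bigr => j _.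
by rewrite !mxE scalerDl scalerA.
Qed.

Lemma lincombD b x y : lincomb b (x + y) = lincomb b x + lincomb b y.
Proof. by have := lincomb_linear b 1 x y; rewrite !scale1r. Qed.

Lemma lincomb0 b : lincomb b 0 = 0.
Proof. by rewrite /lincomb big1 // => j _; rewrite mxE scale0r. Qed.

Lemma lincombZ b a x : lincomb b (a *: x) = a *: lincomb b x.
Proof. by have := lincomb_linear b a x 0; rewrite lincomb0 !addr0. Qed.

Lemma lincombB b x y : lincomb b (x - y) = lincomb b x - lincomb b y.
Proof. by rewrite -scaleN1r lincombD lincombZ scaleN1r. Qed.

Lemma lincomb_sum b (J : Type) (r : seq J) (P : pred J) (F : J -> 'rV[K]_c) :
  lincomb b (\sum_(i <- r | P i) F i) = \sum_(i <- r | P i) lincomb b (F i).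
Proof. by apply: (big_morph _ (lincombD b) (lincomb0 b)). Qed.

Lemma lincomb_delta b j : lincomb b (delta_mx 0 j) = b j.
Proof.
rewrite /lincomb (bigD1 j) //= mxE !eqxx scale1r big1 ?addr0 // => i ij.
by rewrite mxE (negPf ij) andbF scale0r.
Qed.

Lemma lincomb_homog b x : (forall i, b i \is k.-homog) -> lincomb b x \is k.-homog.
Proof. by move=> hb; apply: rpred_sum => j _; apply: dhomogZ. Qed.

Lemma quotient_basis_exists : exists b, quotient_basis b.
Proof.
have [b [hb bspan]] := HFP k sI; exists b; split=> //.
  by move=> p hp; have [x [hx _]] := bspan p hp; exists x.
by move=> x; apply: (qdim_indep (subspace_homogs _ _ _) sI hb bspan).
Qed.

(** [A i] is the matrix of [x_i / l]: multiplication by [x_i] into degree [k + 1], followed by the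
    division by [l] that [ldiv] provides. *)
Lemma mult_matrices b : quotient_basis b ->
  exists A : 'I_n -> 'M[K]_c,
    (forall i a, I ('X_i * b a - l * lincomb b (row a (A i)))) /\
    (forall i j, A i *m A j = A j *m A i).
Proof.
move=> [hb bspan bfree].
have /choice[A0 hA0] : forall ia : 'I_n * 'I_c, exists x : 'rV[K]_c,
    I ('X_(ia.1) * b ia.2 - l * lincomb b x).
  move=> [i a] /=.
  have hxb : 'X_i * b a \is k.+1.-homog.
    by rewrite -add1n; apply: dhomogM => //; rewrite dhomogX; apply/eqP/mdeg1.
  have [q hq Iq] := ldiv hxb.
  have [x hx] := bspan q hq; exists x.
  have -> : 'X_i * b a - l * lincomb b x =
    ('X_i * b a - q * l) + l * (q - lincomb b x) by ring.
  by apply: (subspaceD sI) => //; apply: (idealM _ hI.1).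
pose A i := \matrix_(a < c) A0 (i, a).
have hA i a : I ('X_i * b a - l * lincomb b (row a (A i))).
  by rewrite rowK; apply: (hA0 (i, a)).
exists A; split=> //.
have hAx i x : I ('X_i * lincomb b x - l * lincomb b (x *m A i)).
  have -> : x *m A i = \sum_a x 0 a *: row a (A i).
    by rewrite mulmx_sum_row.
  rewrite lincomb_sum /lincomb !mulr_sumr -sumrB; apply: (subspace_sum sI) => a _.
  rewrite -/(lincomb b _) lincombZ -!scalerAr -scalerBr.
  exact: (subspaceZ sI).
move=> i j; apply/row_matrixP => a; rewrite !row_mul.
(* Multiplied by [l ^+ 2], both products represent [x_i x_j b_a], and [l] can be cancelled. *)
apply/eqP; rewrite -subr_eq0; apply/eqP/bfree/(lreg (e := 2)).
  exact: lincomb_homog.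
rewrite lincombB.
pose u := lincomb b (row a (A i)); pose v := lincomb b (row a (A j)).
set X1 := lincomb b (row a (A i) *m A j).
set X2 := lincomb b (row a (A j) *m A i).
have -> : (X1 - X2) * l ^+ 2 =
  (l * ('X_i * v - l * X2) + 'X_i * ('X_j * b a - l * v))
  - (l * ('X_j * u - l * X1) + 'X_j * ('X_i * b a - l * u)) by ring.
apply: (subspaceB sI); apply: (subspaceD sI); apply: (idealM _ hI.1);
  [exact: hAx|exact: hA|exact: hAx|exact: hA].
Qed.

(** Commuting matrices over an algebraically closed field are triangularized by one unitary [P],
    whose rows give the new basis; [lam a] collects the [a]-th diagonal entries of the conjugated
    matrices. *)
Lemma triangular_basis : exists b (lam : 'I_c -> 'I_n -> K), quotient_basis b /\
  forall i (a : 'I_c), exists2 x : 'rV[K]_c, (forall j : 'I_c, (a <= j)%N -> x 0 j = 0) &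
    I ('X_i * b a - l * (lam a i *: b a + lincomb b x)).
Proof.
have [b hb] := quotient_basis_exists.
have [A [hA Acomm]] := mult_matrices hb.
have [|P Punitary] := @cotrigonalization K c [seq A i | i <- enum 'I_n].
  by move=> _ _ /mapP[i _ ->] /mapP[j _ ->]; apply: Acomm.
have Pu := unitarymx_unit Punitary.
move=> /allP Ptrig.
have Atrig i : is_trig_mx (P *m A i *m invmx P).
  by rewrite -conjumx //; apply: Ptrig; apply/mapP; exists i; rewrite ?mem_enum.
pose b' a := lincomb b (row a P).
have b'E x : lincomb b' x = lincomb b (x *m P).
  by rewrite mulmx_sum_row lincomb_sum; apply: eq_bigr => a _; rewrite lincombZ.
case: hb => hb bspan bfree.
exists b', (fun a i => (P *m A i *m invmx P) a a); split; first split.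
- by move=> a; apply: lincomb_homog.
- move=> p /bspan[x hx]; exists (x *m invmx P).
  by rewrite b'E mulmxKV.
- move=> x; rewrite b'E => /bfree xP0.
  by rewrite -[x](mulmxK Pu) xP0 mul0mx.
move=> i a; set T := P *m A i *m invmx P.
exists (\row_j (if (j < a)%N then T a j else 0)).
  by move=> j aj; rewrite mxE ltnNge aj.
have trigE (U : 'M[K]_c) : is_trig_mx U ->
    U a a *: b' a + lincomb b' (\row_j (if (j < a)%N then U a j else 0)) =
    lincomb b' (row a U).
  move=> /is_trig_mxP Utrig.
  rewrite -(lincomb_delta b') -lincombZ -lincombD; congr lincomb.
  apply/rowP => j; rewrite !mxE eqxx /=.
  have [ja|aj|/val_inj ->] := ltngtP j a; rewrite ?eqxx ?mulr1 ?addr0 //.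
    by rewrite -val_eqE /= ltn_eqF // mulr0 add0r.
  by rewrite -val_eqE /= gtn_eqF // mulr0 Utrig.
rewrite (trigE T (Atrig i)).
have -> : lincomb b' (row a T) = \sum_j P a j *: lincomb b (row j (A i)).
  rewrite b'E -row_mul mulmxKV // row_mul mulmx_sum_row lincomb_sum.
  by apply: eq_bigr => j _; rewrite lincombZ mxE.
rewrite /b' /lincomb !mulr_sumr -sumrB; apply: (subspace_sum sI) => j _.
rewrite mxE -!scalerAr -scalerBr; apply: (subspaceZ sI).
exact: hA.
Qed.

End TriangularBasis.

Lemma mdeg_gt0 n (m : 'X_{1..n}) : (0 < mdeg m)%N -> exists i, m i != 0%N.
Proof.
move=> m_gt0; apply/existsP; apply: contraTT m_gt0 => /existsPn m0.
rewrite mdegE big1 // => i _; apply/eqP.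
by have := m0 i; rewrite negbK.
Qed.

(** * The action of forms on the invariant flag *)

Section Filtration.
Variables (K : numClosedFieldType) (n : nat).
Notation S := {mpoly K[n]}.
Variables (I : S -> Prop) (l : S) (k : nat).
Hypotheses (hI : hom_ideal I) (hl : l \is 1.-homog).
Hypothesis lreg : forall e p, p \is k.-homog -> I (p * l ^+ e) -> I p.

Let sI : subspace I := hom_ideal_subspace hI.
Notation c := (HF I k).

Variables (b : 'I_c -> S) (lam : 'I_c -> 'I_n -> K).
Hypothesis hb : quotient_basis b.
Hypothesis htrig : forall i (a : 'I_c),
  exists2 x : 'rV[K]_c, (forall j : 'I_c, (a <= j)%N -> x 0 j = 0) &
    I ('X_i * b a - l * (lam a i *: b a + lincomb b x)).

(* The span of the classes of [l ^ e * b j], [j < a]: the degree [k + e] piece of the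
   invariant flag, with all pieces identified through powers of [l]. *)
Definition flag (a e : nat) (p : S) := exists2 x : 'rV[K]_c,
  (forall j : 'I_c, (a <= j)%N -> x 0 j = 0) & I (p - l ^+ e * lincomb b x).

Lemma flag_subspace a e : subspace (flag a e).
Proof.
split.
  exists 0 => [j _|]; first by rewrite mxE.
  by rewrite lincomb0 mulr0 subr0; apply: subspace0.
move=> t u v [x x0 Ix] [y y0 Iy]; exists (t *: x + y).
  by move=> j aj; rewrite !mxE x0 // y0 // mulr0 addr0.
have -> : t *: u + v - l ^+ e * lincomb b (t *: x + y) =
  t *: (u - l ^+ e * lincomb b x) + (v - l ^+ e * lincomb b y).
  by rewrite lincombD lincombZ -!mul_mpolyC; ring.
by case: sI => _; apply.
Qed.

Lemma flag_ideal a e p : I p -> flag a e p.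
Proof. by exists 0 => [j _|]; rewrite ?mxE // lincomb0 mulr0 subr0. Qed.

Lemma flag_le a a' e p : (a <= a')%N -> flag a e p -> flag a' e p.
Proof.
by move=> aa' [x x0 Ix]; exists x => // j a'j; apply/x0/(leq_trans aa').
Qed.

Lemma flag_mull a e e' p : flag a e p -> flag a (e + e') (l ^+ e' * p).
Proof.
move=> [x x0 Ix]; exists x => //.
have -> : l ^+ e' * p - l ^+ (e + e') * lincomb b x =
   l ^+ e' * (p - l ^+ e * lincomb b x) by rewrite exprD; ring.
exact: idealM hI.1 _.
Qed.

Lemma flag_lincomb a e (x : 'rV[K]_c) : (forall j : 'I_c, (a <= j)%N -> x 0 j = 0) ->
  flag a e (l ^+ e * lincomb b x).
Proof. by move=> x0; exists x; rewrite // subrr; apply: subspace0. Qed.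

Lemma flag_basis (a : 'I_c) e : flag a.+1 e (l ^+ e * b a).
Proof.
rewrite -lincomb_delta; apply: flag_lincomb => j aj.
by rewrite mxE (_ : j == a = false) ?andbF // -val_eqE /= gtn_eqF.
Qed.

Lemma flag_ind a e p g (W : S -> Prop) : subspace W -> (forall q, I q -> W q) ->
  (forall j : 'I_c, (j < a)%N -> W (l ^+ e * (g * b j))) -> flag a e p -> W (g * p).
Proof.
move=> sW IW Wb [x x0 Ix].
have -> : g * p = g * (p - l ^+ e * lincomb b x) + g * (l ^+ e * lincomb b x) by ring.
apply: (subspaceD sW); first by apply: IW; apply: (idealM _ hI.1).
rewrite /lincomb !mulr_sumr; apply: (subspace_sum sW) => j _.
rewrite -!scalerAr mulrCA; have [aj|ja] := leqP a j.
  by rewrite x0 // scale0r; apply: subspace0.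
by apply: (subspaceZ sW); apply: Wb.
Qed.

Lemma flag_mulX i a e p : flag a e p -> flag a e.+1 ('X_i * p).
Proof.
apply: flag_ind; [exact: flag_subspace|exact: flag_ideal|].
move=> j ja; rewrite -add1n; apply: flag_mull.
have [x x0 Ix] := htrig i j.
have sF := flag_subspace a 1.
apply: (subspace_subl sF (v := l * (lam j i *: b j + lincomb b x))); last exact: flag_ideal.
rewrite mulrDr; apply: (subspaceD sF).
  rewrite -scalerAr; apply: (subspaceZ sF); apply: (flag_le ja).
  exact: (flag_basis j 1).
by apply: (@flag_lincomb a 1) => j' aj'; apply: x0; rewrite ltnW // (leq_trans ja).
Qed.

Lemma flag_mulX_eigen i (a : 'I_c) : flag a 1 ('X_i * b a - lam a i *: (l * b a)).
Proof.
have [x x0 Ix] := htrig i a; exists x => //.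
by move: Ix; rewrite mulrDr opprD addrA -scalerAr expr1.
Qed.

Lemma flag_mulXm (a : 'I_c) e (m : 'X_{1..n}) : mdeg m = e ->
  flag a e ('X_[m] * b a - 'X_[m].@[lam a] *: (l ^+ e * b a)).
Proof.
elim: e m => [|e IHe] m.
  move/eqP; rewrite mdeg_eq0 => /eqP ->.
  rewrite mpolyX0 meval1 !mul1r scale1r subrr.
  exact: subspace0 (flag_subspace _ _).
move=> hm.
have [i mi] : exists i, m i != 0%N by apply: mdeg_gt0; rewrite hm.
have Um : (U_(i) <= m)%MM by rewrite lep1mP.
move: hm; rewrite -(submK Um); set m' := (m - _)%MM.
rewrite mdegD mdeg1 addn1 => -[hm'].
rewrite mpolyXD mevalM mevalXU.
have sF := flag_subspace a e.+1.
have -> : 'X_[m'] * 'X_i * b a - ('X_[m'].@[lam a] * lam a i) *: (l ^+ e.+1 * b a) =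
  'X_i * ('X_[m'] * b a - 'X_[m'].@[lam a] *: (l ^+ e * b a)) +
  'X_[m'].@[lam a] *: (l ^+ e * ('X_i * b a - lam a i *: (l * b a))).
  by rewrite -!mul_mpolyC mpolyCM exprS; ring.
apply: (subspaceD sF); first exact/flag_mulX/IHe.
by apply: (subspaceZ sF); rewrite -add1n; apply/flag_mull/flag_mulX_eigen.
Qed.

(** The diagonal entries multiply: on the [a]-th step of the flag a form [p] acts, up to [l ^+ e],
    as the scalar [p.@[lam a]]. This turns eigenvalues into points. *)
Lemma flag_eval (a : 'I_c) e p : p \is e.-homog ->
  flag a e (p * b a - p.@[lam a] *: (l ^+ e * b a)).
Proof.
move=> /dhomogP hp; have sF := flag_subspace a e.
rewrite {1 2}(mpolyE p) mulr_suml raddf_sum /= scaler_suml -sumrB big_seq.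
apply: (subspace_sum sF) => m /hp hm.
rewrite -scalerAl mevalZ -scalerA -scalerBr; apply: (subspaceZ sF).
exact: flag_mulXm.
Qed.

Lemma flag_mulp a e e' p q : q \is e'.-homog -> flag a e p -> flag a (e' + e) (q * p).
Proof.
move=> hq; apply: flag_ind; [exact: flag_subspace|exact: flag_ideal|].
move=> j ja; apply: flag_mull; have sF := flag_subspace a e'.
have := flag_eval j hq.
move/(flag_le (ltnW ja)) => h; apply: (subspace_subl sF _ h).
by apply: (subspaceZ sF); apply: (flag_le ja); apply: flag_basis.
Qed.

(** The diagonal entry of [q] at [a] is zero, so [q] sends this step of the flag into the preceding
    one. *)
Lemma flag_mulp_vanish (a : 'I_c) e e' p q : q \is e'.-homog -> q.@[lam a] = 0 ->
  flag a.+1 e p -> flag a (e' + e) (q * p).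
Proof.
move=> hq q0; apply: flag_ind; [exact: flag_subspace|exact: flag_ideal|].
move=> j; rewrite ltnS leq_eqVlt => /orP[/eqP/val_inj ->|ja]; apply: flag_mull.
  by have := flag_eval a hq; rewrite q0 scale0r subr0.
have sF := flag_subspace a e'.
have := flag_eval j hq.
move/(flag_le (ltnW ja)) => h; apply: (subspace_subl sF _ h).
by apply: (subspaceZ sF); apply: (flag_le ja); apply: flag_basis.
Qed.

Lemma flag_uniq a e (x : 'rV[K]_c) (j : 'I_c) : flag a e (l ^+ e * lincomb b x) ->
  (a <= j)%N -> x 0 j = 0.
Proof.
case: hb => hbk _ hfree [y y0 Iy] aj.
suff xy : x - y = 0 by rewrite -(y0 j aj); move/eqP: xy; rewrite subr_eq0 => /eqP ->.
apply: hfree; apply: (lreg (e := e)); first exact: lincomb_homog.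
by rewrite lincombB mulrC mulrBr.
Qed.

Lemma flag_top p : p \is k.-homog -> flag c 0 p.
Proof.
case: hb => _ hspan _ /hspan[x hx]; exists x; last by rewrite expr0 mul1r.
by move=> j; rewrite leqNgt ltn_ord.
Qed.

(** A form of [I] acts as zero, and its diagonal entries are its values at the [lam a]. *)
Lemma eigen_ideal e q a : q \is e.-homog -> I q -> q.@[lam a] = 0.
Proof.
move=> hq Iq; have sF := flag_subspace a e.
have h : flag a e (l ^+ e * lincomb b (q.@[lam a] *: delta_mx 0 a)).
  rewrite lincombZ lincomb_delta -scalerAr.
  apply: (subspace_subr sF _ (flag_eval a hq)).
  by apply: flag_ideal; apply: idealMr hI.1 Iq.
by have := flag_uniq h (leqnn a); rewrite !mxE !eqxx mulr1.
Qed.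

Lemma eigen_l a : l.@[lam a] = 1.
Proof.
have sF := flag_subspace a 1.
have h : flag a 1 (l ^+ 1 * lincomb b ((1 - l.@[lam a]) *: delta_mx 0 a)).
  rewrite lincombZ lincomb_delta scalerBl scale1r mulrBr -scalerAr expr1.
  by have := flag_eval a hl; rewrite expr1.
have := flag_uniq h (leqnn a); rewrite !mxE !eqxx mulr1 => /eqP.
by rewrite subr_eq0 => /eqP.
Qed.

(** A triangular operator with nonzero diagonal entries is injective. The coordinates of [p] are
    shown to vanish one by one, from the top of the flag down. *)
Lemma eigen_inj e q p : q \is e.-homog -> (forall a, q.@[lam a] != 0) ->
  p \is k.-homog -> I (q * p) -> I p.
Proof.
move=> hq qN0 /flag_top; move: (leqnn c); elim: {1 3}c => [|a IHa] ac.
  move=> [x x0 Ix] _; rewrite -[p]subr0.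
  have x00 : x = 0 by apply/rowP => j; rewrite x0 ?mxE.
  by move: Ix; rewrite x00 lincomb0 mulr0.
move=> hp Iqp; apply: IHa => //; first exact: ltnW.
case: hp => x x0 Ix; exists x => // j; rewrite leq_eqVlt => /orP[|/x0 //].
have aj : (a < c)%N by [].
pose a' := Ordinal aj => /eqP aj'.
have {aj'} -> : j = a' by apply: val_inj.
have sF := flag_subspace a e.
pose x' := x - x 0 a' *: delta_mx 0 a'.
(* The top coordinate of [q * p] is that of [p] times the diagonal entry; it vanishes because
   [q * p] is in [I]. *)
have h : flag a e (l ^+ e * lincomb b ((x 0 a' * q.@[lam a']) *: delta_mx 0 a')).
  rewrite lincombZ lincomb_delta mulrC -scalerAl [b a' * _]mulrC -scalerA.
  apply: (subspace_subr sF (u := q * lincomb b (x 0 a' *: delta_mx 0 a'))); last first.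
    rewrite lincombZ lincomb_delta -scalerAr -scalerBr; apply: (subspaceZ sF).
    exact: (flag_eval a' hq).
  apply: (subspace_subr sF (u := q * p - q * (p - lincomb b x) - q * lincomb b x')).
    apply: (subspaceB sF).
      apply: flag_ideal; apply: (subspaceB sI) => //; apply: (idealM _ hI.1).
      by move: Ix; rewrite expr0 mul1r.
    rewrite -[e]addn0; apply: flag_mulp => //; rewrite -[lincomb b x']mul1r -(expr0 l).
    apply: flag_lincomb => i; rewrite leq_eqVlt => /orP[/eqP ai|ai]; last first.
      have /negPf ia : i != a' by apply: contraTneq ai => ->; rewrite ltnn.
      by rewrite !mxE ia andbF mulr0 subr0 x0.
    have -> : i = a' by apply: val_inj.
    by rewrite !mxE !eqxx mulr1 subrr.
  rewrite [X in flag _ _ X](_ : _ = 0); first exact: subspace0.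
  by rewrite /x' lincombB; ring.
have := flag_uniq (j := a') h (leqnn a); rewrite !mxE !eqxx mulr1 => /eqP.
by rewrite mulf_eq0 (negPf (qN0 _)) orbF => /eqP.
Qed.

(** An analogue of Cayley-Hamilton: applied from the last index down, each factor lowers the flag by
    one step, and after [c] steps the flag is zero. *)
Lemma eigen_nilp (q : 'I_c -> S) (e : 'I_c -> nat) p : (forall a, q a \is (e a).-homog) ->
  (forall a, (q a).@[lam a] = 0) -> p \is k.-homog -> I ((\prod_a q a) * p).
Proof.
move=> hq q0 /flag_top.
suff H a : (a <= c)%N -> flag c 0 p ->
    exists e, flag (c - a) e ((\prod_(j < c | (c - a <= j)%N) q j) * p).
  move=> /(H c (leqnn c)); rewrite subnn => -[e' [x x0 Ix]].
  have x00 : x = 0 by apply/rowP => j; rewrite x0 ?mxE.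
  by move: Ix; rewrite x00 lincomb0 mulr0 subr0.
move=> + hp; elim: a => [_|a IHa ac].
  exists 0%N; rewrite subn0 big_pred0 ?mul1r // => j.
  by rewrite leqNgt ltn_ord.
have [e' he'] := IHa (ltnW ac).
have ltc : (c - a.+1 < c)%N by rewrite ltn_subrL (leq_trans _ ac).
pose j0 := Ordinal ltc.
have j0S : j0.+1 = (c - a)%N by rewrite /= -subSn // subSS.
exists (e j0 + e')%N; rewrite (bigD1 j0) //= -mulrA.
apply: (flag_mulp_vanish (a := j0) (hq j0) (q0 j0)); rewrite j0S.
rewrite (eq_bigl (fun j : 'I_c => (c - a <= j)%N)) // => j.
by rewrite -j0S /= ltn_neqAle andbC -val_eqE /= eq_sym.
Qed.

End Filtration.

Lemma poly_nonroot (K : numFieldType) (p : {poly K}) : p != 0 -> exists t, ~~ root p t.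
Proof.
move=> pN0; apply: contrapT => /forallNP h.
have := @max_poly_roots _ p [seq i%:R | i <- iota 0 (size p)] pN0.
rewrite size_map size_iota ltnn => hroots; suff: false by []; apply: hroots.
  by apply/allP => x _; have /negP := h x; rewrite negbK.
rewrite map_inj_uniq ?iota_uniq // => i j /eqP.
by rewrite eqr_nat => /eqP.
Qed.

(** Each condition says that [t] is not a root of a nonzero polynomial with coefficients [u a i]; a
    nonroot of the product satisfies all of them. *)
Lemma generic_power (K : numFieldType) (M N : nat) (u : 'I_M -> 'I_N -> K) :
  (forall a, exists i, u a i != 0) ->
  exists t : K, forall a, \sum_(i < N) t ^+ i * u a i != 0.
Proof.
move=> uN0.
pose v a (i : nat) : K := if insub i is Some j then u a j else 0.
pose p a := \poly_(i < N) v a i.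
have vE a (i : 'I_N) : v a i = u a i by rewrite /v valK.
have pN0 : \prod_a p a != 0.
  apply/prodf_neq0 => a _; have [i ui] := uN0 a.
  apply/eqP => /polyP/(_ i); rewrite coef_poly ltn_ord vE coef0 => ui0.
  by rewrite ui0 eqxx in ui.
have [t ht] := poly_nonroot pN0.
exists t => a; apply: contraNneq ht => pa0.
rewrite /root horner_prod; apply/prodf_eq0; exists a => //.
rewrite /p horner_poly -[X in _ == X]pa0; apply/eqP/eq_bigr => i _.
by rewrite vE mulrC.
Qed.

(** * Points of an ideal, generic nonzerodivisors and colength *)

Section EigenPoints.
Variables (K : numClosedFieldType) (n : nat).
Notation S := {mpoly K[n]}.

(* The [lam a] are the points of [I], normalized by [l = 1] and repeated according to
   their multiplicities. *)
Lemma eigen_points (I : S -> Prop) (l : S) (k0 : nat) :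
  hom_ideal I -> l \is 1.-homog ->
  (forall k, (k0 <= k)%N -> HF (addI I l) k = 0%N) ->
  exists k1 c (lam : 'I_c -> 'I_n -> K),
    [/\ forall a, l.@[lam a] = 1,
        forall e q a, q \is e.-homog -> I q -> q.@[lam a] = 0,
        forall e q k p, (k1 <= k)%N -> q \is e.-homog ->
          (forall a, q.@[lam a] != 0) -> p \is k.-homog -> I (q * p) -> I p,
        forall (q : 'I_c -> S) e p, (forall a, q a \is (e a).-homog) ->
          (forall a, (q a).@[lam a] = 0) -> p \is k1.-homog -> I ((\prod_a q a) * p) &
        forall k, (k1 <= k)%N -> HF I k = c].
Proof.
move=> hI hl h0; have [k1 k01 hk1] := HF_stable hI hl h0.
have sI := hom_ideal_subspace hI.
have lreg e k p : (k1 <= k)%N -> p \is k.-homog -> I (p * l ^+ e) -> I p.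
  elim: e k p => [|e IHe] k p k1k hp; first by rewrite expr0 mulr1.
  rewrite exprS mulrA => /(IHe k.+1); have [_ _ h] := hk1 k k1k.
  move=> Ip; apply: h => //; apply: Ip; first exact: ltnW.
  by rewrite -addn1; apply: dhomogM.
have ldiv e p : p \is (k1 + e).-homog ->
    exists2 q, q \is k1.-homog & I (p - q * l ^+ e).
  elim: e p => [|e IHe] p.
    by rewrite addn0 => hp; exists p => //; rewrite mulr1 subrr; apply: subspace0.
  rewrite addnS => hp; have [_ + _] := hk1 (k1 + e)%N (leq_addr _ _).
  move=> /(_ p hp)[q /IHe[r hr Ir] Iq]; exists r => //.
  have -> : p - r * l ^+ e.+1 = (p - q * l) + l * (q - r * l ^+ e) by rewrite exprS; ring.
  by apply: (subspaceD sI) => //; apply: idealM hI.1 _.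
have ldiv1 p : p \is k1.+1.-homog -> exists2 q, q \is k1.-homog & I (p - q * l).
  by move=> hp; have [_ + _] := hk1 k1 (leqnn _); apply.
have lreg1 e p : p \is k1.-homog -> I (p * l ^+ e) -> I p by apply: lreg.
have [b [lam [hb ht]]] := triangular_basis hI ldiv1 lreg1.
exists k1, (HF I k1), lam; split.
- move=> a; apply: (eigen_l hI hl lreg1 hb ht a).
- by move=> e q a hq Iq; apply: (eigen_ideal hI lreg1 hb ht a hq Iq).
- move=> e q k p k1k hq qN0 hp Iqp.
  have := ldiv (k - k1)%N p; rewrite subnKC // => /(_ hp)[r hr Ir].
  suff Ir' : I r by apply: (subspace_subl sI _ Ir); apply: idealMr hI.1 _.
  apply: (eigen_inj hI lreg1 hb ht hq qN0 hr).
  apply: (lreg (k - k1)%N (k1 + e)%N); first exact: leq_addr.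
    by rewrite addnC; apply: dhomogM.
  have -> : q * r * l ^+ (k - k1) = q * p - q * (p - r * l ^+ (k - k1)) by ring.
  by apply: (subspaceB sI) => //; apply: idealM hI.1 _.
- by move=> q e p hq q0 hp; apply: (eigen_nilp hI hb ht hq q0 hp).
- by move=> k /hk1[].
Qed.

(** Only the finitely many eigenvalues have to be avoided, since a form vanishing at none of them is
    injective on [S/I] in large degree. The hypothesis on [y] is needed only at points of [I]
    normalized by [l = 1]. *)
Lemma generic_nzd (I : S -> Prop) (l : S) (k0 N e : nat) (y : 'I_N -> S) :
  hom_ideal I -> l \is 1.-homog -> nzd I l ->
  (forall k, (k0 <= k)%N -> HF (addI I l) k = 0%N) ->
  (forall i, y i \is e.-homog) ->
  (forall w, l.@[w] = 1 -> (forall d q, q \is d.-homog -> I q -> q.@[w] = 0) ->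
     exists i, (y i).@[w] != 0) ->
  exists t : K, nzd I (\sum_(i < N) t ^+ i *: y i).
Proof.
move=> hI hl nl h0 hy yN0; have sI := hom_ideal_subspace hI.
have [k1 [c [lam [laml lamI lamreg _ _]]]] := eigen_points hI hl h0.
have [t ht] : exists t : K, forall a, \sum_(i < N) t ^+ i * (y i).@[lam a] != 0.
  apply: generic_power => a; apply: yN0 => // d q hq Iq; exact: lamI hq Iq.
exists t; set g := \sum_(i < N) _.
have hg : g \is e.-homog by apply: rpred_sum => i _; apply: dhomogZ.
apply: (nzd_homog hI hg) => k p hp Ipg.
have nle j q : I (q * l ^+ j) -> I q.
  by elim: j q => [|j IHj] q; rewrite ?mulr1 // exprSr mulrA => /nl /IHj.
(* [lamreg] starts at degree [k1]; multiplication by [l ^+ k1] reaches it and is cancelled because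
   [l] is regular. *)
apply: (nle k1); apply: (lamreg e g (k + k1)%N) => //; first exact: leq_addl.
- move=> a; rewrite /g raddf_sum /=; under eq_bigr do rewrite mevalZ.
  exact: ht.
- by apply: dhomogM => //; have := dhomogMn k1 hl; rewrite mul1n.
- by rewrite mulrA [g * p]mulrC; apply: idealMr hI.1 _.
Qed.

(* [S / I] has finite dimension [D]. *)
Definition colength (I : S -> Prop) (D : nat) :=
  exists N, forall M, (N <= M)%N -> (\sum_(k < M) HF I k = D)%N.

Lemma colength_HF0 (I : S -> Prop) D : colength I D ->
  exists k0, forall k, (k0 <= k)%N -> HF I k = 0%N.
Proof.
move=> [N hN]; exists N => k Nk; have := hN k.+1 (leqW Nk).
by rewrite big_ord_recr /= hN // => /eqP; rewrite -[X in _ == X]addn0 eqn_add2l => /eqP.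
Qed.

Lemma HF_sum_nzd (I : S -> Prop) e g M : hom_ideal I -> g \is e.-homog -> nzd I g ->
  (\sum_(k < M + e) HF I k = \sum_(k < M + e) HF (addI I g) k + \sum_(k < M) HF I k)%N.
Proof.
move=> hI hg ng; elim: M => [|M IHM].
  rewrite add0n big_ord0 addn0; apply: eq_bigr => k _.
  by rewrite (HF_addI_low hI hg).
by rewrite addSn !big_ord_recr /= IHM (HF_nzd M hI hg ng) addnACA.
Qed.

(** For [l] of degree 1 the differences of [HF I] are the values for [I + (l)], so [HF I] becomes
    the sum of the latter. *)
Lemma colength_HF (I : S -> Prop) D l : hom_ideal I -> l \is 1.-homog -> nzd I l ->
  colength (addI I l) D -> exists N, forall k, (N <= k)%N -> HF I k = D.
Proof.
move=> hI hl nl [N hN]; exists N => k Nk.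
have := HF_sum_nzd k hI hl nl; rewrite addn1 big_ord_recr /= hN ?leqW // addnC.
by move/eqP; rewrite eqn_add2r => /eqP.
Qed.

(** Summation of [HF_nzd] telescopes: for [I + (g)] there remain the last [e] values of [HF I], all
    eventually equal to [D]. This is one step of Bezout's theorem. *)
Lemma colength_exchange (I : S -> Prop) D l e g : hom_ideal I -> l \is 1.-homog -> nzd I l ->
  g \is e.-homog -> nzd I g ->
  colength (addI I l) D -> colength (addI I g) (e * D).
Proof.
move=> hI hl nl hg ng hD; have [N hN] := colength_HF hI hl nl hD.
exists (N + e)%N => M NM; have eM : (e <= M)%N by lia.
have := HF_sum_nzd (M - e) hI hg ng; rewrite subnK // => h.
have : (\sum_(k < M) HF I k = \sum_(k < M - e) HF I k + e * D)%N.
  rewrite -[in LHS](subnK eM) big_split_ord /=; congr (_ + _)%N.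
  rewrite (eq_bigr (fun=> D)); first by rewrite sum_nat_const card_ord.
  by move=> i _; apply: hN; lia.
by rewrite h addnC; lia.
Qed.

End EigenPoints.

(** * Regular families of forms *)

Section RegularFamilies.
Variables (K : fieldType) (n m : nat).
Notation S := {mpoly K[n]}.
Implicit Types (L : 'I_m -> S) (T : {set 'I_m}).

Definition idl T L : S -> Prop :=
  fun p => exists q : 'I_m -> S, p = \sum_(i in T) q i * L i.

(* A regular sequence in every order, so that its members can be exchanged. *)
Definition regular_family L := forall T j, j \notin T -> nzd (idl T L) (L j).

Definition upd L (j : 'I_m) g : 'I_m -> S := fun i => if i == j then g else L i.

Lemma idl_ideal T L : is_ideal (idl T L).
Proof.
split.
- by exists (fun=> 0); rewrite big1 // => i _; rewrite mul0r.
- move=> _ _ [p ->] [q ->]; exists (fun i => p i + q i).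
  by rewrite -big_split; apply: eq_bigr => i _; rewrite mulrDl.
- move=> p _ [q ->]; exists (fun i => p * q i).
  by rewrite mulr_sumr; apply: eq_bigr => i _; rewrite mulrA.
Qed.

Lemma idl_gen T L i : i \in T -> idl T L (L i).
Proof.
move=> iT; exists (fun j => (j == i)%:R); rewrite (bigD1 i) //= eqxx mul1r.
by rewrite big1 ?addr0 // => j /andP[_ /negPf ->]; rewrite mul0r.
Qed.

Lemma idl_hom T L (e : 'I_m -> nat) : (forall i, L i \is (e i).-homog) ->
  hom_ideal (idl T L).
Proof.
move=> hL; split; first exact: idl_ideal.
move=> k _ [q ->]; rewrite raddf_sum /=.
apply: (subspace_sum (ideal_subspace (idl_ideal T L))) => i iT.
have [ke|ek] := ltnP k (e i).
  by rewrite (pihomogM0 _ (hL i)) //; case: (idl_ideal T L).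
rewrite -(subnK ek) (pihomogM _ _ (hL i)).
by apply: idealM (idl_gen _ iT); apply: idl_ideal.
Qed.

Lemma idl_setU1 T L j : j \notin T -> idl (j |: T) L = addI (idl T L) (L j).
Proof.
move=> jT; apply/predeqP => p; split=> [[q ->]|[q [r hr]]].
  rewrite big_setU1 //=; exists (q j); exists q.
  by rewrite addrAC subrr add0r.
exists (fun i => if i == j then q else r i); rewrite big_setU1 //= eqxx.
rewrite -[p](subrK (q * L j)) addrC hr; congr (_ + _).
by apply: eq_bigr => i iT; case: eqP iT jT => // -> ->.
Qed.

Lemma eq_idl T L L' : {in T, L =1 L'} -> idl T L = idl T L'.
Proof.
move=> LL'; apply/predeqP => p; split=> -[q ->]; exists q;
  by apply: eq_bigr => i iT; rewrite LL'.
Qed.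

Lemma idl_upd T L j g : j \notin T -> idl T (upd L j g) = idl T L.
Proof.
by move=> jT; apply: eq_idl => i iT; rewrite /upd; case: eqP iT jT => // -> ->.
Qed.

Lemma idl_min T L (I : S -> Prop) p : is_ideal I -> (forall i, i \in T -> I (L i)) ->
  idl T L p -> I p.
Proof.
move=> iI IL [q ->]; apply: (subspace_sum (ideal_subspace iI)) => i iT.
by apply: idealM iI _; apply: IL.
Qed.

(** By descending induction on [T], [nzd_descend] carries the regularity of [g] from the ideal of
    all other members to every smaller one; [nzd_swap] then gives the regularity of the old members
    modulo ideals containing [g]. *)
Lemma regular_family_upd L (e : 'I_m -> nat) j d g :
  (forall i, L i \is (e i).-homog) -> (forall i, (0 < e i)%N) ->
  g \is d.-homog -> regular_family L -> nzd (idl (~: [set j]) L) g ->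
  regular_family (upd L j g).
Proof.
move=> hL e0 hg rL ng.
have nzg T : j \notin T -> nzd (idl T L) g.
  move: {2}#|~: T| (leqnn #|~: T|) => N; elim: N T => [|N IHN] T.
    rewrite leqn0 cards_eq0 => /eqP T0 jT.
    by have := finset.in_set0 j; rewrite -T0 inE jT.
  move=> TN jT; have [Tj|] := eqVneq T (~: [set j]); first by rewrite Tj.
  move=> nTj; have [h hT hj] : exists2 h, h \notin T & h != j.
    apply/exists2P; apply: contrapT => nh; case/eqP: nTj.
    apply/setP => i; rewrite !inE; apply/idP/idP => [iT|ij].
      by apply: contraNneq jT => <-.
    by apply: contrapT => /negP iT; apply: nh; exists i.
  apply: (nzd_descend (idl_hom T hL) (hL h) (e0 h) hg (rL _ _ hT)).
  rewrite -idl_setU1 //; apply: IHN; last by rewrite !inE negb_or eq_sym hj.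
  move: TN; rewrite (cardsD1 h) inE hT add1n ltnS; apply: leq_trans.
  by apply: subset_leq_card; apply/fintype.subsetP => i; rewrite !inE negb_or.
move=> T h hT; have [jT|jT] := boolP (j \in T); last first.
  rewrite idl_upd // /upd; case: eqP => [_|_]; [exact: nzg|exact: rL].
have hj : h != j by apply: contraNneq hT => ->.
pose T' := T :\ j.
have jT' : j \notin T' by rewrite !inE eqxx.
have hT' : h \notin T' by rewrite !inE negb_and negbK hT orbT.
rewrite -(finset.setD1K jT) -/T' idl_setU1 // idl_upd // /upd (negPf hj) eqxx.
apply: (nzd_swap (idl_ideal _ _)); first exact: rL.
by rewrite -idl_setU1 //; apply: nzg; rewrite !inE negb_or eq_sym hj negb_and eqxx.
Qed.

End RegularFamilies.

(** * Exchange of linear members for forms of higher degree *)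

Section Exchange.
Variables (K : numClosedFieldType) (n m : nat).
Notation S := {mpoly K[n]}.
Implicit Types (L : 'I_m -> S).

Lemma meval0_homog e (p : S) w : (0 < e)%N -> p \is e.-homog -> (forall i, w i = 0) ->
  p.@[w] = 0.
Proof.
move=> e0 /dhomogP hp w0; rewrite mevalE big_seq big1 // => k /hp kp.
have [i ki] : exists i, k i != 0%N by apply: mdeg_gt0; rewrite (kp : mdeg k = e).
by rewrite (bigD1 i) //= w0 expr0n (negPf ki) mul0r mulr0.
Qed.

Section OneStep.
Variables (L : 'I_m -> S) (e : 'I_m -> nat) (j : 'I_m) (d D : nat).
Hypotheses (hL : forall i, L i \is (e i).-homog) (e_gt0 : forall i, (0 < e i)%N).
Hypotheses (ej : e j = 1%N) (rL : regular_family L).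
Hypothesis lL : colength (idl finset.setT L) D.

Let Q := idl (~: [set j]) L.

Let jQ : j \notin ~: [set j]. Proof. by rewrite !inE eqxx. Qed.

Let hQ : hom_ideal Q := idl_hom _ hL.

Let hLj : L j \is 1.-homog. Proof. by rewrite -ej. Qed.

Let QT : idl finset.setT L = addI Q (L j).
Proof. by rewrite -idl_setU1 // finset.setUCr. Qed.

Let nQ : nzd Q (L j) := rL jQ.

Lemma regular_upd g : g \is d.-homog -> nzd Q g ->
  regular_family (upd L j g) /\ colength (idl finset.setT (upd L j g)) (d * D).
Proof.
move=> hg ng; split; first exact: (regular_family_upd hL e_gt0 hg rL ng).
have -> : idl finset.setT (upd L j g) = addI Q g.
  by rewrite -(finset.setUCr [set j]) idl_setU1 // idl_upd // /upd eqxx.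
by apply: (colength_exchange hQ hLj nQ hg ng); rewrite -QT.
Qed.

Lemma regular_generic_nzd N (y : 'I_N -> S) : (forall i, y i \is d.-homog) ->
  (forall w, (exists i, w i != 0) -> (forall i, i != j -> (L i).@[w] = 0) ->
     exists i, (y i).@[w] != 0) ->
  exists t : K, nzd Q (\sum_(i < N) t ^+ i *: y i).
Proof.
move=> hy yN0; have [k0 hk0] := colength_HF0 lL.
apply: (generic_nzd hQ hLj nQ (k0 := k0)) => // [k|w Ljw Qw].
  by rewrite -QT; apply: hk0.
apply: yN0.
  apply: contrapT => /forallNP w0; have : (L j).@[w] = 0.
    by apply: (meval0_homog _ hLj) => // i; apply/eqP; have /negP := w0 i; rewrite negbK.
  by rewrite Ljw => /eqP; rewrite oner_eq0.
by move=> i ij; apply: (Qw (e i)) => //; apply: idl_gen; rewrite !inE.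
Qed.

Lemma regular_exchange1 g : g \is d.-homog ->
  (forall w, (exists i, w i != 0) -> (forall i, i != j -> (L i).@[w] = 0) -> g.@[w] != 0) ->
  regular_family (upd L j g) /\ colength (idl finset.setT (upd L j g)) (d * D).
Proof.
move=> hg gN0; apply: regular_upd => //.
have [//||t] := @regular_generic_nzd 1 (fun=> g); last by rewrite big_ord1 expr0 scale1r.
by move=> w wN0 Lw; exists ord0; apply: gN0.
Qed.

End OneStep.

(** The members to be replaced have degree 1 because each one, before its exchange, is the linear
    form normalizing the eigenvalues. Each exchange multiplies the colength by [d]. The condition on
    zeros mentions only the members that stay, hence survives the induction. *)
Lemma regular_exchange N (y : 'I_N -> S) d (s : seq 'I_m) L (e : 'I_m -> nat) D :
  (forall i, L i \is (e i).-homog) -> (forall i, (0 < e i)%N) -> (0 < d)%N ->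
  (forall i, y i \is d.-homog) -> uniq s -> {in s, forall i, e i = 1%N} ->
  regular_family L -> colength (idl finset.setT L) D ->
  (forall w, (exists i, w i != 0) -> (forall i, i \notin s -> (L i).@[w] = 0) ->
     exists i, (y i).@[w] != 0) ->
  exists C : 'I_m -> 'I_N -> K,
    let L' i := if i \in s then \sum_k C i k *: y k else L i in
    regular_family L' /\ colength (idl finset.setT L') (d ^ size s * D).
Proof.
move=> hL e0 d0 hy; elim: s => [|j s IHs] /=.
  by move=> _ _ rL lL _; exists (fun _ _ => 0); rewrite mul1n.
move=> /andP[js us] e1 rL lL yN0.
have [||C] := IHs us _ rL lL.
- by move=> i si; apply: e1; rewrite inE si orbT.
- move=> w wN0 Lw; apply: yN0 => // i; rewrite inE negb_or => /andP[_]; exact: Lw.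
set L' := fun i => _; move=> [rL' lL'].
pose e' i := if i \in s then d else e i.
have hL' i : L' i \is (e' i).-homog.
  by rewrite /L' /e'; case: ifP => // _; apply: rpred_sum => k _; apply: dhomogZ.
have e'0 i : (0 < e' i)%N by rewrite /e'; case: ifP.
have L'j : L' j = L j by rewrite /L' (negPf js).
have e'j : e' j = 1%N by rewrite /e' (negPf js) e1 ?mem_head.
have [|t nt] := regular_generic_nzd hL' e'j rL' lL' hy.
  move=> w wN0 L'w; apply: yN0 => // i; rewrite inE negb_or => /andP[ij si].
  by have := L'w i ij; rewrite /L' (negPf si).
set g := \sum_(k < N) _ in nt.
have hg : g \is d.-homog by apply: rpred_sum => k _; apply: dhomogZ.
pose C' i := if i == j then (fun k : 'I_N => t ^+ k) else C i.
exists C'; set L'' := fun i => _.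
have -> : L'' = upd L' j g.
  apply/funext => i; rewrite /L'' /upd /L' /C' inE; case: eqP => //= ->.
rewrite expnS -mulnA; exact: (regular_upd hL' e'0 e'j rL' lL' hg nt).
Qed.

End Exchange.

Lemma comp_mpoly_congr (K : fieldType) (n : nat) (I : {mpoly K[n]} -> Prop)
    (t : n.-tuple {mpoly K[n]}) : is_ideal I ->
  (forall i, I ('X_i - tnth t i)) -> forall q, I (q - (q \mPo t)).
Proof.
move=> iI It; have sI := ideal_subspace iI.
elim/mpolyind => [|c m q _ _ IHq]; first by rewrite comp_mpoly0 subrr; apply: subspace0.
rewrite comp_mpolyD opprD addrACA; apply: (subspaceD sI) => //.
rewrite comp_mpolyZ -scalerBr; apply: (subspaceZ sI) => {c q IHq}.
move: {2}(mdeg m) (erefl (mdeg m)) => e; elim: e m => [|e IHe] m hm.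
  have -> : m = 0%MM by apply/eqP; rewrite -mdeg_eq0 hm.
  by rewrite mpolyX0 comp_mpoly1 subrr; apply: subspace0.
have [i mi] : exists i, m i != 0%N by apply: mdeg_gt0; rewrite hm.
have Um : (U_(i) <= m)%MM by rewrite lep1mP.
rewrite -(submK Um); set m' := (m - _)%MM.
have hm' : mdeg m' = e by move: hm; rewrite -(submK Um) mdegD mdeg1 addn1 => -[].
rewrite mpolyXD rmorphM /= comp_mpolyXU -tnth_nth.
have -> : 'X_[m'] * 'X_i - ('X_[m'] \mPo t) * tnth t i =
  ('X_[m'] - ('X_[m'] \mPo t)) * 'X_i + ('X_[m'] \mPo t) * ('X_i - tnth t i) by ring.
apply: (subspaceD sI); first by apply: idealMr => //; apply: IHe.
exact: idealM.
Qed.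

Section CoordinateForms.
Variables (K : numClosedFieldType) (n : nat).
Notation S := {mpoly K[n]}.
Notation X := (fun i : 'I_n => 'X_i : S).

(** Setting the variables of [T] to zero changes a polynomial only modulo [idl T X], and the result
    lives in a domain where ['X_j] is nonzero. *)
Lemma regular_variables : regular_family X.
Proof.
move=> T j jT p.
pose t := [tuple (if i \in T then 0 else 'X_i : S) | i < n].
have key q : idl T X (q - (q \mPo t)).
  have iI := idl_ideal T X.
  apply: comp_mpoly_congr => // i; rewrite tnth_mktuple; case: ifP => iT.
    by rewrite subr0; apply: (idl_gen X).
  by rewrite subrr; apply: subspace0 (ideal_subspace iI).
move=> [q hq].
suff p0 : p \mPo t = 0 by rewrite -[p]subr0 -p0.
have : (p * 'X_j) \mPo t = 0.
  rewrite hq raddf_sum big1 //= => i iT.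
  by rewrite rmorphM /= comp_mpolyXU -tnth_nth tnth_mktuple iT mulr0.
rewrite rmorphM /= comp_mpolyXU -tnth_nth tnth_mktuple (negPf jT) => /eqP.
rewrite mulf_eq0 => /orP[/eqP //|].
by rewrite -msize_poly_eq0 msizeX.
Qed.

Lemma colength_variables : colength (idl finset.setT X) 1.
Proof.
have hX : hom_ideal (idl finset.setT X).
  by apply: (@idl_hom _ _ _ _ _ (fun=> 1%N)) => i; rewrite dhomogX; apply/eqP/mdeg1.
have sX := hom_ideal_subspace hX; have iX := hX.1.
exists 1%N => M; case: M => // M _; rewrite big_ord_recl /=.
have -> : HF (idl finset.setT X) 0 = 1%N.
  apply: (HF_qdim sX); apply: (indep_span_qdim sX (v := fun=> 1)).
  - by move=> _; apply: dhomog1.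
  - move=> u hu; exists (const_mx u@_0%MM); rewrite big_ord1 mxE.
    suff -> : u = (u@_0%MM)%:A by rewrite mcoeffZ mcoeff1 eqxx mulr1 subrr; apply: subspace0.
    rewrite alg_mpolyC; apply: msize1_polyC.
    by rewrite msizeE; apply/bigmax_leqP_seq => m /(dhomogP _ _ _ hu) ->.
  - move=> x; rewrite big_ord1 => -[q] /(congr1 (fun p => p.@[fun=> 0])).
    rewrite mevalZ meval1 mulr1 raddf_sum big1 //= => [x0|i _].
      by apply/rowP => i; rewrite ord1 x0 mxE.
    by rewrite mevalM mevalXU mulr0.
rewrite big1 ?addn0 // => k _; apply/(HF_eq0 _ sX) => p /dhomogP hp.
rewrite (mpolyE p) big_seq; apply: (subspace_sum sX) => m /hp hm.
apply: (subspaceZ sX).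
have [i mi] : exists i, m i != 0%N by apply: mdeg_gt0; rewrite (hm : mdeg m = _).
have Um : (U_(i) <= m)%MM by rewrite lep1mP.
rewrite -(submK Um) mpolyXD; apply: (idealM _ iX).
by apply: (idl_gen X); rewrite inE.
Qed.

End CoordinateForms.

(** * Affine charts *)

Lemma mpoly_nonvanishing (K : numFieldType) n (p : {mpoly K[n]}) :
  p != 0 -> exists v, p.@[v] != 0.
Proof.
elim: n p => [|n IHn] p pN0.
  by exists (fun=> 0); rewrite (nvar0_mpolyC p) mevalC -(mpolyC_eq0 0) -nvar0_mpolyC.
have mN0 : muni p != 0.
  have := mlead_supp pN0; set m0 := mlead p; rewrite mcoeff_msupp => pm0.
  apply: contraNneq pm0 => /polyP/(_ (m0 ord_max)).
  rewrite coef0 muniE coef_sum => /(congr1 (mcoeff [multinom m0 (widen_ord (leqnSn n) i) | i < n])).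
  rewrite mcoeff0 raddf_sum /= => <-.
  rewrite (bigD1_seq m0) ?msupp_uniq ?mlead_supp //= [X in _ + X]big1; last first.
    move=> m mm0; rewrite coefZ coefXn.
    case: eqP => [e|]; last by rewrite mulr0 mcoeff0.
    rewrite mulr1 mcoeffZ mcoeffX; case: eqP => [e'|]; last by rewrite mulr0.
    case/eqP: mm0; apply/mnmP => i; case: (unliftP ord_max i) => [j|] -> //.
    have -> : lift ord_max j = widen_ord (leqnSn n) j by apply: val_inj; exact: lift_max.
    by move/mnmP/(_ j) : e'; rewrite !mnmE.
  by rewrite coefZ coefXn eqxx mulr1 mcoeffZ mcoeffX eqxx mulr1 addr0.
have [i pi] : exists i, (muni p)`_i != 0.
  by exists (size (muni p)).-1; rewrite -lead_coefE lead_coef_eq0.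
have [v hv] := IHn _ pi.
have [t ht] : exists t, ~~ root (map_poly (meval v) (muni p)) t.
  have qN0 : map_poly (meval v) (muni p) != 0.
    by apply: contraNneq hv => /polyP/(_ i); rewrite coef_map coef0 => ->.
  exact: poly_nonroot.
exists (fun j => if unlift ord_max j is Some k then v k else t).
apply: contraNneq ht => pv0; rewrite /root -[X in _ == X]pv0.
rewrite muniE rmorph_sum /= horner_sum mevalE; apply/eqP/eq_bigr => m _.
rewrite -mul_polyC rmorphM /= map_polyC /= map_polyXn hornerM hornerC hornerXn.
rewrite mevalZ mevalX big_ord_recr /= -mulrA unlift_none; congr (_ * (_ * _)).
apply: eq_bigr => j _; rewrite mnmE.
have -> : widen_ord (leqnSn n) j = lift ord_max j by apply/val_inj/esym/lift_max.
by rewrite liftK.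
Qed.

Lemma mpoly_eval_eq (K : numFieldType) n (p q : {mpoly K[n]}) :
  (forall v, p.@[v] = q.@[v]) -> p = q.
Proof.
move=> pq; apply/eqP; rewrite -subr_eq0; apply: contrapT => /negP/mpoly_nonvanishing[v].
by rewrite mevalB pq subrr eqxx.
Qed.

(** Identities about homogenizations can thus be verified by evaluation where division by the pivot
    coordinate makes sense. *)
Lemma mpoly_eval_eqW (K : numFieldType) n (p q : {mpoly K[n]}) i :
  (forall v, v i != 0 -> p.@[v] = q.@[v]) -> p = q.
Proof.
move=> pq; have XN0 : 'X_i != 0 :> {mpoly K[n]}.
  by rewrite -msize_poly_eq0 msizeX.
apply: (mulIf XN0); apply: mpoly_eval_eq => v; rewrite !mevalM mevalXU.
by have [->|/pq -> //] := eqVneq (v i) 0; rewrite !mulr0.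
Qed.

Lemma submm n (m : 'X_{1..n}) : (m - m)%MM = 0%MM.
Proof. by apply/mnmP => i; rewrite mnmBE subnn mnm0E. Qed.

Section DegreeBounds.
Variables (K : fieldType) (n : nat).
Implicit Types (p q : {mpoly K[n]}).

Lemma meval_homogZ e p c v : p \is e.-homog ->
  p.@[fun i => c * v i] = c ^+ e * p.@[v].
Proof.
move=> /dhomogP hp; rewrite !mevalE mulr_sumr !big_seq; apply: eq_bigr => m /hp hm.
rewrite mulrCA; congr (_ * _).
under eq_bigr do rewrite exprMn.
by rewrite big_split /= -expr_sum -mdegE (hm : mdeg m = e).
Qed.

Lemma homog_msize_le e p : p \is e.-homog -> (msize p <= e.+1)%N.
Proof.
by move=> hp; rewrite msizeE; apply/bigmax_leqP_seq => m /(dhomogP _ _ _ hp) ->.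
Qed.

Lemma msizeM_leq a b p q : (msize p <= a.+1)%N -> (msize q <= b.+1)%N ->
  (msize (p * q) <= (a + b).+1)%N.
Proof.
move=> pa qb; have [->|pN0] := eqVneq p 0; first by rewrite mul0r msize0.
have [->|qN0] := eqVneq q 0; first by rewrite mulr0 msize0.
rewrite msizeM //; move: pa qb; move: (msize p) (msize q) => x y; lia.
Qed.

Lemma msizeD_leq a p q : (msize p <= a)%N -> (msize q <= a)%N -> (msize (p + q) <= a)%N.
Proof. by move=> pa qa; apply: leq_trans (msizeD_le _ _) _; rewrite geq_max pa. Qed.

Lemma msize_sum_leq (I : Type) (r : seq I) (P : pred I) (F : I -> {mpoly K[n]}) a :
  (forall i, P i -> (msize (F i) <= a)%N) -> (msize (\sum_(i <- r | P i) F i) <= a)%N.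
Proof.
move=> h; elim/big_rec: _ => [|i p Pi hp]; first by rewrite msize0.
by apply: msizeD_leq => //; apply: h.
Qed.

Lemma msizeX_leq p a e : (msize p <= a.+1)%N -> (msize (p ^+ e) <= (a * e).+1)%N.
Proof.
move=> pa; elim: e => [|e IHe]; first by rewrite expr0 msize1 muln0.
by rewrite exprS mulnS; apply: msizeM_leq.
Qed.

Lemma mderiv_homog d p i : p \is d.-homog -> p^`M(i) \is d.-1.-homog.
Proof.
move=> /dhomogP hp; apply/dhomogP => m; rewrite mcoeff_msupp mcoeff_deriv => h.
have : (m + U_(i))%MM \in msupp p.
  by rewrite mcoeff_msupp; apply: contraNneq h => ->; rewrite mul0rn.
by move/hp; rewrite /= mdegD mdeg1 addn1 => <-.
Qed.

Lemma Euler_formula d p : p \is d.-homog -> \sum_i 'X_i * p^`M(i) = d%:R * p.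
Proof.
move=> /dhomogP hp.
rewrite (mpolyE p); under eq_bigr do rewrite raddf_sum mulr_sumr /=.
rewrite exchange_big /= mulr_sumr !big_seq; apply: eq_bigr => m /hp hm.
rewrite -scalerAr -mpolyC_nat mul_mpolyC -(hm : mdeg m = d).
under eq_bigr do rewrite mderivZ -scalerAr mderivX -scalerAr.
rewrite -scaler_sumr; congr (_ *: _).
rewrite mdegE natr_sum scaler_suml; apply: eq_bigr => i _.
have [->|mi] := eqVneq (m i) 0%N; first by rewrite !scale0r.
by rewrite -mpolyXD addmC submK // lep1mP.
Qed.

End DegreeBounds.

(** * Dehomogenization at a point and its inverse *)

Section Charts.
Variables (K : numFieldType) (n : nat) (piv : 'I_n.+1) (p : 'I_n.+1 -> K).
Notation S := {mpoly K[n.+1]}.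
Notation A := {mpoly K[n]}.
Hypothesis ppiv : p piv = 1.

(** [chart (pivot p) (p 0)] is convertible to [local_equation] at [p], while the chart [x_0 = 1]
    centred at the origin recovers [g] from [f]; one theory serves both. *)
Definition chart (F : S) : A :=
  F \mPo [tuple (p j)%:MP + (if unlift piv j is Some k then 'X_k else 0) | j < n.+1].

Definition chart_var (j : 'I_n) : S :=
  'X_(lift piv j) - p (lift piv j) *: 'X_piv.

(* The inverse of [chart]: homogenization in degree [M] of a polynomial of degree at
   most [M]. *)
Definition hz (M : nat) (q : A) : S := \sum_(m <- msupp q)
  q@_m *: ('X_piv ^+ (M - mdeg m) * \prod_(j < n) chart_var j ^+ m j).

Lemma chart_linear : linear chart.
Proof. by move=> a u v; rewrite /chart linearP. Qed.

Lemma chartM F G : chart (F * G) = chart F * chart G.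
Proof. exact: rmorphM. Qed.

Lemma chartD F G : chart (F + G) = chart F + chart G.
Proof. exact: raddfD. Qed.

Lemma chartZ c F : chart (c *: F) = c *: chart F.
Proof. exact: linearZ. Qed.

Lemma chart0 : chart 0 = 0.
Proof. exact: raddf0. Qed.

Lemma chart_sum (I : Type) (r : seq I) (P : pred I) (F : I -> S) :
  chart (\sum_(i <- r | P i) F i) = \sum_(i <- r | P i) chart (F i).
Proof. exact: raddf_sum. Qed.

Lemma chart_piv : chart 'X_piv = 1.
Proof.
by rewrite /chart comp_mpolyXU -tnth_nth tnth_mktuple unlift_none addr0 ppiv.
Qed.

Lemma chart_lift j : chart 'X_(lift piv j) = (p (lift piv j))%:MP + 'X_j.
Proof. by rewrite /chart comp_mpolyXU -tnth_nth tnth_mktuple liftK. Qed.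

Lemma chart_chart_var j : chart (chart_var j) = 'X_j.
Proof.
rewrite /chart_var /chart raddfB /= -/(chart _) -/(chart _) chartZ chart_piv chart_lift.
by rewrite -mul_mpolyC mulr1 addrC addKr.
Qed.

Lemma chart_prod (I : Type) (r : seq I) (P : pred I) (F : I -> S) :
  chart (\prod_(i <- r | P i) F i) = \prod_(i <- r | P i) chart (F i).
Proof. exact: rmorph_prod. Qed.

Lemma chartX F e : chart (F ^+ e) = chart F ^+ e.
Proof. exact: rmorphXn. Qed.

Lemma chart_hz M q : chart (hz M q) = q.
Proof.
rewrite {2}(mpolyE q) /hz chart_sum; apply: eq_bigr => m _.
rewrite chartZ chartM chartX chart_piv expr1n mul1r chart_prod; congr (_ *: _).
by rewrite mpolyXE_id; apply: eq_bigr => j _; rewrite chartX chart_chart_var.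
Qed.

Lemma chart_eval F t : (chart F).@[t] =
  F.@[fun j => p j + (if unlift piv j is Some k then t k else 0)].
Proof.
rewrite /chart comp_mpoly_meval; apply: meval_eq => j.
rewrite tnth_mktuple mevalD mevalC; congr (_ + _).
by case: (unlift _ _) => [k|]; rewrite ?mevalXU ?meval0.
Qed.

Lemma hz_eval M q v : v piv != 0 -> (msize q <= M.+1)%N ->
  (hz M q).@[v] = v piv ^+ M * q.@[fun j => v (lift piv j) / v piv - p (lift piv j)].
Proof.
move=> vN0 qM; rewrite /hz raddf_sum /= mevalE mulr_sumr !big_seq.
apply: eq_bigr => m /msize_mdeg_lt mq; rewrite mevalZ mulrCA; congr (_ * _).
rewrite mevalM rmorphXn /= mevalXU rmorph_prod /=.
have -> : \prod_(i < n) (chart_var i ^+ m i).@[v] =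
   v piv ^+ mdeg m * \prod_i (v (lift piv i) / v piv - p (lift piv i)) ^+ m i.
  rewrite mdegE expr_sum -big_split; apply: eq_bigr => i _ /=.
  rewrite -exprMn rmorphXn /= /chart_var mevalB mevalZ !mevalXU; congr (_ ^+ _).
  by field.
by rewrite mulrA -exprD subnK //; lia.
Qed.

Lemma msize_chart e F : F \is e.-homog -> (msize (chart F) <= e.+1)%N.
Proof.
move=> /dhomogP hF; rewrite (mpolyE F) chart_sum big_seq; apply: msize_sum_leq => m /hF hm.
rewrite chartZ; apply: leq_trans (msizeZ_le _ _) _.
rewrite mpolyXE_id chart_prod -(hm : mdeg m = e) mdegE.
elim/big_rec2: _ => [|i a q _ IH]; first by rewrite msize1.
apply: msizeM_leq => //; rewrite chartX.
have := @msizeX_leq K n (chart 'X_i) 1 (m i); rewrite mul1n; apply.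
rewrite /chart comp_mpolyXU -tnth_nth tnth_mktuple; apply: msizeD_leq.
  by rewrite msizeC; case: (_ != _).
by case: (unlift _ _) => [k|]; rewrite ?msizeX ?mdeg1 ?msize0.
Qed.

Lemma hz_homog M q : (msize q <= M.+1)%N -> hz M q \is M.-homog.
Proof.
move=> qM; rewrite /hz big_seq; apply: rpred_sum => m /msize_mdeg_lt mq.
apply: dhomogZ.
have mM : (mdeg m <= M)%N by rewrite -ltnS (leq_trans mq).
rewrite -[X in X.-homog](subnK mM); apply: dhomogM.
  rewrite -[X in X.-homog]mul1n; apply: dhomogMn.
  by rewrite dhomogX; apply/eqP/mdeg1.
rewrite mdegE; elim/big_rec2: _ => [|i a F _ IH]; first exact: dhomog1.
apply: dhomogM => //; rewrite -[X in X.-homog]mul1n; apply: dhomogMn.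
apply: rpredB; last apply: dhomogZ; by rewrite dhomogX; apply/eqP/mdeg1.
Qed.

Lemma hz_chartM M e q F : F \is e.-homog -> (msize q <= M.+1)%N ->
  hz (M + e) (q * chart F) = hz M q * F.
Proof.
move=> hF qM; apply: (mpoly_eval_eqW (i := piv)) => v vN0.
rewrite mevalM !hz_eval //; last by apply: msizeM_leq => //; apply: msize_chart.
rewrite mevalM chart_eval exprD -!mulrA; congr (_ * _).
rewrite mulrCA; congr (_ * _).
rewrite -(meval_homogZ _ _ hF); apply: meval_eq => j.
case: (unliftP piv j) => [k|] ->; last by rewrite addr0 ppiv mulr1.
by field.
Qed.

Lemma hz_chart M e F : F \is e.-homog -> hz (M + e) (chart F) = 'X_piv ^+ M * F.
Proof.
move=> hF; have := hz_chartM (M := M) (q := 1) hF; rewrite mul1r msize1 => -> //.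
congr (_ * _); rewrite /hz msupp1 big_seq1 mcoeff1 eqxx scale1r mdeg0 subn0.
by rewrite big1 ?mulr1 // => j _; rewrite mnm0E expr0.
Qed.

Lemma chart_inj e F : F \is e.-homog -> chart F = 0 -> F = 0.
Proof.
move=> hF F0; rewrite -[F]mul1r -(expr0 'X_piv) -(hz_chart 0 hF) F0.
by rewrite /hz msupp0 big_nil.
Qed.

Lemma hzD M q r : (msize q <= M.+1)%N -> (msize r <= M.+1)%N ->
  hz M (q + r) = hz M q + hz M r.
Proof.
move=> qM rM; apply: (mpoly_eval_eqW (i := piv)) => v vN0.
by rewrite mevalD !hz_eval ?mevalD ?mulrDr //; apply: msizeD_leq.
Qed.

Lemma hz0 M : hz M 0 = 0. Proof. by rewrite /hz msupp0 big_nil. Qed.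

Lemma hz_sum M (I : Type) (r : seq I) (F : I -> A) : (forall i, (msize (F i) <= M.+1)%N) ->
  hz M (\sum_(i <- r) F i) = \sum_(i <- r) hz M (F i).
Proof.
move=> FM; elim: r => [|i r IHr]; first by rewrite !big_nil hz0.
by rewrite !big_cons hzD ?IHr //; apply: msize_sum_leq.
Qed.

Lemma mderiv_chart k F : (chart F)^`M(k) = chart (F^`M(lift piv k)).
Proof.
have dX j : (chart 'X_j)^`M(k) = (j == lift piv k)%:R.
  case: (unliftP piv j) => [i|] ->; last first.
    by rewrite chart_piv -mpolyC1 mderivC (negPf (neq_lift _ _)).
  rewrite chart_lift mderivD mderivC add0r mderivX mnm1E (inj_eq lift_inj).
  case: eqP => [->|]; last by rewrite scale0r.
  by rewrite scale1r submm mpolyX0.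
elim/mpolyind: F => [|c m F _ _ IHF].
  by rewrite chart0 !mderiv0 chart0.
rewrite chartD mderivD IHF mderivD chartD; congr (_ + _).
rewrite chartZ !mderivZ chartZ; congr (_ *: _).
move: {2}(mdeg m) (erefl (mdeg m)) => e; elim: e m => [|e IHe] m hm.
  move/eqP: hm; rewrite mdeg_eq0 => /eqP ->.
  by rewrite mpolyX0 /chart rmorph1 -!mpolyC1 !mderivC raddf0.
have [i mi] : exists i, m i != 0%N by apply: mdeg_gt0; rewrite hm.
have Um : (U_(i) <= m)%MM by rewrite lep1mP.
rewrite -(submK Um) mpolyXD chartM !mderivM chartD !chartM IHe; last first.
  by move: hm; rewrite -{1}(submK Um) mdegD mdeg1 addn1 => -[].
rewrite dX; congr (_ + _ * _).
rewrite mderivX mnm1E; case: eqP => [->|]; last by rewrite scale0r chart0.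
by rewrite scale1r submm mpolyX0 /chart comp_mpoly1.
Qed.

End Charts.

(** * The two minimal degrees of syzygies *)

Lemma least_spec (A : set nat) k : A k -> A (least A) /\ (least A <= k)%N.
Proof.
move=> Ak; have exA : exists j, `[< A j >] by exists k; apply/asboolP.
have [/= hA hmin] : [set k | A k /\ forall j, A j -> (k <= j)%N]%classic (least A).
  rewrite /least; case: xgetP => [? -> //|/(_ (ex_minn exA))/= []].
  case: ex_minnP => j /asboolP Aj jmin; split=> // i Ai.
  by apply: jmin; apply/asboolP.
by split=> //; apply: hmin.
Qed.

Section HyperplaneAtInfinity.
Variables (K : numFieldType) (n : nat).
Notation S := {mpoly K[n.+1]}.
Notation A := {mpoly K[n]}.

Definition origin_chart : 'I_n.+1 -> K := fun j => (j == ord0)%:R.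
Notation dehom := (chart ord0 origin_chart).
Notation hom := (hz ord0 origin_chart).

Lemma origin_chart0 : origin_chart ord0 = 1. Proof. by rewrite /origin_chart eqxx. Qed.

Lemma homogenizeE d (g : A) : homogenize d g = hom d g.
Proof.
apply: eq_bigr => m _; congr (_ *: (_ * _)); apply: eq_bigr => j _.
by rewrite /chart_var /origin_chart eq_sym (negPf (neq_lift _ _)) scale0r subr0.
Qed.

Lemma dehom_lift j : dehom 'X_(lift ord0 j) = 'X_j.
Proof.
rewrite chart_lift /origin_chart eq_sym (negPf (neq_lift _ _)).
by rewrite mpolyC0 add0r.
Qed.

Variables (d : nat) (g : A).
Hypothesis d_gt0 : (0 < d)%N.
Hypothesis gsize : msize g = d.+1.
Let f := homogenize d g.

Let hf : f \is d.-homog.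
Proof. by rewrite /f homogenizeE; apply: hz_homog; rewrite gsize. Qed.

Let dehom_f : dehom f = g.
Proof. by rewrite /f homogenizeE chart_hz // origin_chart0. Qed.

Let dehom_df j : dehom (f^`M(lift ord0 j)) = g^`M(j).
Proof. by rewrite -mderiv_chart ?dehom_f // origin_chart0. Qed.

Let dN0 : d%:R != 0 :> K. Proof. by rewrite pnatr_eq0 -lt0n. Qed.

(** Euler's relation at [x_0 = 1]. It expresses the one derivative of [f] that is not a derivative
    of [g]. *)
Let dehom_Euler : dehom (f^`M(ord0)) = d%:R *: g - \sum_j 'X_j * g^`M(j).
Proof.
have := congr1 dehom (Euler_formula hf); rewrite chart_sum chartM dehom_f.
rewrite big_ord_recl chartM chart_piv ?origin_chart0 // mul1r.
rewrite -mpolyC_nat /chart comp_mpolyC mul_mpolyC => <-.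
rewrite [X in _ = _ + X - _](eq_bigr (fun j => 'X_j * g^`M(j))) ?addrK // => j _.
by rewrite -!/(chart _ _ _) chartM dehom_lift dehom_df.
Qed.

Lemma homogenize_homog : f \is d.-homog. Proof. exact: hf. Qed.

Lemma homogenize_neq0 : f != 0.
Proof.
apply: contra_eq_neq gsize => f0.
by rewrite -dehom_f f0 chart0 msize0.
Qed.

Lemma jacobian_neq0 : exists j, f^`M(j) != 0.
Proof.
apply: contrapT => /forallNP f0; have /eqP := Euler_formula hf.
rewrite big1; last by move=> j _; have /negP := f0 j; rewrite negbK => /eqP ->; rewrite mulr0.
rewrite eq_sym -mpolyC_nat mul_mpolyC scaler_eq0 (negPf dN0) (negPf homogenize_neq0).
by [].
Qed.

Lemma sdeg_le s (a : 'I_n.+1 -> A) : (sdeg d a <= s)%N <->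
  (msize (a ord0) <= s.+1)%N /\
  forall j, (msize (d%:R * a (lift ord0 j) + 'X_j * a ord0) <= s.+1)%N.
Proof.
rewrite /sdeg; set M := maxn _ _.
have -> : (M.-1 <= s)%N = (M <= s.+1)%N by lia.
rewrite geq_max; split=> [/andP[-> /bigmax_leqP h]|[-> h]]; first by split=> // j; apply: h.
by apply/bigmax_leqP => j _; apply: h.
Qed.

Lemma AR_aff_of_hom s a : AR_hom f s a -> (exists j, a j != 0) ->
  exists b, [/\ AR_aff g b, exists j, b j != 0 & (sdeg d b <= s)%N].
Proof.
move=> [ha a_f] [j0 aN0].
(* By [dehom_Euler], the syzygy at [x_0 = 1] reads [d a_0 g + sum (a_j - x_j a_0) g_j = 0]. *)
pose b (j : 'I_n.+1) : A := if unlift ord0 j is Some k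
  then dehom (a j) - 'X_k * dehom (a ord0) else d%:R * dehom (a ord0).
have b0 : b ord0 = d%:R * dehom (a ord0) by rewrite /b unlift_none.
have bl k : b (lift ord0 k) = dehom (a (lift ord0 k)) - 'X_k * dehom (a ord0).
  by rewrite /b liftK.
exists b; split.
- rewrite /AR_aff b0; under eq_bigr do rewrite bl mulrBl.
  have := congr1 dehom a_f; rewrite chart_sum chart0 big_ord_recl chartM dehom_Euler.
  rewrite [X in _ + X](eq_bigr (fun k => dehom (a (lift ord0 k)) * g^`M(k))); last first.
    by move=> k _; rewrite chartM dehom_df.
  move=> E; rewrite -[RHS]E sumrB mulrBr -mul_mpolyC mpolyC_nat.
  have -> : dehom (a ord0) * \sum_j 'X_j * g^`M(j) =
      \sum_(i < n) 'X_i * dehom (a ord0) * g^`M(i).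
    by rewrite mulr_sumr; apply: eq_bigr => i _; ring.
  by ring.
- apply: contrapT => /forallNP b_0.
  have {}b_0 j : b j = 0 by have /negP := b_0 j; rewrite negbK => /eqP.
  have a0 : dehom (a ord0) = 0.
    move: (b_0 ord0); rewrite b0 -mpolyC_nat mul_mpolyC => /eqP.
    by rewrite scaler_eq0 (negPf dN0) => /eqP.
  have aj j : dehom (a j) = 0.
    case: (unliftP ord0 j) => [k|] -> //.
    by move: (b_0 (lift ord0 k)); rewrite bl a0 mulr0 subr0.
  by case/eqP: aN0; apply: (chart_inj origin_chart0 (ha _)).
- apply/sdeg_le; rewrite b0; split.
    rewrite -mpolyC_nat mul_mpolyC; apply: leq_trans (msizeZ_le _ _) _.
    exact: msize_chart.
  move=> j; rewrite bl.
  (* The combination in [sdeg] undoes the substitution: it equals [d a_j] at [x_0 = 1], of degree at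
     most [s]. *)
  have -> : d%:R * (dehom (a (lift ord0 j)) - 'X_j * dehom (a ord0)) +
    'X_j * (d%:R * dehom (a ord0)) = d%:R * dehom (a (lift ord0 j)) by ring.
  rewrite -mpolyC_nat mul_mpolyC; apply: leq_trans (msizeZ_le _ _) _.
  exact: msize_chart.
Qed.

Lemma AR_hom_of_aff a : AR_aff g a -> (exists j, a j != 0) ->
  exists b, AR_hom f (sdeg d a) b /\ exists j, b j != 0.
Proof.
move=> a_g [j0 aN0]; set s := sdeg d a.
have /sdeg_le[sz0 szl] : (sdeg d a <= s)%N by [].
(* Up to the factor [d], the inverse of the substitution in [AR_aff_of_hom]. [sdeg] is the largest
   degree of these entries, so they can all be homogenized in that degree. *)
pose c (j : 'I_n.+1) : A := if unlift ord0 j is Some k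
  then d%:R * a j + 'X_k * a ord0 else a ord0.
have c0 : c ord0 = a ord0 by rewrite /c unlift_none.
have cl k : c (lift ord0 k) = d%:R * a (lift ord0 k) + 'X_k * a ord0.
  by rewrite /c liftK.
have szc j : (msize (c j) <= s.+1)%N.
  by case: (unliftP ord0 j) => [k|] ->; rewrite ?c0 ?cl.
have oc := origin_chart0.
exists (fun j => hom s (c j)); split; first split.
- by move=> j; apply: hz_homog.
- apply: (chart_inj oc (e := (s + d.-1)%N)).
    apply: rpred_sum => j _; apply: dhomogM; first exact: hz_homog.
    exact: mderiv_homog.
  rewrite chart_sum big_ord_recl chartM chart_hz // dehom_Euler c0.
  rewrite [X in _ + X](eq_bigr (fun i =>
      d%:R * a (lift ord0 i) * g^`M(i) + 'X_i * a ord0 * g^`M(i))); last first.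
    by move=> i _; rewrite chartM chart_hz // dehom_df cl mulrDl.
  rewrite big_split /= mulrBr mulr_sumr.
  rewrite [X in _ - X + _](eq_bigr (fun i => 'X_i * a ord0 * g^`M(i))); last first.
    by move=> i _; ring.
  transitivity (d%:R * (a ord0 * g + \sum_(i < n) a (lift ord0 i) * g^`M(i))).
    rewrite mulrDr mulr_sumr -mul_mpolyC mpolyC_nat.
    rewrite [X in _ = _ + X](eq_bigr (fun i => d%:R * a (lift ord0 i) * g^`M(i))).
      by ring.
    by move=> i _; ring.
  by rewrite a_g mulr0.
- apply: contrapT => /forallNP b_0.
  have {}c_0 j : c j = 0.
    have /negP := b_0 j; rewrite negbK => /eqP/(congr1 dehom).
    by rewrite chart_hz // chart0.
  have a0 : a ord0 = 0 by rewrite -c0.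
  case/eqP: aN0; case: (unliftP ord0 j0) => [k|] -> //.
  move: (c_0 (lift ord0 k)); rewrite cl a0 mulr0 addr0 -mpolyC_nat mul_mpolyC => /eqP.
  by rewrite scaler_eq0 (negPf dN0) => /eqP.
Qed.

Lemma mdr_spec : (0 < n)%N ->
  [/\ exists a, AR_hom f (mdr_hom f) a /\ exists j, a j != 0,
      mdr_aff d g = mdr_hom f & (mdr_hom f <= d.-1)%N].
Proof.
move=> n_gt0.
(* A nonzero derivative [f_j] and any other index [i] give the syzygy with entries [f_j] at [i] and
   [- f_i] at [j]; [0 < n] provides the second index. *)
have koszul : [set s | exists a, AR_hom f s a /\ exists j, a j != 0]%classic d.-1.
  have [j fj] := jacobian_neq0.
  have [i ij] : exists i, i != j.
    have [->|] := eqVneq j ord0; last by exists ord0; rewrite eq_sym.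
    by exists (lift ord0 (Ordinal n_gt0)); rewrite eq_sym neq_lift.
  exists (fun k => if k == i then f^`M(j) else if k == j then - f^`M(i) else 0).
  split; first split.
  - by move=> k /=; case: ifP => _; last case: ifP => _;
      rewrite ?dhomog0 ?dhomogN //; apply: mderiv_homog.
  - have ji : j != i by rewrite eq_sym.
    rewrite (bigD1 i) //= (bigD1 j) //= !eqxx (negPf ji).
    rewrite big1; first by ring.
    by move=> k /andP[/negPf -> /negPf ->]; rewrite mul0r.
  - by exists i; rewrite eqxx.
have [hom_mem hom_le] := least_spec koszul.
split=> //.
have [a [ha aN0]] := hom_mem.
have [b [hb bN0 sb]] := AR_aff_of_hom ha aN0.
have [aff_mem aff_le] := @least_spec
  [set s | exists a, [/\ AR_aff g a, exists j, a j != 0 & s = sdeg d a]]%classic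
  (sdeg d b) (ex_intro _ b (And3 hb bN0 erefl)).
apply/eqP; rewrite eqn_leq; apply/andP; split; first exact: leq_trans aff_le sb.
have [a' [ha' a'N0 affE]] := aff_mem; rewrite /mdr_aff affE.
have [b' hb'] := AR_hom_of_aff ha' a'N0.
by have [] := @least_spec [set s | exists a, AR_hom f s a /\ exists j, a j != 0]%classic
  _ (ex_intro _ b' hb').
Qed.

End HyperplaneAtInfinity.

(** * Finiteness of the singular locus *)

(** Compactness of the cube is applied to the filter of sets containing all but finitely many points
    of [B], proper since [B] is infinite. Removing [z] from [B] leaves a member of the filter,
    whence [q != z]. *)
Lemma bounded_infinite_cluster (R : realType) N (B : set 'rV[R]_N) :
  infinite_set B -> (forall v, B v -> forall i, `|v 0 i| <= 1) ->
  exists p : 'rV[R]_N, forall e z, 0 < e ->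
    exists q, [/\ B q, q != z & forall i, `|p 0 i - q 0 i| < e].
Proof.
move=> infB bB.
pose F : set_system 'rV[R]_N := fun U => finite_set (B `\` U)%classic.
have FF : ProperFilter F.
  apply: Build_ProperFilter; last split.
  - by rewrite /F setD0; exact: infB.
  - by rewrite /F setDT.
  - by move=> U V hU hV; rewrite /F setDIr finite_setU.
  - move=> U V UV; apply: sub_finite_set => v [Bv nV]; split=> // Uv.
    by apply: nV; apply: UV.
have : compact [set v : 'rV[R]_N | forall i, `[(-1 : R), 1]%classic (v ord0 i)]%classic.
  by apply: (@rV_compact _ _ (fun=> `[(-1 : R), 1]%classic)) => i; apply: segment_compact.
move=> /(_ F FF)[].
  rewrite /F (_ : _ `\` _ = set0)%classic //.
  apply/seteqP; split=> // v [Bv]; apply => i /=.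
  by rewrite in_itv /= -ler_norml; apply: bB.
move=> p [_ clp]; exists p => e z e0.
have [|q [[/= Bq qz] qb]] := clp (B `\ z)%classic (ball p e) _ (nbhsx_ballx p e e0).
  rewrite /F setDD; apply: (@sub_finite_set _ _ [set z]%classic) => //.
exists q; split=> //; first by apply/eqP => qE; apply: qz.
by move=> i; case: qb => _ /(_ ord0 i); rewrite /ball /=.
Qed.

Section Continuity.
Variables (K : numFieldType) (n : nat).

(** The property passes to sums and products; the bound [M] is carried along for the sake of
    products. *)
Lemma meval_lipschitz (P : {mpoly K[n]}) (v : 'I_n -> K) :
  exists L M : K, [/\ 0 <= L, 0 <= M & forall w, (forall j, `|w j - v j| <= 1) ->
    `|P.@[w]| <= M /\ `|P.@[w] - P.@[v]| <= L * \sum_j `|w j - v j|].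
Proof.
pose lip (f : ('I_n -> K) -> K) := exists L M : K,
  [/\ 0 <= L, 0 <= M & forall w, (forall j, `|w j - v j| <= 1) ->
    `|f w| <= M /\ `|f w - f v| <= L * \sum_j `|w j - v j|].
have s0 (w : 'I_n -> K) : 0 <= \sum_j `|w j - v j| by apply: sumr_ge0.
have lipC c : lip (fun=> c).
  exists 0, `|c|; split=> // w _; rewrite subrr normr0 mul0r; split=> //.
have lipX i : lip (fun w => w i).
  exists 1, (`|v i| + 1); split=> //; first by rewrite addr_ge0.
  move=> w wv; split.
    rewrite -[w i](subrK (v i)) addrC; apply: le_trans (ler_normD _ _) _.
    by rewrite lerD2l.
  by rewrite mul1r (bigD1 i) //= lerDl sumr_ge0.
have lipD f g : lip f -> lip g -> lip (fun w => f w + g w).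
  move=> [L [M [L0 M0 hf]]] [L' [M' [L'0 M'0 hg]]].
  exists (L + L'), (M + M'); split; rewrite ?addr_ge0 // => w wv.
  have [f1 f2] := hf w wv; have [g1 g2] := hg w wv; split.
    by apply: le_trans (ler_normD _ _) _; apply: lerD.
  have -> : f w + g w - (f v + g v) = (f w - f v) + (g w - g v) by ring.
  by rewrite mulrDl; apply: le_trans (ler_normD _ _) _; apply: lerD.
have lipM f g : lip f -> lip g -> lip (fun w => f w * g w).
  move=> [L [M [L0 M0 hf]]] [L' [M' [L'0 M'0 hg]]].
  exists (M * L' + L * M'), (M * M'); split; rewrite ?addr_ge0 ?mulr_ge0 // => w wv.
  have [f1 f2] := hf w wv; have [g1 g2] := hg w wv; split.
    by rewrite normrM; apply: ler_pM.
  have vv : forall j, `|v j - v j| <= 1 by move=> j; rewrite subrr normr0.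
  have [g3 _] := hg v vv.
  have -> : f w * g w - f v * g v = f w * (g w - g v) + (f w - f v) * g v by ring.
  apply: le_trans (ler_normD _ _) _; rewrite !normrM mulrDl; apply: lerD.
    by rewrite -mulrA; apply: ler_pM.
  by rewrite mulrAC; apply: ler_pM.
have lip1 (I : Type) (r : seq I) (f : I -> ('I_n -> K) -> K) :
    (forall i, lip (f i)) -> lip (fun w => \prod_(i <- r) f i w).
  move=> hf; elim: r => [|i r IHr].
    under eq_fun do rewrite big_nil.
    by apply: lipC.
  under eq_fun do rewrite big_cons.
    by apply: lipM.
rewrite -/(lip (fun w => P.@[w])).
elim/mpolyind: P => [|c m P _ _ IHP].
  under eq_fun do rewrite meval0.
    by apply: (lipC).
under eq_fun do rewrite mevalD mevalZ mevalX.
apply: (lipD) => //; apply: (lipM); first exact: lipC.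
apply: (lip1) => i; elim: (m i) => [|e IHe].
  under eq_fun do rewrite expr0.
  by apply: (lipC).
under eq_fun do rewrite exprS.
by apply: (lipM).
Qed.

End Continuity.

Section ComplexNorm.
Variable R : realType.
Implicit Types (z : R[i]).

Lemma normC_real z : exists2 r : R, 0 <= r & `|z| = r%:C.
Proof.
rewrite normc_def; exists (Num.sqrt (complex.Re z ^+ 2 + complex.Im z ^+ 2)) => //.
exact: sqrtr_ge0.
Qed.

Lemma normC_leD z : `|z| <= (`|complex.Re z| + `|complex.Im z|)%:C.
Proof.
rewrite normc_def lecR -[leRHS]ger0_norm ?addr_ge0 // -sqrtr_sqr ler_sqrt ?sqr_ge0 //.
by rewrite -(real_normK (num_real (complex.Re z))) -(real_normK (num_real (complex.Im z)));
  have := mulr_ge0 (normr_ge0 (complex.Re z)) (normr_ge0 (complex.Im z)); nra.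
Qed.

Lemma normC_geRe z : (`|complex.Re z|)%:C <= `|z|.
Proof.
rewrite normc_def lecR -sqrtr_sqr ler_sqrt ?addr_ge0 ?sqr_ge0 //.
by rewrite lerDl sqr_ge0.
Qed.

Lemma normC_geIm z : (`|complex.Im z|)%:C <= `|z|.
Proof.
rewrite normc_def lecR -sqrtr_sqr ler_sqrt ?addr_ge0 ?sqr_ge0 //.
by rewrite lerDr sqr_ge0.
Qed.

End ComplexNorm.

Section Pivot.
Variables (R : realType) (n : nat).
Implicit Types p : 'rV[R[i]]_n.+1.

Lemma pivot_neq0 p : p != 0 -> p 0 (pivot p) != 0.
Proof.
move=> /rV0Pn[i0 pi0]; rewrite /pivot /arg_min /extremum.
case: pickP => [i /andP[] //|none] /=.
case: (@arg_minnP _ i0 (fun i => p 0 i != 0) (fun i => i : nat) pi0) => i Pi imin.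
have /negP[] := negbT (none i); rewrite /= Pi /=.
by apply/forallP => j; apply/implyP/imin.
Qed.

Lemma pivotZ c p : c != 0 -> pivot (c *: p) = pivot p.
Proof.
move=> cN0; rewrite /pivot /arg_min /extremum; congr odflt; apply: eq_pick => i /=.
rewrite mxE mulf_eq0 (negPf cN0) /=; congr (_ && _); apply: eq_forallb => j.
by rewrite mxE mulf_eq0 (negPf cN0).
Qed.

End Pivot.

Section FinitelyManySingularities.
Variables (R : realType) (n : nat).

Definition real_part m (v : 'rV[R[i]]_m) : 'rV[R]_(m + m) :=
  row_mx (map_mx (@complex.Re R) v) (map_mx (@complex.Im R) v).

Lemma real_part_inj m : injective (@real_part m).
Proof.
move=> v w /eq_row_mx[/rowP re /rowP im]; apply/rowP => j; apply/eqP.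
by rewrite eq_complex; have := re j; have := im j; rewrite !mxE => -> ->; rewrite !eqxx.
Qed.

Lemma bounded_infinite_clusterC m (B : set 'rV[R[i]]_m) :
  infinite_set B -> (forall v, B v -> forall i, `|v 0 i| <= 1) ->
  exists p : 'rV[R[i]]_m, forall (e : R) z, 0 < e ->
    exists q, [/\ B q, q != z & forall i, `|q 0 i - p 0 i| < e%:C].
Proof.
move=> infB bB.
have infB' : infinite_set (@real_part m @` B)%classic.
  move=> finB; apply: infB.
  apply: (@sub_finite_set _ _ (@real_part m @^-1` (@real_part m @` B))%classic).
    by move=> v Bv; exists v.
  by apply: finite_preimage finB => v w _ _; apply: real_part_inj.
have [|p hp] := bounded_infinite_cluster infB'.
  move=> _ [v Bv <-] i; rewrite /real_part mxE; case: (fintype.split i) => j; rewrite mxE -lecR;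
    [apply: le_trans (normC_geRe _) (bB v Bv j)|apply: le_trans (normC_geIm _) (bB v Bv j)].
exists (\row_j (Complex (p 0 (lshift m j)) (p 0 (rshift m j)))) => e z e0.
have [|_ [[v Bv <-] vz vp]] := hp (e / 2) (real_part z); first by rewrite divr_gt0.
exists v; split=> //; first by apply: contraNneq vz => ->.
move=> i; apply: le_lt_trans (normC_leD _) _; rewrite ltcR.
have := vp (lshift m i); have := vp (rshift m i); rewrite /real_part row_mxEl row_mxEr !mxE.
rewrite [`|p 0 _ - _|]distrC [X in _ -> X < _ -> _]distrC.
case: (v 0 i) => a b /=; lra.
Qed.

(** Divided by a coordinate of largest modulus, every singular point enters a bounded set [A i]. If
    [A i] were infinite, an accumulation point [p] would again be singular with [p_i = 1]; a nearby
    point of [A i], being proportional to [p] with the same [i]-th coordinate, would equal [p]. *)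
Lemma singular_finite (f : {mpoly R[i][n.+1]}) d : f \is d.-homog ->
  isolated_singularities f -> finite_set [set p | normalized p /\ singular f p]%classic.
Proof.
move=> hf hiso.
have scale_sing c p : c != 0 -> singular f p -> singular f (c *: p).
  move=> cN0 [pN0 fp dfp].
  have ev (P : {mpoly R[i][n.+1]}) e : P \is e.-homog -> P.@[p 0] = 0 -> P.@[(c *: p) 0] = 0.
    move=> hP P0; rewrite (@meval_eq _ _ _ (fun i => c * p 0 i)); last by move=> i; rewrite mxE.
    by rewrite (meval_homogZ _ _ hP) P0 mulr0.
  split; first by rewrite scaler_eq0 negb_or cN0.
    exact: ev hf fp.
  by move=> j; apply: ev (mderiv_homog j hf) (dfp j).
pose A i : set 'rV[R[i]]_n.+1 :=
  [set q | [/\ singular f q, q 0 i = 1 & forall j, `|q 0 j| <= 1]]%classic.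
have finA i : finite_set (A i).
  apply: contrapT => infA.
  have [|p accp] := bounded_infinite_clusterC infA; first by move=> v [].
  have vanish (P : {mpoly R[i][n.+1]}) : (forall q, A i q -> P.@[q 0] = 0) -> P.@[p 0] = 0.
    move=> P0; have [L [M [L0 M0 lip]]] := meval_lipschitz P (p 0).
    apply/eqP; rewrite -normr_eq0; have [r r0 rE] := normC_real P.@[p 0].
    rewrite rE -[0]/(0%:C) (inj_eq (@complexI R)) eq_le r0 andbT leNgt; apply/negP => rp.
    have [l l0 lE] := normC_real L; rewrite ger0_norm // in lE.
    pose N : R := n.+1%:R.
    have Np : 0 < N by rewrite ltr0n.
    (* The Lipschitz estimate becomes at most [l N e < r], against [|P(p)| = r]; the minimum with 1
       keeps [q] where the estimate holds. *)
    pose e := Num.min 1 (r / (2 * (l + 1) * N)).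
    have e0 : 0 < e.
      rewrite lt_min ltr01 divr_gt0 // !mulr_gt0 //.
      by rewrite ltr_wpDl.
    have [q [Aq _ qp]] := accp e 0 e0.
    have [|_] := lip (q 0).
      move=> j; apply: le_trans (ltW (qp j)) _.
      by rewrite -[1]/(1%:C) lecR ge_min lexx.
    have h : L * \sum_j `|q 0 j - p 0 j| <= (l * (N * e))%:C.
      rewrite lE rmorphM; apply: ler_wpM2l; first by rewrite -[0]/(0%:C) lecR.
      apply: (@le_trans _ _ (\sum_(j < n.+1) e%:C)); first by apply: ler_sum => j _; apply/ltW.
      by rewrite sumr_const card_ord rmorphM rmorph_nat mulr_natl.
    rewrite P0 // sub0r normrN rE => /le_trans/(_ h); rewrite lecR.
    have : e <= r / (2 * (l + 1) * N) by rewrite ge_min lexx orbT.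
    rewrite ler_pdivlMr ?mulr_gt0 ?ltr_wpDl // => h1 h2.
    have h3 : 0 < N * e by rewrite mulr_gt0.
    by move: h1 h2 h3; clear -Np l0 rp; nra.
  have pi1 : p 0 i = 1.
    apply/eqP; rewrite -subr_eq0; apply/eqP.
    have := vanish ('X_i - 1); rewrite mevalB mevalXU meval1; apply=> q [_ q1 _].
    by rewrite mevalB mevalXU meval1 q1 subrr.
  have singp : singular f p.
    split; last by move=> j; apply: vanish => q [[_ _ ->]].
      by apply: contra_eq_neq pi1 => ->; rewrite mxE eq_sym oner_neq0.
    by apply: vanish => q [[]].
  have [e e0 he] := hiso p singp.
  have [q [[singq q1 _] qNp qe]] := accp e p e0.
  have [c qc] := he q singq qe.
  case/eqP: qNp; rewrite qc; move: q1; rewrite qc mxE pi1 mulr1 => ->.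
  by rewrite scale1r.
(* Return from the scaling by the largest coordinate to the normalized representative. *)
pose N (q : 'rV[R[i]]_n.+1) := (q 0 (pivot q))^-1 *: q.
apply: (@sub_finite_set _ _ (\bigcup_(i in setT) (N @` A i))%classic); last first.
  by apply: bigcup_finite => // i _; apply: finite_image.
move=> p [np singp].
have pN0 : p != 0 by case: singp.
have pvN0 := pivot_neq0 pN0.
pose F i : R := complex.Re `|p 0 i|.
have FE i : `|p 0 i| = (F i)%:C by have [r _ rE] := normC_real (p 0 i); rewrite /F rE.
case: (@arg_maxP _ _ _ (pivot p) predT F isT) => i _ imax.
have iN0 : p 0 i != 0.
  rewrite -normr_gt0 FE ltcR; apply: lt_le_trans (imax (pivot p) isT).
  by rewrite -ltcR -FE normr_gt0.
exists i => //; exists ((p 0 i)^-1 *: p); first split.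
- by apply: scale_sing; rewrite ?invr_eq0.
- by rewrite mxE mulVf.
- move=> j; rewrite mxE normrM normfV ler_pdivrMl ?normr_gt0 // mulr1 !FE lecR.
  exact: imax.
rewrite /N pivotZ ?invr_eq0 // mxE (np : p 0 (pivot p) = 1) mulr1 invrK scalerA.
by rewrite mulfV // scale1r.
Qed.

End FinitelyManySingularities.

(** * Analytic germs *)

Section Truncation.
Variables (K : comNzRingType) (n : nat).
Implicit Types (p q : {mpoly K[n]}) (u v : 'X_{1..n} -> K).

Definition trunc N u : {mpoly K[n]} := \sum_(m : 'X_{1..n < N}) u m *: 'X_[m].

Definition eqmod N p q := forall m, (mdeg m < N)%N -> p@_m = q@_m.

Lemma mcoeff_trunc N u m : (mdeg m < N)%N -> (trunc N u)@_m = u m.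
Proof. by move=> mN; rewrite /trunc mcoeff_mpoly. Qed.

Lemma trunc_mcoeff N p : eqmod N (trunc N (fun m => p@_m)) p.
Proof. by move=> m mN; rewrite mcoeff_trunc. Qed.

Lemma eqmod_refl N p : eqmod N p p. Proof. by []. Qed.

Lemma eqmodM N p p' q q' : eqmod N p p' -> eqmod N q q' -> eqmod N (p * q) (p' * q').
Proof.
move=> pp' qq' m mN; rewrite !mcoeffM; apply: eq_bigr => k _.
rewrite pp' ?qq' //; [have := bmdeg k.2|have := bmdeg k.1] => h;
  exact: leq_trans h mN.
Qed.

Lemma eqmod_exp_low N p : p@_0%MM = 0 -> eqmod N (p ^+ N) 0.
Proof.
move=> p0; elim: N => [|N IHN] m //; rewrite ltnS => mN.
rewrite exprSr mcoeffM mcoeff0 big1 // => k /eqP mk.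
have [k20|k2N0] := eqVneq (k.2 : 'X_{1..n}) 0%MM; first by rewrite k20 p0 mulr0.
have : (0 < mdeg k.2)%N by rewrite lt0n mdeg_eq0.
move=> k20; rewrite IHN ?mcoeff0 ?mul0r //; apply: leq_trans mN.
have := congr1 (@mdeg n) (esym mk); rewrite mdegD => /eq_leq; apply: leq_trans.
by rewrite -[X in (X < _)%N]addn0 ltn_add2l.
Qed.

End Truncation.

(** * The ring of convergent power series *)

Section SeriesRing.
Variables (R : realType) (n : nat).
Notation C := R[i].
Implicit Types (u v w : series R n) (p q : {mpoly C[n]}).

(** A coefficient of a product depends only on truncations, so the ring laws for series follow from
    those for polynomials. *)
Lemma mul_seriesE N u v m : (mdeg m < N)%N ->
  mul_series u v m = (trunc N u * trunc N v)@_m.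
Proof.
move=> mN; rewrite mcoeffM; apply: eq_bigr => k _.
by rewrite !mcoeff_trunc //; [have := bmdeg k.2|have := bmdeg k.1] => h;
  exact: leq_trans h mN.
Qed.

Lemma trunc_mul N u v : eqmod N (trunc N (mul_series u v)) (trunc N u * trunc N v).
Proof. by move=> m mN; rewrite mcoeff_trunc // (mul_seriesE _ _ mN). Qed.

Lemma mul_seriesA u v w : mul_series u (mul_series v w) = mul_series (mul_series u v) w.
Proof.
apply/funext => m; rewrite !(mul_seriesE _ _ (ltnSn (mdeg m))).
rewrite (eqmodM (eqmod_refl _) (trunc_mul _ _)) // mulrA.
by apply/esym/(eqmodM (trunc_mul _ _) (eqmod_refl _)).
Qed.

Lemma mul_seriesC u v : mul_series u v = mul_series v u.
Proof. by apply/funext => m; rewrite !(mul_seriesE _ _ (ltnSn (mdeg m))) mulrC. Qed.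

Lemma truncD N u v : trunc N (u + v) = trunc N u + trunc N v.
Proof. by rewrite /trunc -big_split /=; apply: eq_bigr => m _; rewrite -scalerDl. Qed.

Lemma truncZ N a u : trunc N (a *: u) = a *: trunc N u.
Proof. by rewrite /trunc scaler_sumr; apply: eq_bigr => m _; rewrite scalerA. Qed.

Lemma mul_seriesDr u v w : mul_series u (v + w) = mul_series u v + mul_series u w.
Proof.
apply/funext => m; rewrite !(mul_seriesE _ _ (ltnSn (mdeg m))) truncD mulrDr mcoeffD.
by rewrite -!mul_seriesE.
Qed.

Lemma mul_seriesZr a u w : mul_series u (a *: w) = a *: mul_series u w.
Proof.
apply/funext => m; rewrite !(mul_seriesE _ _ (ltnSn (mdeg m))) truncZ -scalerAr mcoeffZ.
by rewrite -mul_seriesE.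
Qed.

Lemma mul_series_linear u : linear (mul_series u).
Proof. by move=> a v w; rewrite mul_seriesDr mul_seriesZr. Qed.

Lemma mul_series0 u : mul_series u 0 = 0.
Proof. by have := mul_seriesZr 0 u 0; rewrite !scale0r. Qed.

Lemma mul_series_sum u (I : Type) (r : seq I) (F : I -> series R n) :
  mul_series u (\sum_(i <- r) F i) = \sum_(i <- r) mul_series u (F i).
Proof. by apply: (big_morph _ (mul_seriesDr u) (mul_series0 u)). Qed.

Lemma series_ofM p q : series_of (p * q) = mul_series (series_of p) (series_of q).
Proof. by apply/funext => m; rewrite /series_of mcoeffM. Qed.

Lemma series_of_linear : linear (@series_of R n).
Proof. by move=> a p q; apply/funext => m; rewrite /series_of mcoeffD mcoeffZ. Qed.

Lemma series_ofD p q : series_of (p + q) = series_of p + series_of q.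
Proof. by apply/funext => m; rewrite /series_of mcoeffD. Qed.

Lemma series_of0 : series_of (0 : {mpoly C[n]}) = 0.
Proof. by apply/funext => m; rewrite /series_of mcoeff0. Qed.

Lemma series_of_sum (I : Type) (r : seq I) (F : I -> {mpoly C[n]}) :
  series_of (\sum_(i <- r) F i) = \sum_(i <- r) series_of (F i).
Proof. by apply: (big_morph _ series_ofD series_of0). Qed.

Lemma mul_series1 u : mul_series (series_of 1) u = u.
Proof.
apply/funext => m; rewrite (mul_seriesE _ _ (ltnSn (mdeg m))).
rewrite (eqmodM (trunc_mcoeff 1) (eqmod_refl _)) // mul1r mcoeff_trunc //.
Qed.

Lemma mul_series_var i u m : mul_series (series_of 'X_i) u m =
  if m i == 0%N then 0 else u (m - U_(i))%MM.
Proof.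
rewrite (mul_seriesE _ _ (ltnSn (mdeg m))) (eqmodM (trunc_mcoeff _) (eqmod_refl _)) //.
case: ifPn => [/eqP mi|mi].
  rewrite mcoeffM big1 // => k /eqP mk; rewrite mcoeffX.
  case: eqP => [ki|]; last by rewrite mul0r.
  by move/mnmP/(_ i): mk; rewrite mi mnmDE -ki mnm1E eqxx.
have Um : (U_(i) <= m)%MM by rewrite lep1mP.
have := mcoeffMX (trunc (mdeg m).+1 u) U_(i) (m - U_(i))%MM.
rewrite [(U_(i) + _)%MM]addmC submK // mulrC => ->; rewrite mcoeff_trunc //.
by rewrite ltnS mdegB.
Qed.

(** Partial sum of the weighted l1 norm on the polydisc of radius [E], with [E] in [R[i]] so that
    norms need no embedding. *)
Definition snorm N (E : C) u : C := \sum_(m : 'X_{1..n < N}) `|u m| * E ^+ mdeg m.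

Lemma snorm_ge0 N E u : 0 <= E -> 0 <= snorm N E u.
Proof. by move=> E0; apply: sumr_ge0 => m _; rewrite mulr_ge0 ?exprn_ge0. Qed.

Lemma germP u : germ u <-> exists2 E : C, 0 < E & exists M, forall N, snorm N E u <= M.
Proof.
split=> [[e e0 [M hM]]|[E E0 [M hM]]].
  by exists e%:C; [rewrite -[0]/(0%:C) ltcR|exists M%:C].
have EE : (complex.Re E)%:C = E by apply: RRe_real; apply: gtr0_real.
have M0 : 0 <= M by apply: le_trans (hM 0%N); apply/snorm_ge0/ltW.
have MM : (complex.Re M)%:C = M by apply: RRe_real; apply: ger0_real.
exists (complex.Re E); first by rewrite -ltcR EE.
by exists (complex.Re M) => N; rewrite EE MM; apply: hM.
Qed.

Lemma snorm_leE N E E' u : 0 <= E -> E <= E' -> snorm N E u <= snorm N E' u.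
Proof.
move=> E0 EE'; apply: ler_sum => m _; apply: ler_wpM2l => //.
by apply: lerXn2r => //; rewrite nnegrE //; apply: le_trans EE'.
Qed.

Lemma germ2 u v : germ u -> germ v -> exists2 E : C, 0 < E &
  exists M M' : C, (forall N, snorm N E u <= M) /\ (forall N, snorm N E v <= M').
Proof.
move=> [e e0 [M hM]] [e' e'0 [M' hM']].
have m0 : 0 < Num.min e e' by rewrite lt_min e0.
have m0C : 0 <= (Num.min e e')%:C by rewrite -[0]/(0%:C) lecR ltW.
exists (Num.min e e')%:C; first by rewrite -[0]/(0%:C) ltcR.
exists M%:C, M'%:C; split=> N.
  by apply: le_trans (hM N); apply: snorm_leE => //; rewrite lecR ge_min lexx.
by apply: le_trans (hM' N); apply: snorm_leE => //; rewrite lecR ge_min lexx orbT.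
Qed.

Lemma snormD N E u v : 0 <= E -> snorm N E (u + v) <= snorm N E u + snorm N E v.
Proof.
move=> E0; rewrite -big_split /=; apply: ler_sum => m _; rewrite -mulrDl.
by apply: ler_wpM2r; [rewrite exprn_ge0|exact: ler_normD].
Qed.

Lemma snormZ N E a u : snorm N E (a *: u) = `|a| * snorm N E u.
Proof. by rewrite mulr_sumr; apply: eq_bigr => m _; rewrite mulrA -normrM. Qed.

Lemma subspace_germ : subspace (@germ R n).
Proof.
split.
  apply/germP; exists 1 => //; exists 0 => N.
  by rewrite /snorm big1 // => m _; rewrite normr0 mul0r.
move=> a u v gu gv; have [E E0 [M [M' [hM hM']]]] := germ2 gu gv.
apply/germP; exists E => //; exists (`|a| * M + M') => N.
apply: le_trans (snormD _ _ _ (ltW E0)) _; rewrite snormZ; apply: lerD => //.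
exact: ler_wpM2l.
Qed.

(** Pairs of monomials are grouped by their product; the pairs whose product has degree at least [N]
    occur only on the right. *)
Lemma snormM N E u v : 0 <= E -> snorm N E (mul_series u v) <= snorm N E u * snorm N E v.
Proof.
move=> E0; rewrite /snorm big_distrlr /= pair_big /=.
pose F (k : 'X_{1..n < N} * 'X_{1..n < N}) :=
  `|u k.1| * E ^+ mdeg k.1 * (`|v k.2| * E ^+ mdeg k.2).
have F0 k : 0 <= F k by rewrite !mulr_ge0 ?exprn_ge0.
apply: (@le_trans _ _ (\sum_(m : 'X_{1..n < N})
    \sum_(k : 'X_{1..n < N, N} | (m : 'X_{1..n}) == (k.1 + k.2)%MM) F k)).
  apply: ler_sum => m _; have mN := bmdeg m.
  rewrite (mul_seriesE _ _ mN) (mcoeff_poly_mul _ _ mN).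
  apply: le_trans (ler_wpM2r _ (ler_norm_sum _ _ _)) _; first by rewrite exprn_ge0.
  rewrite mulr_suml; apply: ler_sum => k /eqP ->.
  rewrite !mcoeff_trunc ?bmdeg // normrM mdegD exprD /F le_eqVlt; apply/orP; left.
  by apply/eqP; ring.
rewrite (exchange_big_dep predT) //=; apply: ler_sum => k _.
have [/existsP[m0 /eqP m0k]|/existsPn none] :=
    boolP [exists m : 'X_{1..n < N}, (m : 'X_{1..n}) == (k.1 + k.2)%MM].
  rewrite (bigD1 m0) /= ?m0k // big1 ?addr0 // => m /andP[/eqP mk mm0].
  by case/eqP: mm0; apply: val_inj; rewrite /= mk.
rewrite big_pred0; first exact: F0.
by move=> m; apply/negbTE/none.
Qed.

Lemma germ_mul u v : germ u -> germ v -> germ (mul_series u v).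
Proof.
move=> gu gv; have [E E0 [M [M' [hM hM']]]] := germ2 gu gv.
apply/germP; exists E => //; exists (M * M') => N.
apply: le_trans (snormM _ _ _ (ltW E0)) _.
by apply: ler_pM => //; apply/snorm_ge0/ltW.
Qed.

Lemma snorm_monomial N E m : 0 <= E -> snorm N E (series_of 'X_[m]) <= E ^+ mdeg m.
Proof.
move=> E0; rewrite /snorm; have [mN|Nm] := ltnP (mdeg m) N.
  rewrite (bigD1 (BMultinom mN)) //= big1 => [|k km].
    by rewrite /series_of mcoeffX eqxx normr1 mul1r addr0.
  have /negPf mk : m != bmnm k by apply: contraNneq km => mk; rewrite bmeqP /= mk.
  by rewrite /series_of mcoeffX mk normr0 mul0r.
rewrite big1 ?exprn_ge0 // => k _; rewrite /series_of mcoeffX.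
have /negPf -> : m != bmnm k by apply: contraTneq (bmdeg k) => <-; rewrite -leqNgt.
by rewrite normr0 mul0r.
Qed.

Lemma germ_poly p : germ (series_of p).
Proof.
elim/mpolyind: p => [|c m p _ _ IHp]; first by rewrite series_of0; apply: subspace0 subspace_germ.
rewrite series_of_linear; apply: subspace_germ.2 => //; apply/germP; exists 1 => //.
by exists 1 => N; apply: le_trans (snorm_monomial _ _ ler01) _; rewrite expr1n.
Qed.

Lemma snorm_small p : p@_0%MM = 0 -> exists2 E : C, 0 < E &
  forall N, snorm N E (series_of p) <= 2^-1.
Proof.
move=> p0; have /germP[E0 E0p [M hM]] := germ_poly p.
have M0 : 0 <= M by apply: le_trans (hM 0%N); apply/snorm_ge0/ltW.
(* [t * M <= 1/2]; since [t <= 1], shrinking the radius by [t] gains at least this factor on every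
   monomial of positive degree. *)
pose t : C := (2 * (M + 1))^-1.
have M1 : 0 < M + 1 by rewrite ltr_wpDl.
have t0 : 0 < t by rewrite invr_gt0 mulr_gt0.
have t1 : t <= 1.
  rewrite invf_le1 ?mulr_gt0 //.
  have -> : 2 * (M + 1) = 1 + (1 + 2 * M) by ring.
  by rewrite lerDl addr_ge0 // mulr_ge0.
exists (t * E0) => [|N]; first exact: mulr_gt0.
apply: (@le_trans _ _ (t * snorm N E0 (series_of p))); last first.
  apply: (@le_trans _ _ (t * M)); first by rewrite ler_wpM2l // ltW.
  rewrite /t invfM -mulrA ger_pMr ?invr_gt0 // ler_pdivrMl // mulr1.
  by rewrite lerDl.
rewrite /snorm mulr_sumr; apply: ler_sum => m _.
have [m0|mN0] := eqVneq (m : 'X_{1..n}) 0%MM.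
  by rewrite m0 /series_of p0 normr0 !mul0r mulr0.
rewrite mulrCA; apply: ler_wpM2l => //; rewrite exprMn; apply: ler_wpM2r.
  by rewrite exprn_ge0 // ltW.
have : (0 < mdeg m)%N by rewrite lt0n mdeg_eq0.
by case: (mdeg m) => // k _; rewrite exprS ger_pMr // exprn_ile1 // ltW.
Qed.

(** Geometric series in [x = 1 - p / p(0)]. As [x] has no constant term, each coefficient involves
    finitely many powers, and at a radius where the norm of [x] is at most 1/2 the partial sums stay
    below 2. *)
Lemma germ_inverse p : p@_0%MM != 0 -> exists2 v, germ v &
  mul_series v (series_of p) = series_of 1.
Proof.
move=> pN0; pose a := p@_0%MM; pose x := 1 - a^-1 *: p.
have x0 : x@_0%MM = 0 by rewrite mcoeffB mcoeff1 eqxx mcoeffZ mulVf // subrr.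
pose w : series R n := fun m => (\sum_(j < (mdeg m).+1) x ^+ j)@_m.
have wE N : eqmod N (trunc N w) (\sum_(j < N) x ^+ j).
  move=> m mN; rewrite mcoeff_trunc // /w !raddf_sum /=.
  rewrite -[in RHS](subnKC mN) big_split_ord /= [X in _ + X]big1 ?addr0 // => j _.
  rewrite exprD (eqmodM (eqmod_exp_low x0) (eqmod_refl _)) //.
  by rewrite mul0r mcoeff0.
have wx : mul_series w (series_of (1 - x)) = series_of 1.
  apply/funext => m; rewrite (mul_seriesE _ _ (ltnSn (mdeg m))).
  rewrite (eqmodM (wE _) (trunc_mcoeff _)) //.
  have -> : (\sum_(j < (mdeg m).+1) x ^+ j) * (1 - x) = 1 - x ^+ (mdeg m).+1.
    by rewrite mulrC -opprB mulNr -subrX1 opprB.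
  by rewrite mcoeffB (eqmod_exp_low x0) // mcoeff0 subr0.
have gw : germ w.
  have [E E0 hE] := snorm_small x0.
  apply/germP; exists E => //; exists 2 => N.
  have pow j : snorm N E (series_of (x ^+ j)) <= 2^-1 ^+ j.
    elim: j => [|j IHj].
      by rewrite !expr0 -mpolyX0; apply: le_trans (snorm_monomial _ _ (ltW E0)) _; rewrite mdeg0.
    rewrite !exprS series_ofM; apply: le_trans (snormM _ _ _ (ltW E0)) _.
    by apply: ler_pM => //; apply/snorm_ge0/ltW.
  apply: (@le_trans _ _ (\sum_(j < N) snorm N E (series_of (x ^+ j)))).
    rewrite /snorm exchange_big /=; apply: ler_sum => m _.
    rewrite -mulr_suml; apply: ler_wpM2r; first by rewrite exprn_ge0 // ltW.
    have := wE N m (bmdeg m); rewrite mcoeff_trunc ?bmdeg // => ->.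
    by rewrite raddf_sum; apply: ler_norm_sum.
  apply: (@le_trans _ _ (\sum_(j < N) 2^-1 ^+ j)); first exact: ler_sum.
  have -> : \sum_(j < N) 2^-1 ^+ j = 2 - 2 * 2^-1 ^+ N :> C.
    elim: {pow} N => [|N IHN]; first by rewrite big_ord0 expr0 mulr1 subrr.
    by rewrite big_ord_recr /= IHN exprS mulrA mulfV ?pnatr_eq0 //; ring.
  by rewrite gerBl; apply: mulr_ge0 => //; apply: exprn_ge0; rewrite invr_ge0.
exists (a^-1 *: w); first exact: (subspaceZ subspace_germ).
have -> : p = a *: (1 - x) + 0.
  by rewrite addr0 /x opprB addrC subrK scalerA mulfV // scale1r.
rewrite series_of_linear series_of0 addr0 mul_seriesZr mul_seriesC mul_seriesZr.
by rewrite mul_seriesC wx scalerA mulfV // scale1r.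
Qed.

End SeriesRing.

(** * Ideals of germs and Tjurina numbers *)

Section GermIdeals.
Variables (R : realType) (n : nat).
Notation C := R[i].
Implicit Types (u v w : series R n) (p q h : {mpoly C[n]}) (T : series R n -> Prop).

Definition germ_ideal T :=
  subspace T /\ forall w u, germ w -> T u -> T (mul_series w u).

Definition first_var (m : 'X_{1..n}) : option 'I_n := [pick i | m i != 0%N].

(** Each monomial is assigned to its first variable, so a series without constant term is the sum of
    the [x_i * var_part u i] without overlap, and convergence is inherited. *)
Definition var_part u (i : 'I_n) : series R n := fun m =>
  if first_var (m + U_(i))%MM == Some i then u (m + U_(i))%MM else 0.

Lemma var_part_sum u : u 0%MM = 0 ->
  u = \sum_i mul_series (series_of 'X_i) (var_part u i).
Proof.
move=> u0; apply/funext => m; rewrite fct_sumE.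
under eq_bigr do rewrite mul_series_var.
have [->|mN0] := eqVneq m 0%MM.
  by rewrite u0 big1 // => i _; rewrite mnm0E eqxx.
have [i fi] : exists i, first_var m = Some i.
  rewrite /first_var; case: pickP => [i _|m0]; first by exists i.
  case/eqP: mN0; apply/mnmP => i; rewrite mnm0E; apply/eqP.
  by have := m0 i => /negbT; rewrite negbK.
have mi : m i != 0%N by move: fi; rewrite /first_var; case: pickP => // j ? [<-].
rewrite (bigD1 i) //= (negPf mi) /var_part submK ?lep1mP // fi eqxx.
rewrite big1 ?addr0 // => j ji; case: ifPn => // mj.
rewrite submK ?lep1mP // fi; case: eqP => // -[ij].
by rewrite ij eqxx in ji.
Qed.

Lemma germ_var_part u i : germ u -> germ (var_part u i).
Proof.
move=> /germP[E E0 [M hM]]; apply/germP; exists E => //; exists (E^-1 * M) => N.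
rewrite mulrC ler_pdivlMr //; apply: le_trans (hM N.+1).
have shP (m : 'X_{1..n < N}) : (mdeg (m + U_(i))%MM < N.+1)%N.
  by rewrite mdegD mdeg1 addn1 ltnS bmdeg.
pose sh m := BMultinom (shP m).
have shE m : (sh m : 'X_{1..n}) = (m + U_(i))%MM by [].
have sh_inj : injective sh.
  move=> m m' mm'; apply: val_inj; apply: (@addIm _ U_(i)%MM).
  by rewrite /= -!shE mm'.
rewrite /snorm mulr_suml.
apply: (@le_trans _ _ (\sum_(m in [set sh m | m : 'X_{1..n < N}]) `|u m| * E ^+ mdeg m)).
  rewrite big_imset /=; last by move=> m m' _ _; apply: sh_inj.
  apply: ler_sum => m _; rewrite /= mdegD mdeg1 addn1 exprSr mulrA.
  rewrite ler_pM2r //; apply: ler_wpM2r; first by rewrite exprn_ge0 // ltW.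
  by rewrite /var_part; case: ifP => // _; rewrite normr0.
rewrite [leRHS](bigID (fun m => m \in [set sh m | m : 'X_{1..n < N}])) /= lerDl.
by apply: sumr_ge0 => m _; apply: mulr_ge0 => //; apply/exprn_ge0/ltW.
Qed.

(* Dividing a series without terms of order
   less than [N] by its first variables lowers [N], and [(T : x_i)] is again an ideal. *)
Lemma germ_ideal_order N T u : germ_ideal T ->
  (forall m : 'X_{1..n}, mdeg m = N -> T (series_of 'X_[m])) ->
  germ u -> (forall m, (mdeg m < N)%N -> u m = 0) -> T u.
Proof.
elim: N T u => [|N IHN] T u [sT mT] XT gu u0.
  have := mT u (series_of 1) gu; rewrite mul_seriesC mul_series1; apply.
  by rewrite -mpolyX0; apply: XT; rewrite mdeg0.
rewrite (var_part_sum (u0 _ _)) ?mdeg0 //; apply: (subspace_sum sT) => i _.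
pose Ti v := T (mul_series (series_of 'X_i) v).
apply: (IHN Ti).
- split; first split.
  + by rewrite /Ti mul_series0; apply: subspace0.
  + by move=> a v w Tv Tw; rewrite /Ti mul_series_linear; apply: sT.2.
  + move=> w v gw Tv; rewrite /Ti mul_seriesA [mul_series _ w]mul_seriesC -mul_seriesA.
    exact: mT.
- move=> m mN; rewrite /Ti -series_ofM -mpolyXD; apply: XT.
  by rewrite mdegD mdeg1 mN.
- exact: germ_var_part.
- move=> m mN; rewrite /var_part; case: ifP => // _; apply: u0.
  by rewrite mdegD mdeg1 addn1.
Qed.

Lemma germ_quotient_finite N T : germ_ideal T ->
  (forall m : 'X_{1..n}, mdeg m = N -> T (series_of 'X_[m])) ->
  exists k, qdim (@germ R n) T k.
Proof.
move=> gT XT; have [sT mT] := gT.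
pose ev (i : 'I_#|{: 'X_{1..n < N}}|) := bmnm (enum_val i).
pose b i := @series_of R n 'X_[ev i].
apply: (span_qdim sT (v := b)) => [i|u gu]; first exact: germ_poly.
exists (\row_i u (ev i)).
apply: (germ_ideal_order gT XT).
  apply: (subspaceB (subspace_germ R n)) => //.
  apply: (subspace_sum (subspace_germ R n)) => i _.
  by apply: (subspaceZ (subspace_germ R n)); apply: germ_poly.
move=> m mN.
have -> : (u - \sum_i (\row_i u (ev i)) 0 i *: b i) m =
    u m - (trunc N u)@_m.
  transitivity (u m - (\sum_i (\row_i u (ev i)) 0 i *: b i) m) => //.
  rewrite fct_sumE; congr (_ - _).
  rewrite /trunc raddf_sum /= [RHS](reindex _ (onW_bij _ (enum_val_bij _))) /=.
  by apply: eq_bigr => i _; rewrite mxE mcoeffZ.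
by rewrite mcoeff_trunc // subrr.
Qed.

Lemma germ_ideal_tjurina h : germ_ideal (tjurina_ideal h).
Proof.
split; first split.
- exists 0, (fun=> 0); split=> [|_|m]; try exact: subspace0 (subspace_germ R n).
  rewrite mul_seriesC mul_series0 big1 ?addr0 // => j _.
  by rewrite mul_seriesC mul_series0.
- move=> a u v [c0 [c [gc0 gc hu]]] [e0 [e [ge0 ge hv]]].
  exists (a *: c0 + e0), (fun j => a *: c j + e j); split.
  + exact: (subspace_germ R n).2.
  + by move=> j; apply: (subspace_germ R n).2.
  move=> m; change (a * u m + v m = mul_series (a *: c0 + e0) (series_of h) m +
     \sum_(j < n) mul_series (a *: c j + e j) (series_of h^`M(j)) m).
  have lin w w' q : mul_series (a *: w + w') (series_of q) m =
      a * mul_series w (series_of q) m + mul_series w' (series_of q) m.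
    by rewrite mul_seriesC mul_series_linear ![mul_series (series_of q) _]mul_seriesC.
  rewrite hu hv lin; under [in RHS]eq_bigr do rewrite lin.
  by rewrite big_split /= -mulr_sumr mulrDr addrACA.
- move=> w u gw [c0 [c [gc0 gc hu]]].
  exists (mul_series w c0), (fun j => mul_series w (c j)); split.
  + exact: germ_mul.
  + by move=> j; apply: germ_mul.
  have -> : u = mul_series c0 (series_of h) + \sum_(j < n) mul_series (c j) (series_of h^`M(j)).
    by apply/funext => m; rewrite hu; congr (_ + _); rewrite fct_sumE.
  move=> m; rewrite mul_seriesDr mul_series_sum mul_seriesA.
  congr (_ + _); rewrite fct_sumE; apply: eq_bigr => j _.
  by rewrite mul_seriesA.
Qed.

Lemma tjurina_ideal_poly h q0 (q : 'I_n -> {mpoly C[n]}) :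
  tjurina_ideal h (series_of (q0 * h + \sum_(j < n) q j * h^`M(j))).
Proof.
exists (series_of q0), (fun j => series_of (q j)); split; try by move=> *; apply: germ_poly.
move=> m; rewrite series_ofD series_of_sum series_ofM.
congr (_ + _); rewrite fct_sumE; apply: eq_bigr => j _.
by rewrite series_ofM.
Qed.

(** Truncating the germ coefficients yields polynomial ones at the price of an error of order [N],
    which the local conductor will absorb. *)
Lemma tjurina_ideal_trunc h p N : tjurina_ideal h (series_of p) ->
  exists q0 (q : 'I_n -> {mpoly C[n]}),
    eqmod N p (q0 * h + \sum_(j < n) q j * h^`M(j)).
Proof.
move=> [c0 [c [_ _ hp]]]; exists (trunc N c0), (fun j => trunc N (c j)) => m mN.
have := hp m; rewrite /series_of => ->; rewrite mcoeffD raddf_sum /=; congr (_ + _).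
  rewrite (mul_seriesE _ _ mN).
  by apply: (eqmodM (eqmod_refl _) (trunc_mcoeff _)).
apply: eq_bigr => j _; rewrite (mul_seriesE _ _ mN).
by apply: (eqmodM (eqmod_refl _) (trunc_mcoeff _)).
Qed.

Lemma tjurina_ideal_unit h s p : s@_0%MM != 0 -> tjurina_ideal h (series_of (s * p)) ->
  tjurina_ideal h (series_of p).
Proof.
move=> sN0 Tsp; have [v gv vs] := germ_inverse sN0.
have := (germ_ideal_tjurina h).2 _ _ gv Tsp.
by rewrite series_ofM mul_seriesA vs mul_series1.
Qed.

(** As the ideal contains all monomials of degree [N], the quotient is finite-dimensional and the
    default value 0 of [tjurina] is ruled out. *)
Lemma tjurina_qdim N h :
  (forall m : 'X_{1..n}, mdeg m = N -> tjurina_ideal h (series_of 'X_[m])) ->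
  qdim (@germ R n) (tjurina_ideal h) (tjurina h).
Proof.
move=> hX; have [k [b [gb hb]]] := germ_quotient_finite (germ_ideal_tjurina h) hX.
have E (k' : nat) (b' : 'I_k' -> series R n) (c : 'rV[C]_k') u :
    (fun m => u m - \sum_(i < k') c 0 i * b' i m) = u - \sum_i c 0 i *: b' i.
  apply/funext => m.
  change (u m - \sum_(i < k') c 0 i * b' i m = u m - (\sum_i c 0 i *: b' i) m).
  by rewrite fct_sumE.
rewrite /tjurina; case: xgetP => [j _ [b' [gb' hb']]|/(_ k)].
  exists b'; split=> // u gu; have [c [hc cu]] := hb' u gu; exists c.
  split; first by rewrite -E.
  by move=> c' hc'; apply: cu; rewrite E.
case; exists b; split=> // u gu; have [c [hc cu]] := hb u gu; exists c.
split; first by rewrite E.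
by move=> c' hc'; apply: cu; rewrite -E.
Qed.

End GermIdeals.

(** * The Jacobian ideal and the local Tjurina algebras *)

(** A monomial of degree [c] as a product of [c] variables, to be paired one by one with the [c]
    eigenvalues. *)
Lemma monomial_listing n c (m : 'X_{1..n}) : mdeg m = c -> exists j : 'I_c -> 'I_n,
  forall (A : comNzRingType) (x : 'I_n -> A), \prod_i x i ^+ m i = \prod_b x (j b).
Proof.
elim: c m => [|c IHc] m hm.
  have m0 : m = 0%MM by apply/eqP; rewrite -mdeg_eq0 hm.
  have j0 : 'I_0 -> 'I_n by case.
  exists j0 => A x; by rewrite big_ord0 big1 // => i _; rewrite m0 mnm0E expr0.
have [i mi] : exists i, m i != 0%N by apply: mdeg_gt0; rewrite hm.
have Um : (U_(i) <= m)%MM by rewrite lep1mP.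
have [|j hj] := IHc (m - U_(i))%MM.
  by move: hm; rewrite -{1}(submK Um) mdegD mdeg1 addn1 => -[].
exists (fun b => if unlift ord0 b is Some b' then j b' else i) => A x.
rewrite big_ord_recl unlift_none; under [in RHS]eq_bigr do rewrite liftK.
rewrite -hj -{1}(submK Um); under eq_bigr do rewrite mnmDE exprD.
rewrite big_split /= mulrC; congr (_ * _).
rewrite (bigD1 i) //= mnm1E eqxx expr1 big1 ?mulr1 // => k ki.
by rewrite mnm1E eq_sym (negPf ki) expr0.
Qed.

Lemma submonomial n N (m : 'X_{1..n}) : (N <= mdeg m)%N ->
  exists2 a : 'X_{1..n}, (a <= m)%MM & mdeg a = N.
Proof.
move=> Nm; rewrite -(subKn Nm); move: (mdeg m - N)%N (leq_subr N (mdeg m)) => k.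
elim: k => [_|k IHk km]; first by exists m; rewrite ?subn0 ?lepm_refl.
have [a am ha] := IHk (ltnW km).
have [i ai] : exists i, a i != 0%N by apply: mdeg_gt0; rewrite ha subn_gt0.
have Ua : (U_(i) <= a)%MM by rewrite lep1mP.
exists (a - U_(i))%MM; first exact: lepm_trans (lem_subr _ _) am.
by have := ha; rewrite -{1}(submK Ua) mdegD mdeg1; lia.
Qed.

Section LocalGlobal.
Variables (K : numClosedFieldType) (n : nat).
Notation S := {mpoly K[n.+1]}.
Variables (f : S) (d : nat) (l : S) (k0 : nat).
Hypotheses (hf : f \is d.-homog) (d_gt0 : (0 < d)%N) (hl : l \is 1.-homog).

Definition jacobian : S -> Prop := idl finset.setT (fun j => f^`M(j)).

Hypothesis cofinite : forall k, (k0 <= k)%N -> HF (addI jacobian l) k = 0%N.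

Let dN0 : d%:R != 0 :> K. Proof. by rewrite pnatr_eq0 -lt0n. Qed.

Lemma jacobian_hom : hom_ideal jacobian.
Proof. by apply: (idl_hom _ (e := fun=> d.-1)) => j; apply: mderiv_homog. Qed.

Let iJ : is_ideal jacobian := jacobian_hom.1.
Let sJ : subspace jacobian := hom_ideal_subspace jacobian_hom.

Lemma jacobian_deriv j : jacobian f^`M(j).
Proof. by apply: (idl_gen (fun j => f^`M(j))); rewrite inE. Qed.

Lemma jacobian_f : jacobian f.
Proof.
have -> : f = d%:R^-1 *: \sum_i 'X_i * f^`M(i).
  by rewrite (Euler_formula hf) -mpolyC_nat mul_mpolyC scalerA mulVf // scale1r.
apply: (subspaceZ sJ); apply: (subspace_sum sJ) => i _.
by apply: idealM => //; apply: jacobian_deriv.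
Qed.

Lemma jacobian_vanish q p : jacobian q -> (forall j, (f^`M(j)).@[p] = 0) -> q.@[p] = 0.
Proof.
move=> [c ->] hp; rewrite raddf_sum big1 //= => j _.
by rewrite mevalM hp mulr0.
Qed.

Lemma jacobian_zero_l_neq0 (p : 'I_n.+1 -> K) : (exists i, p i != 0) ->
  (forall j, (f^`M(j)).@[p] = 0) -> l.@[p] != 0.
Proof.
move=> [i pi] dfp; apply: contraNneq pi => lp.
have /(HF_eq0 _ (hom_ideal_subspace (addI_hom jacobian_hom hl))) := cofinite (leqnn k0).
move=> /(_ ('X_i ^+ k0)) [|q].
  by rewrite -[k0 in X in X.-homog]mul1n; apply: dhomogMn; rewrite dhomogX; apply/eqP/mdeg1.
move=> /jacobian_vanish/(_ dfp); rewrite mevalB mevalM lp mulr0 subr0 rmorphXn /= mevalXU.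
by move/eqP; rewrite expf_eq0 => /andP[_ /eqP ->].
Qed.

Section AtAPoint.
Variables (piv : 'I_n.+1) (p : 'I_n.+1 -> K).
Hypotheses (ppiv : p piv = 1) (dfp : forall j, (f^`M(j)).@[p] = 0).
Notation pchart := (chart piv p).
Notation cvar := (chart_var piv p).
Let h := pchart f.

Lemma chart_local_equation : pchart f = h. Proof. by []. Qed.

Lemma chart_local_equation_deriv k : pchart f^`M(lift piv k) = h^`M(k).
Proof. by rewrite -mderiv_chart. Qed.

Lemma chart_var_vanish j : (cvar j).@[p] = 0.
Proof. by rewrite mevalB mevalZ !mevalXU ppiv mulr1 subrr. Qed.

Lemma chart_var_homog j : cvar j \is 1.-homog.
Proof. by apply: rpredB; last apply: dhomogZ; rewrite dhomogX; apply/eqP/mdeg1. Qed.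

(** Euler's relation eliminates the derivative in the direction of the pivot, so [J] restricts into
    the polynomial part of the Tjurina ideal. *)
Lemma jacobian_chart q : jacobian q -> exists q0 (r : 'I_n -> {mpoly K[n]}),
  pchart q = q0 * h + \sum_(j < n) r j * h^`M(j).
Proof.
have alg (x y z a b : {mpoly K[n]}) : x * (y * z - b) + a = x * y * z + (a - x * b) by ring.
have E : pchart f^`M(piv) =
    d%:R *: h - \sum_(i < n) pchart 'X_(lift piv i) * h^`M(i).
  have E0 := congr1 pchart (Euler_formula hf).
  rewrite chart_sum (bigD1_ord piv isT) /= chartM (chart_piv ppiv) mul1r in E0.
  have E1 : \sum_(i < n) pchart ('X_(lift piv i) * f^`M(lift piv i)) =
      \sum_(i < n) pchart 'X_(lift piv i) * h^`M(i).
    by apply: eq_bigr => i _; rewrite chartM chart_local_equation_deriv.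
  rewrite E1 -mpolyC_nat mul_mpolyC chartZ chart_local_equation in E0.
  by rewrite -E0 addrK.
move=> [c ->]; exists (pchart (c piv) * d%:R%:MP).
exists (fun j => pchart (c (lift piv j)) - pchart (c piv) * pchart 'X_(lift piv j)).
pose A := \sum_(j < n) pchart (c (lift piv j)) * h^`M(j).
pose B := \sum_(j < n) pchart 'X_(lift piv j) * h^`M(j).
have -> : \sum_(j < n) (pchart (c (lift piv j)) - pchart (c piv) * pchart 'X_(lift piv j)) *
    h^`M(j) = A - pchart (c piv) * B.
  rewrite /A /B mulr_sumr -sumrB; apply: eq_bigr => j _.
  by rewrite mulrBl mulrA.
have -> : pchart (\sum_(i in finset.setT) c i * f^`M(i)) = pchart (c piv) * (d%:R *: h - B) + A.
  rewrite chart_sum (bigD1_ord piv) ?inE //= chartM E; congr (_ + _).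
  by apply: eq_big => j; rewrite ?inE // chartM chart_local_equation_deriv.
rewrite -mul_mpolyC; clearbody A B; exact: alg.
Qed.

(** Once [M] exceeds the degrees of all terms, each term homogenizes to a multiple of [f] or of one
    of its derivatives. *)
Lemma hz_jacobian q0 (r : 'I_n -> {mpoly K[n]}) : exists M0, forall M, (M0 <= M)%N ->
  jacobian (hz piv p M (q0 * h + \sum_(j < n) r j * h^`M(j))).
Proof.
pose B := (msize q0 + \max_(j < n) msize (r j))%N.
exists (B + d)%N => M hM; have dM : (d <= M)%N by lia.
have q0M : (msize q0 <= (M - d).+1)%N by rewrite /B in hM; lia.
have rM j : (msize (r j) <= (M - d.-1).+1)%N.
  have : (msize (r j) <= \max_(j < n) msize (r j))%N.
    exact: (leq_bigmax (F := fun j => msize (r j))).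
  by rewrite /B in hM; lia.
have hM1 : msize (h) = msize (pchart f) by [].
have sz0 : (msize (q0 * h) <= M.+1)%N.
  by rewrite -(subnK dM); apply: msizeM_leq => //; apply: (@msize_chart _ _ _ _ d f hf).
have dM1 : (d.-1 <= M)%N by lia.
have szr j : (msize (r j * h^`M(j)) <= M.+1)%N.
  rewrite -(subnK dM1) -chart_local_equation_deriv; apply: msizeM_leq => //.
  by apply: msize_chart; apply: mderiv_homog.
rewrite hzD //; last by apply: msize_sum_leq => j _.
rewrite hz_sum //; apply: (subspaceD sJ).
  rewrite -{1}(subnK dM) -chart_local_equation (hz_chartM _ hf) //.
  by apply: idealM => //; apply: jacobian_f.
apply: (subspace_sum sJ) => j _.
rewrite -{1}(subnK dM1) -chart_local_equation_deriv (hz_chartM _ (mderiv_homog _ hf)) //.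
by apply: idealM => //; apply: jacobian_deriv.
Qed.

(* [s] vanishes at the other eigenvalues to a high order: it brings the local behaviour
   at [p] back to [J]. *)
Lemma local_conductor : exists s e N, [/\ s \is e.-homog, s.@[p] != 0 &
  forall m : 'X_{1..n}, (N <= mdeg m)%N -> jacobian (s * \prod_j cvar j ^+ m j)].
Proof.
have [k1 [c [lam [laml lamJ _ lamnil _]]]] := eigen_points jacobian_hom hl cofinite.
have pN0 : exists i, p i != 0 by exists piv; rewrite ppiv oner_neq0.
have lp := jacobian_zero_l_neq0 pN0 dfp.
pose p1 (i : 'I_n.+1) := (l.@[p])^-1 * p i.
(* [p1] is [p] rescaled to [l = 1], like the eigenvalues. [L b] is [x_i - lam b i * l] for a
   coordinate where [lam b] and [p1] differ, and [l] if they coincide. *)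
have /choice[L hL] : forall b : 'I_c, exists Lb : S,
    [/\ Lb \is 1.-homog, Lb.@[p] != 0 & lam b <> p1 -> Lb.@[lam b] = 0].
  move=> b; have [lb|nlb] := pselect (lam b = p1).
    by exists l; split.
  have [i lbi] : exists i, lam b i != p1 i.
    apply: contrapT => /forallNP nlb'; apply: nlb; apply/funext => i.
    by have /negP := nlb' i; rewrite negbK => /eqP.
  exists ('X_i - lam b i *: l); split.
  - by apply: rpredB; [rewrite dhomogX; apply/eqP/mdeg1|apply: dhomogZ].
  - rewrite mevalB mevalZ mevalXU subr_eq0; apply: contraNneq lbi => E.
    by rewrite /p1 E mulrCA mulVf ?mulr1.
  - by rewrite mevalB mevalZ mevalXU laml mulr1 subrr.
pose s := 'X_piv ^+ k1 * \prod_b L b.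
have hX : 'X_piv ^+ k1 \is [in K[n.+1], k1.-homog].
  by rewrite -[X in X.-homog]mul1n; apply: dhomogMn; rewrite dhomogX; apply/eqP/mdeg1.
have hprod (F : 'I_c -> S) : (forall b, F b \is 1.-homog) -> \prod_b F b \is c.-homog.
  move=> hF; rewrite -[X in X.-homog]card_ord -sum1_card.
  by elim/big_rec2: _ => [|b a y _ IH]; [exact: dhomog1|apply: dhomogM].
exists s, (k1 + c)%N, c; split.
- by apply: dhomogM => //; apply: hprod => b; case: (hL b).
- rewrite mevalM rmorphXn /= mevalXU ppiv expr1n mul1r rmorph_prod.
  by apply/prodf_neq0 => b _; case: (hL b).
move=> m /submonomial[a am ha].
have -> : \prod_j cvar j ^+ m j = \prod_j cvar j ^+ (m - a)%MM j * \prod_j cvar j ^+ a j.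
  by rewrite -big_split /=; apply: eq_bigr => j _; rewrite -exprD -mnmDE submK.
have [j hj] := monomial_listing ha; rewrite hj.
(* Each [P b] vanishes at [lam b]: a chart variable if this is the point [p], the separating form
   otherwise. Thus [c] chart variables, one per eigenvalue, always suffice for [eigen_nilp]. *)
pose P b := if `[< lam b = p1 >] then cvar (j b) else L b.
pose Q b := if `[< lam b = p1 >] then L b else cvar (j b).
have PQ : \prod_b L b * \prod_b cvar (j b) = \prod_b P b * \prod_b Q b.
  rewrite -!big_split /=; apply: eq_bigr => b _; rewrite /P /Q.
  by case: ifP => // _; rewrite mulrC.
have -> : s * (\prod_j cvar j ^+ (m - a)%MM j * \prod_b cvar (j b)) =
    (\prod_b Q b * \prod_j cvar j ^+ (m - a)%MM j) * (\prod_b P b * 'X_piv ^+ k1).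
  rewrite /s; move: PQ; set x1 := \prod_b L b; set x2 := \prod_b cvar (j b).
  set x3 := \prod_b P b; set x4 := \prod_b Q b; set x5 := \prod_j0 _ => PQ.
  transitivity ('X_piv ^+ k1 * x5 * (x1 * x2)); first by ring.
  by rewrite PQ; ring.
apply: idealM => //; apply: (lamnil P (fun=> 1%N)) => //.
  by move=> b; rewrite /P; case: ifP => _; [exact: chart_var_homog|case: (hL b)].
move=> b; rewrite /P; case: asboolP => [lb|]; last by case: (hL b).
by rewrite lb (meval_homogZ _ _ (chart_var_homog _)) chart_var_vanish mulr0.
Qed.

Lemma mcoeff0_chart s : (pchart s)@_0%MM = s.@[p].
Proof.
have -> (q : {mpoly K[n]}) : q@_0%MM = q.@[fun=> 0].
  rewrite mevalE; have [q0|q0] := boolP (0%MM \in msupp q).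
    rewrite (bigD1_seq 0%MM) //= big1 ?mulr1 ?msupp_uniq //; last by move=> i _; rewrite mnm0E.
    rewrite big1 ?addr0 // => m mN0.
    have [i mi] : exists i, m i != 0%N by apply: mdeg_gt0; rewrite lt0n mdeg_eq0.
    by rewrite (bigD1 i) //= expr0n (negPf mi) mul0r mulr0.
  rewrite memN_msupp_eq0 // big_seq big1 // => m mq.
  have [i mi] : exists i, m i != 0%N.
    by apply: mdeg_gt0; rewrite lt0n mdeg_eq0; apply: contraNneq q0 => <-.
  by rewrite (bigD1 i) //= expr0n (negPf mi) mul0r mulr0.
rewrite chart_eval; apply: meval_eq => j.
by case: (unlift _ _) => [k|]; rewrite addr0.
Qed.

(** In the chart the conductor has a nonzero constant term, so it is a unit of the ring of germs and
    all monomials of degree [N] will lie in the Tjurina ideal. *)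
Lemma local_finiteness : exists s N, (pchart s)@_0%MM != 0 /\
  forall m : 'X_{1..n}, mdeg m = N -> exists q0 (r : 'I_n -> {mpoly K[n]}),
    pchart s * 'X_[m] = q0 * h + \sum_(j < n) r j * h^`M(j).
Proof.
have [s [e [N [hs sp0 sJ']]]] := local_conductor.
exists s, N; rewrite mcoeff0_chart; split=> // m mN.
have [|q0 [r E]] := jacobian_chart (sJ' m _); first by rewrite mN.
exists q0, r; rewrite -E chartM chart_prod; congr (_ * _); rewrite mpolyXE_id.
by apply: eq_bigr => j _; rewrite chartX chart_chart_var.
Qed.

(** Modulo order [N], the chart of [F] is a polynomial combination whose homogenization is in [J];
    the remaining terms have order at least [N], and the conductor sends them into [J]. *)
Lemma local_to_global k F : F \is k.-homog ->
  (forall N, exists q0 (r : 'I_n -> {mpoly K[n]}),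
     eqmod N (pchart F) (q0 * h + \sum_(j < n) r j * h^`M(j))) ->
  exists s e, [/\ s \is e.-homog, s.@[p] != 0 & jacobian (s * F)].
Proof.
move=> hF TF; have [s [e [N [hs sp0 sJ']]]] := local_conductor.
have [q0 [r Fqr]] := TF N.
set Q := q0 * h + _ in Fqr; pose rest := pchart F - Q.
have [M0 hM0] := hz_jacobian q0 r; rewrite -/Q in hM0.
pose M := (M0 + k + msize Q)%N.
have kM : (k <= M)%N by rewrite /M; lia.
exists (s * 'X_piv ^+ (M - k)), (e + (M - k))%N; split.
- apply: dhomogM => //; rewrite -[X in X.-homog]mul1n; apply: dhomogMn.
  by rewrite dhomogX; apply/eqP/mdeg1.
- by rewrite mevalM rmorphXn /= mevalXU ppiv expr1n mulr1.
rewrite -mulrA -(hz_chart ppiv _ hF) subnK //.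
have szF : (msize (pchart F) <= M.+1)%N.
  by apply: leq_trans (msize_chart _ _ hF) _; rewrite ltnS.
have szQ : (msize Q <= M.+1)%N by rewrite /M; lia.
have szr : (msize rest <= M.+1)%N.
  by apply: msizeD_leq; rewrite ?mmeasureN.
have -> : pchart F = Q + rest by rewrite addrC subrK.
rewrite hzD // mulrDr; apply: (subspaceD sJ).
  by apply: idealM => //; apply: hM0; rewrite /M; lia.
rewrite /hz mulr_sumr big_seq; apply: (subspace_sum sJ) => m mr.
have Nm : (N <= mdeg m)%N.
  rewrite leqNgt; apply/negP => mN; move: mr; rewrite mcoeff_msupp mcoeffB Fqr //.
  by rewrite subrr eqxx.
rewrite -scalerAr mulrCA; apply: (subspaceZ sJ); apply: idealM => //.
exact: sJ'.
Qed.

End AtAPoint.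

(** At each eigenvalue some form not vanishing there multiplies [F] into [J]. A generic combination
    of these forms vanishes at no eigenvalue, hence can be cancelled in large degree. *)
Lemma jacobian_of_local : exists k1, forall k F, (k1 <= k)%N -> F \is k.-homog ->
  (forall v, (exists i, v i != 0) -> (forall j, (f^`M(j)).@[v] = 0) ->
     exists piv c, [/\ c != 0, c * v piv = 1 & forall N,
       exists q0 (r : 'I_n -> {mpoly K[n]}), let p i := c * v i in
       eqmod N (chart piv p F) (q0 * chart piv p f + \sum_(j < n) r j * (chart piv p f)^`M(j))]) ->
  jacobian F.
Proof.
have [k1 [c [lam [laml lamJ lamreg _ _]]]] := eigen_points jacobian_hom hl cofinite.
exists k1 => k F k1k hF hloc.
have /choice[s hs] : forall a : 'I_c, exists se : S * nat,
    [/\ se.1 \is se.2.-homog, se.1.@[lam a] != 0 & jacobian (se.1 * F)].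
  move=> a.
  have vN0 : exists i, lam a i != 0.
    apply: contrapT => /forallNP v0; have := laml a.
    rewrite (meval0_homog (isT : 0 < 1)%N hl); last first.
      by move=> i; apply/eqP; have /negP := v0 i; rewrite negbK.
    by move/eqP; rewrite eq_sym oner_eq0.
  have dfv j : (f^`M(j)).@[lam a] = 0.
    by apply: (lamJ d.-1); [exact: mderiv_homog|exact: jacobian_deriv].
  have [piv [t [tN0 tpiv loc]]] := hloc _ vN0 dfv.
  have dfp j : (f^`M(j)).@[fun i => t * lam a i] = 0.
    by rewrite (meval_homogZ _ _ (mderiv_homog j hf)) dfv mulr0.
  have [q [e [hq qp qF]]] := local_to_global tpiv dfp hF loc.
  exists (q, e); split=> //=; apply: contraNneq qp => q0.
  by rewrite (meval_homogZ _ _ hq) q0 mulr0.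
pose e := (\sum_a (s a).2)%N.
have ea a : ((s a).2 <= e)%N by rewrite /e (bigD1 a) //= leq_addr.
(* Powers of [l], which is 1 at every eigenvalue, bring the multipliers to a common degree. *)
pose t a := l ^+ (e - (s a).2) * (s a).1.
have ht a : t a \is e.-homog.
  rewrite -[X in X.-homog](subnK (ea a)); apply: dhomogM; last by case: (hs a).
  by rewrite -[X in X.-homog]mul1n; apply: dhomogMn.
have [z hz] : exists z : K, forall a, \sum_(b < c) z ^+ b * (t b).@[lam a] != 0.
  apply: (generic_power (u := fun a b => (t b).@[lam a])) => a; exists a.
  by rewrite mevalM rmorphXn /= laml expr1n mul1r; case: (hs a).
apply: (lamreg e (\sum_(b < c) z ^+ b *: t b) k) => //.
- by apply: rpred_sum => b _; apply: dhomogZ.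
- move=> a; rewrite raddf_sum /=; under eq_bigr do rewrite mevalZ; exact: hz.
rewrite mulr_suml; apply: (subspace_sum sJ) => b _.
rewrite -scalerAl; apply: (subspaceZ sJ); rewrite -mulrA; apply: idealM => //.
by case: (hs b).
Qed.

End LocalGlobal.

(** * The upper bound by the total Tjurina number *)

Section TjurinaBound.
Variables (R : realType) (n : nat).
Notation K := R[i].
Notation S := {mpoly K[n.+1]}.
Variables (f : S) (d : nat) (l : S) (k0 : nat).
Hypotheses (hf : f \is d.-homog) (d_gt0 : (0 < d)%N) (hl : l \is 1.-homog).
Hypothesis cofinite : forall k, (k0 <= k)%N -> HF (addI (jacobian f) l) k = 0%N.

Lemma tjurina_qdim_singular p : normalized p -> singular f p ->
  qdim (@germ R n) (tjurina_ideal (local_equation f p)) (tjurina (local_equation f p)).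
Proof.
move=> np [pN0 fp dfp].
have [s [N [s0 hs]]] := local_finiteness hf hl cofinite np dfp.
apply: (tjurina_qdim (N := N)) => m mN.
have [q0 [r E]] := hs m mN.
apply: (tjurina_ideal_unit s0).
by have := tjurina_ideal_poly (local_equation f p) q0 r; rewrite -E.
Qed.

Lemma jacobian_of_tjurina : exists k1, forall k F, (k1 <= k)%N -> F \is k.-homog ->
  (forall p, normalized p -> singular f p ->
     tjurina_ideal (local_equation f p) (series_of (chart (pivot p) (p 0) F))) ->
  jacobian f F.
Proof.
have [k1 hk1] := jacobian_of_local hf d_gt0 hl cofinite; exists k1 => k F k1k hF hloc.
apply: (hk1 k) => // v [i0 vi0] dfv.
pose w : 'rV[K]_n.+1 := \row_i v i.
have wE q : q.@[w 0] = q.@[v] by apply: meval_eq => i; rewrite mxE.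
have wi i : w 0 i = v i by rewrite mxE.
have wN0 : w != 0 by apply/rV0Pn; exists i0; rewrite mxE.
have pN0 := pivot_neq0 wN0; have ipN0 : (w 0 (pivot w))^-1 != 0 by rewrite invr_eq0.
exists (pivot w), (w 0 (pivot w))^-1; split=> //; first by rewrite -wi mulVf.
pose p := (w 0 (pivot w))^-1 *: w.
have np : normalized p by rewrite /normalized /p pivotZ // mxE mulVf.
have pE : p 0 = fun i => (w 0 (pivot w))^-1 * v i by apply/funext => i; rewrite !mxE.
have ev (q : S) e : q \is e.-homog -> q.@[p 0] = (w 0 (pivot w))^-1 ^+ e * q.@[v].
  by move=> hq; rewrite -(meval_homogZ _ _ hq) pE.
have sp : singular f p.
  split.
  - by rewrite scaler_eq0 negb_or ipN0.
  - rewrite (ev f d) //; have -> := jacobian_vanish (jacobian_f hf d_gt0) dfv.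
    by rewrite mulr0.
  - by move=> j; rewrite (ev _ d.-1) ?mderiv_homog // dfv mulr0.
move=> N; have := hloc p np sp => /(tjurina_ideal_trunc N)[q0 [r E]].
exists q0, r => /=; rewrite -pE -(pivotZ w ipN0) -/p.
exact: E.
Qed.

(** In large degree [J] contains the space [W s] of forms satisfying the Tjurina conditions at all
    singular points; each point adds at most its Tjurina number to the codimension. *)
Lemma HF_jacobian_le_tjurina :
  finite_set [set p | normalized p /\ singular f p]%classic ->
  exists k1, forall k, (k1 <= k)%N -> (HF (jacobian f) k <= total_tjurina f)%N.
Proof.
move=> finD; have [k1 hk1] := jacobian_of_tjurina; exists k1 => k k1k.
rewrite /total_tjurina (fsbig_finite _ _ finD) /=.
set s := finmap.enum_fset _.
have sD p : p \in s -> normalized p /\ singular f p.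
  by rewrite in_fset_set // inE.
pose W (r : seq 'rV[K]_n.+1) (F : S) := forall p, p \in r ->
  tjurina_ideal (local_equation f p) (series_of (chart (pivot p) (p 0) F)).
have lphi (p : 'rV[K]_n.+1) : linear (fun F => series_of (chart (pivot p) (p 0) F)).
  by move=> a u v; rewrite chart_linear series_of_linear.
have sT (p : 'rV[K]_n.+1) : subspace (tjurina_ideal (local_equation f p)).
  exact: (germ_ideal_tjurina _).1.
have sW r : subspace (W r).
  split=> [p _|a u v Wu Wv p pr].
    rewrite chart0 series_of0; exact: subspace0.
  by rewrite lphi; apply: (sT p).2; [apply: Wu|apply: Wv].
apply: (@leq_trans (HF (W s) k)).
  apply: (HF_le (sW s) (hom_ideal_subspace (jacobian_hom hf))) => F hF WF.
  apply: (hk1 k) => // p np sp; apply: WF.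
  by rewrite in_fset_set // inE.
elim: s sD => [_|p r IHr sD].
  rewrite big_nil leqn0; apply/eqP/(HF_eq0 _ (sW _)) => F _ p.
  by rewrite in_nil.
have [np sp] := sD p (mem_head _ _).
rewrite big_cons addnC; apply: (@leq_trans (HF (W r) k + tjurina (local_equation f p))%N).
  have sh := subspace_homogs K n.+1 k.
  apply: (qdim_meet_leq sh (sW r) (subspace_germ R n) (sT p) (lphi p) _
    (HFP k (sW r)) (tjurina_qdim_singular np sp)).
    by move=> u _; apply: germ_poly.
  apply: (qdim_ext _ sh (HFP k (sW (p :: r)))) => F _; split=> [WF|[WF Tp] q].
    by split=> [q qr|]; apply: WF; rewrite inE ?eqxx ?qr ?orbT.
  by rewrite inE => /orP[/eqP -> //|]; apply: WF.
by rewrite leq_add2r; apply: IHr => q qr; apply: sD; rewrite inE qr orbT.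
Qed.

End TjurinaBound.

(** * The lower bound for the Hilbert function of the Jacobian ideal *)

Section Regular.
Variables (K : numClosedFieldType) (n m : nat).
Notation S := {mpoly K[n]}.
Implicit Types (L : 'I_m -> S).

Lemma meval_linear_form (p : S) (c : K) v w : p \is 1.-homog ->
  p.@[fun i => w i - c * v i] = p.@[w] - c * p.@[v].
Proof.
move=> /dhomogP hp; rewrite !mevalE mulr_sumr -sumrB !big_seq; apply: eq_bigr => k /hp hk.
have /mdeg1P[i /eqP ->] : mdeg k == 1%N by apply/eqP.
have E (x : 'I_n -> K) : \prod_j x j ^+ U_(i)%MM j = x i.
  rewrite (bigD1 i) //= mnm1E eqxx expr1 big1 ?mulr1 // => j ji.
  by rewrite mnm1E eq_sym (negPf ji) expr0.
by rewrite !E; ring.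
Qed.

(** Finite colength puts a power of every variable in the ideal. *)
Lemma colength_zero L D w : colength (idl [set: 'I_m] L) D ->
  (forall i, (exists e, L i \is e.-homog)) ->
  (forall i, (L i).@[w] = 0) -> forall i, w i = 0.
Proof.
move=> lL /choice[e hL] Lw i; have [k0 hk0] := colength_HF0 lL.
have hI := idl_hom [set: 'I_m] hL.
have /(HF_eq0 _ (hom_ideal_subspace hI))/(_ ('X_i ^+ k0)) := hk0 _ (leqnn k0).
case=> [|q].
  rewrite -[k0 in X in X.-homog]mul1n; apply: dhomogMn; rewrite dhomogX.
  exact/eqP/mdeg1.
move=> /(congr1 (fun p => p.@[w])); rewrite rmorphXn /= mevalXU raddf_sum big1 /=.
  by move/eqP; rewrite expf_eq0 => /andP[_ /eqP].
by move=> j _; rewrite mevalM Lw mulr0.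
Qed.

(** Each entry of a syzygy lies in the ideal of the other members, which contains no nonzero form of
    degree [r]. *)
Lemma regular_syzygy L (e : 'I_m -> nat) (T : {set 'I_m}) (b : 'I_m -> S) r :
  regular_family L -> (forall i, L i \is (e i).-homog) -> (forall i, i \in T -> (r < e i)%N) ->
  (forall i, b i \is r.-homog) -> \sum_(i in T) b i * L i = 0 ->
  forall i, i \in T -> b i = 0.
Proof.
move=> rL hL re hb sum0 i iT.
have iTi : i \notin T :\ i by rewrite !inE eqxx.
have : idl (T :\ i) L (b i).
  apply: (rL _ _ iTi); move: sum0; rewrite (big_setD1 i) //= => /eqP.
  rewrite addr_eq0 => /eqP ->; exists (fun k => - b k).
  by rewrite -sumrN; apply: eq_bigr => k _; rewrite mulNr.
move=> [q bq]; rewrite -(pihomog_dE (hb i)) bq raddf_sum big1 //= => k.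
by rewrite inE => /andP[_ kT]; apply: (pihomogM0 _ (hL k)); apply: re.
Qed.

End Regular.

(** * Polar combinations, the colon ideal and the lower bound *)

Section LowerBound.
Variables (K : numClosedFieldType) (n : nat).
Notation S := {mpoly K[n.+1]}.
Notation X := (fun i : 'I_n.+1 => 'X_i : S).
Variables (f : S) (d : nat) (t : K).
Hypotheses (hf : f \is d.-homog) (d_gt1 : (1 < d)%N).

(* A single parameter is enough for [l] to avoid finitely many points, by [generic_power]. *)
Definition generic_linear_form : S := \sum_(i < n.+1) t ^+ i *: 'X_i.
Notation l := generic_linear_form.

Hypothesis l_nonvanishing : forall w, (exists i, w i != 0) ->
  (forall j, (f^`M(j)).@[w] = 0) -> l.@[w] != 0.

Let hX i : X i \is 1.-homog. Proof. by rewrite dhomogX; apply/eqP/mdeg1. Qed.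

Lemma generic_linear_form_homog : l \is 1.-homog.
Proof. by apply: rpred_sum => i _; apply: dhomogZ. Qed.

Let hl := generic_linear_form_homog.

Lemma generic_linear_form_eval w : l.@[w] = w ord0 + \sum_(i < n) t ^+ i.+1 * w (lift ord0 i).
Proof.
rewrite raddf_sum big_ord_recl /= mevalZ mevalXU expr0 mul1r; congr (_ + _).
by apply: eq_bigr => i _; rewrite mevalZ mevalXU.
Qed.

Let indices := [seq lift ord0 i | i <- enum 'I_n].

Let mem_indices i : (i \in indices) = (i != ord0).
Proof.
case: (unliftP ord0 i) => [j|] ->.
  by rewrite eq_sym neq_lift mem_map ?mem_enum //; apply: lift_inj.
by rewrite eqxx; apply/negbTE/negP => /mapP[j _ /eqP]; rewrite (negPf (neq_lift _ _)).
Qed.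

Let uniq_indices : uniq indices.
Proof. by rewrite map_inj_uniq ?enum_uniq //; apply: lift_inj. Qed.

Let size_indices : size indices = n.
Proof. by rewrite size_map size_enum_ord. Qed.

(** The coefficient of [x_0] in [l] is [t ^+ 0 = 1], so [l, x_1, ..., x_n] is again a coordinate
    system. Index 0 stays reserved for [l]. *)
Let L1 := upd X ord0 l.

Let hL1 i : L1 i \is 1.-homog.
Proof. by rewrite /L1 /upd; case: ifP. Qed.

Let L1_spec : regular_family L1 /\ colength (idl [set: 'I_n.+1] L1) 1.
Proof.
rewrite -[X in colength _ X](mul1n 1).
apply: (@regular_exchange1 _ _ _ X (fun=> 1%N)) => //.
- exact: regular_variables.
- exact: colength_variables.
move=> w [i wi] w0; rewrite generic_linear_form_eval big1 ?addr0.
  case: (unliftP ord0 i) wi => [j|] -> //.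
  by have := w0 (lift ord0 j); rewrite mevalXU eq_sym neq_lift => -> //; rewrite eqxx.
by move=> j _; have := w0 (lift ord0 j); rewrite mevalXU eq_sym neq_lift => -> //; rewrite mulr0.
Qed.

(** All coordinates but [l] are exchanged for combinations of derivatives. The condition is that the
    derivatives have no common zero on [l = 0], which is the hypothesis on [l]. *)
Let polar_family : exists C : 'I_n.+1 -> 'I_n.+1 -> K,
  let L i := if i \in indices then \sum_k C i k *: f^`M(k) else L1 i in
  regular_family L /\ colength (idl [set: 'I_n.+1] L) (d.-1 ^ n).
Proof.
have [rL1 lL1] := L1_spec.
have [|||||C] := @regular_exchange _ _ _ _ (fun k => f^`M(k)) d.-1 indices L1 (fun=> 1%N) 1
  hL1 _ _ _ uniq_indices _ rL1 lL1.
- by [].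
- by lia.
- by move=> i; apply: mderiv_homog.
- by [].
- move=> w wN0 /(_ ord0); rewrite mem_indices eqxx /L1 /upd eqxx => /(_ isT) lw.
  apply: contrapT => /forallNP fw; have := l_nonvanishing wN0.
  rewrite lw eqxx => h; suff: false by []; apply: h => j.
  by apply/eqP; have /negP := fw j; rewrite negbK.
by rewrite size_indices muln1; exists C.
Qed.

Lemma jacobian_cofinite : exists k0, forall k, (k0 <= k)%N -> HF (addI (jacobian f) l) k = 0%N.
Proof.
have [C] := polar_family; set L := fun i => _; move=> [rL lL].
have [k0 hk0] := colength_HF0 lL; exists k0 => k k0k.
have sA := hom_ideal_subspace (addI_hom (jacobian_hom hf) hl).
have iA := (addI_hom (jacobian_hom hf) hl).1.
have sL := ideal_subspace (idl_ideal [set: 'I_n.+1] L).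
apply/eqP; rewrite -leqn0 -(hk0 k k0k); apply: HF_le => // p _.
apply: idl_min => // i _; rewrite /L; case: ifP => [_|].
  apply: (subspace_sum sA) => j _; apply: (subspaceZ sA).
  by apply: (addI_sub _ (jacobian_hom hf).1); apply: jacobian_deriv.
rewrite mem_indices => /negbT; rewrite negbK => /eqP ->; rewrite /L1 /upd eqxx.
by have := addI_gen l 1 (jacobian_hom hf).1; rewrite mul1r.
Qed.

(** Substituting [x_0 - l] for [x_0] retracts onto the hyperplane [l = 0] and changes [b] only
    modulo [l]; if [b] vanished on the hyperplane, the substitution would give zero. *)
Let exists_point (b : S) : (forall q, b <> q * l) ->
  exists2 v, l.@[v] = 0 & b.@[v] != 0.
Proof.
move=> bl; apply: contrapT => nv.
pose s := [tuple (if i == ord0 then 'X_i - l else 'X_i) | i < n.+1].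
pose I := addI (fun p : S => p = 0) l.
have i0 : is_ideal (fun p : S => p = 0).
  by split=> // [p q -> ->|p q ->]; rewrite ?addr0 ?mulr0.
have iI : is_ideal I := addI_ideal l i0.
have : I (b - (b \mPo s)).
  apply: comp_mpoly_congr => // i; rewrite tnth_mktuple; case: eqP => [_|_]; last first.
    by rewrite subrr; case: iI.
  rewrite opprB addrC subrK -[X in I X]mul1r; exact: addI_gen.
have -> : b \mPo s = 0.
  apply: mpoly_eval_eq => w; rewrite meval0 comp_mpoly_meval; apply/eqP.
  apply: contrapT => /negP bw; apply: nv.
  exists (fun i => (tnth s i).@[w]) => //.
  have E i : (tnth s i).@[w] = if i == ord0 then w ord0 - l.@[w] else w i.
    by rewrite tnth_mktuple; case: eqP => [->|_]; rewrite ?mevalB mevalXU.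
  rewrite generic_linear_form_eval E eqxx (generic_linear_form_eval w).
  rewrite opprD addrA subrr add0r addrC; apply/eqP; rewrite subr_eq0; apply/eqP.
  by apply: eq_bigr => i _; rewrite E eq_sym (negPf (neq_lift _ _)).
rewrite subr0 => -[q /eqP]; rewrite subr_eq0 => /eqP; exact: bl.
Qed.

(** The given form [b] is not generic, so room must be made for it: all linear members but one are
    chosen to vanish at [v], [b] replaces the remaining one, and then the others except [l] are
    exchanged for combinations of the [g k]. *)
Let second_family N (g : 'I_N -> S) (b : S) e v : (forall k, g k \is d.-1.-homog) ->
    b \is e.-homog -> (0 < e)%N -> l.@[v] = 0 -> b.@[v] != 0 ->
    (forall w, (exists i, w i != 0) -> l.@[w] = 0 -> exists k, (g k).@[w] != 0) ->
  exists L : 'I_n.+1 -> S, [/\ regular_family L,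
    colength (idl [set: 'I_n.+1] L) (d.-1 ^ n.-1 * e), L ord0 = l,
    forall i, exists e', L i \is e'.-homog &
    forall i, i != ord0 -> L i = b \/ exists C : 'I_N -> K, L i = \sum_k C k *: g k].
Proof.
move=> hg hb e_gt0 lv bv gN0; have [rL1 lL1] := L1_spec.
have [i0 i0N0 vi0] : exists2 i0, i0 != ord0 & v i0 != 0.
  apply: contrapT => nv; have v0 j : v j = 0.
    have vl k : v (lift ord0 k) = 0.
      apply/eqP; apply: contrapT => /negP vk; apply: nv.
      by exists (lift ord0 k); rewrite // eq_sym neq_lift.
    case: (unliftP ord0 j) => [k|] ->; first exact: vl.
    by move: lv; rewrite generic_linear_form_eval big1 ?addr0 // => k _; rewrite vl mulr0.
  by move: bv; rewrite (meval0_homog e_gt0 hb v0) eqxx.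
pose s := rem i0 indices.
have us : uniq s := rem_uniq _ uniq_indices.
have mems i : (i \in s) = (i != i0) && (i != ord0).
  by rewrite /s mem_rem_uniq // inE mem_indices.
have szs : size s = n.-1 by rewrite size_rem ?size_indices // mem_indices.
(* Linear forms whose common zeros are the multiples of [v]; on [x_i0 = 0] only the origin is left,
   since [v i0 != 0]. *)
pose y j : S := v i0 *: 'X_j - v j *: 'X_i0.
have hy j : y j \is 1.-homog by apply: rpredB; apply: dhomogZ; apply: hX.
have yE j w : (y j).@[w] = v i0 * w j - v j * w i0.
  by rewrite mevalB !mevalZ !mevalXU.
have L1E i : L1 i = if i == ord0 then l else 'X_i by [].
have [||||C3] := @regular_exchange _ _ _ _ y 1 s L1 (fun=> 1%N) 1
  hL1 _ _ hy us _ rL1 lL1.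
- by [].
- by [].
- by [].
- move=> w [j wj] Lw; exists j.
  have := Lw i0; rewrite mems eqxx L1E (negPf i0N0) mevalXU => /(_ isT) wi0.
  by rewrite yE wi0 mulr0 subr0 mulf_neq0.
set L3 := fun i => _; rewrite exp1n mul1n => -[rL3 lL3].
have hL3 i : L3 i \is 1.-homog.
  by rewrite /L3; case: ifP => // _; apply: rpred_sum => k _; apply: dhomogZ.
have L3v i : i != i0 -> (L3 i).@[v] = 0.
  move=> ii0; rewrite /L3 mems ii0 /= L1E; case: eqP => //= _.
  rewrite raddf_sum big1 //= => k _.
  by rewrite mevalZ yE [v i0 * _]mulrC subrr mulr0.
have L3i0 : L3 i0 = 'X_i0 by rewrite /L3 mems eqxx L1E (negPf i0N0).
(* The members other than [x_i0] vanish at [v] and, jointly with [x_i0], only at the origin. Their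
   common zeros are therefore the multiples of [v], where [b] does not vanish. *)
have [|rL4 lL4] := @regular_exchange1 _ _ _ L3 (fun=> 1%N) i0 e 1 hL3 (fun=> isT)
  erefl rL3 lL3 b hb.
  move=> w [j wj] L3w; pose c := w i0 / v i0.
  have u0 : forall i, w i - c * v i = 0.
    apply: (colength_zero lL3) => [i|i]; first by exists 1%N.
    rewrite (meval_linear_form _ _ _ (hL3 i)); have [->|ii0] := eqVneq i i0.
      by rewrite L3i0 !mevalXU /c divfK // subrr.
    by rewrite L3w // L3v // mulr0 subr0.
  have wE i : w i = c * v i by apply/eqP; rewrite -subr_eq0 u0.
  have cN0 : c != 0 by apply: contraNneq wj => c0; rewrite wE c0 mul0r.
  by rewrite (meval_eq _ wE) (meval_homogZ _ _ hb) mulf_neq0 ?expf_neq0.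
set L4 := upd L3 i0 b in rL4 lL4; rewrite muln1 in lL4.
pose e4 i := if i == i0 then e else 1%N.
have hL4 i : L4 i \is (e4 i).-homog by rewrite /L4 /upd /e4; case: ifP.
have L40 : L4 ord0 = l.
  by rewrite /L4 /upd eq_sym (negPf i0N0) /L3 mems eqxx andbF L1E eqxx.
have [||||C5] := @regular_exchange _ _ _ _ g d.-1 s L4 e4 e hL4 _ _ hg us _ rL4 lL4.
- by move=> i; rewrite /e4; case: ifP.
- by lia.
- by move=> i; rewrite mems /e4 => /andP[/negPf ->].
- move=> w wN0 Lw; apply: gN0 => //; rewrite -L40; apply: Lw.
  by rewrite mems eqxx andbF.
set L5 := fun i => _; rewrite szs => -[rL5 lL5].
exists L5; split=> //.
- by rewrite /L5 mems eqxx andbF L40.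
- move=> i; rewrite /L5; case: ifP => _; last by exists (e4 i).
  by exists d.-1; apply: rpred_sum => k _; apply: dhomogZ.
- move=> i iN0; rewrite /L5 mems iN0 andbT; have [->|ii0] := eqVneq i i0.
    by left; rewrite /L4 /upd eqxx.
  by right; exists (C5 i).
Qed.

Hypothesis n_gt0 : (0 < n)%N.

Lemma HF_jacobian_lower_bound r (a : 'I_n.+1 -> S) : (r < d.-1)%N ->
    AR_hom f r a -> (exists j, a j != 0) ->
  exists k1, forall k, (k1 <= k)%N ->
    (d.-1 ^ n <= HF (jacobian f) k + r * d.-1 ^ n.-1)%N.
Proof.
move=> rd [ha af] [j0 aj0].
have [C] := polar_family; set L := fun i => _; move=> [rL lL].
have L0 : L ord0 = l by rewrite /L mem_indices eqxx /L1 /upd eqxx.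
have Ll i : L (lift ord0 i) = \sum_k C (lift ord0 i) k *: f^`M(k).
  by rewrite /L mem_indices eq_sym neq_lift.
pose eL (i : 'I_n.+1) := if i == ord0 then 1%N else d.-1.
have hL i : L i \is (eL i).-homog.
  rewrite /eL; case: (unliftP ord0 i) => [j|] ->; last by rewrite eqxx L0.
  rewrite eq_sym (negPf (neq_lift _ _)) Ll; apply: rpred_sum => k _.
  by apply: dhomogZ; apply: mderiv_homog.
pose I := idl (~: [set ord0]) L.
have hI : hom_ideal I := idl_hom _ hL.
have iI := hI.1; have sI := hom_ideal_subspace hI.
have nl : nzd I l by rewrite -L0; apply: rL; rewrite !inE eqxx.
have lI : colength (addI I l) (d.-1 ^ n).
  by rewrite -L0 -idl_setU1 ?finset.setUCr // !inE eqxx.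
have [N1 hN1] := colength_HF hI hl nl lI.
have gI i : I (L (lift ord0 i)) by apply: idl_gen; rewrite !inE eq_sym neq_lift.
(* The polar combinations have no syzygy below degree [d - 1]. In degree 0 this gives the
   independence of the rows of [Cm], in degree [r] the nonvanishing of [b ord_max]. *)
have syz (x : 'I_n -> S) e : (e < d.-1)%N -> (forall i, x i \is e.-homog) ->
    \sum_i x i * L (lift ord0 i) = 0 -> forall i, x i = 0.
  move=> ed hx sum0 i.
  pose x' (j : 'I_n.+1) := if unlift ord0 j is Some k then x k else 0.
  have x'l k : x' (lift ord0 k) = x k by rewrite /x' liftK.
  rewrite -x'l; apply: (@regular_syzygy _ _ _ L eL (~: [set ord0]) x' e rL hL).
  - by move=> j; rewrite !inE /eL => /negPf ->.
  - by move=> j; rewrite /x'; case: (unlift _ _) => [k|] //; apply: dhomog0.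
  - rewrite big_mkcond big_ord_recl /= !inE eqxx /= add0r -[RHS]sum0.
    by apply: eq_bigr => k _; rewrite !inE eq_sym neq_lift x'l.
  - by rewrite !inE eq_sym neq_lift.
pose Cm := \matrix_(i < n, k < n.+1) C (lift ord0 i) k.
have freeC : row_free Cm.
  rewrite -kermx_eq0; apply/rowV0P => x /sub_kermxP xC.
  apply/rowP => i; rewrite [RHS]mxE.
  have := syz (fun i => (x 0 i)%:MP) 0%N _ _ _ i.
  rewrite -mpolyC0 => h; apply/eqP; rewrite -(@mpolyC_eq n.+1); apply/eqP; apply: h.
  - by lia.
  - by move=> j; rewrite -alg_mpolyC; apply: dhomogZ; apply: dhomog1.
  under eq_bigr do rewrite Ll mulr_sumr.
  rewrite exchange_big big1 //= => k _.
  under eq_bigr do rewrite mul_mpolyC scalerA.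
  rewrite -scaler_suml; have /rowP/(_ k) := xC; rewrite !mxE.
  under eq_bigr do rewrite mxE.
  by move=> ->; rewrite scale0r.
(* The rank normal form completes the row space of [Cm] to an invertible [E]: the first [n] forms
   [g'] span the same space as the polar combinations, and the last one, [G], generates [J] modulo
   [I]. *)
pose E := row_ebase Cm; have Eu : E \in unitmx := row_ebase_unit Cm.
pose Q := invmx (col_ebase Cm); have Qu : Q \in unitmx by rewrite unitmx_inv col_ebase_unit.
have rkC : \rank Cm = n by apply/eqP.
have EQ i k : E (widen_ord (leqnSn n) i) k = \sum_j Q i j * C (lift ord0 j) k.
  have : pid_mx n *m E = Q *m Cm :> 'M_(n, n.+1).
    by rewrite -{1}(mulmx_ebase Cm) rkC !mulmxA /Q mulVmx ?col_ebase_unit // mul1mx.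
  move/matrixP/(_ i k); rewrite [X in _ = X]mxE.
  under [X in _ = X -> _]eq_bigr do rewrite mxE.
  move=> <-; rewrite mxE (bigD1 (widen_ord (leqnSn n) i)) //= mxE eqxx ltn_ord mul1r.
  rewrite big1 ?addr0 // => j; rewrite -val_eqE /= eq_sym => /negPf ji.
  by rewrite mxE ji mul0r.
pose W := invmx E.
pose g' i := \sum_k E i k *: f^`M(k).
(* The dual change of coefficients keeps the syzygy: [sum b_i g'_i = sum a_k f_k = 0]. *)
pose b i := \sum_k W k i *: a k.
have hg' i : g' i \is d.-1.-homog.
  by apply: rpred_sum => k _; apply: dhomogZ; apply: mderiv_homog.
have hb i : b i \is r.-homog by apply: rpred_sum => k _; apply: dhomogZ.
have fE k : f^`M(k) = \sum_i W k i *: g' i.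
  under eq_bigr do rewrite scaler_sumr.
  rewrite exchange_big /= (bigD1 k) //= [X in _ + X]big1.
    under eq_bigr do rewrite scalerA.
    rewrite addr0 -scaler_suml; have /matrixP/(_ k k) := mulVmx Eu.
    by rewrite !mxE eqxx => ->; rewrite scale1r.
  move=> j jk; under eq_bigr do rewrite scalerA.
  rewrite -scaler_suml; have /matrixP/(_ k j) := mulVmx Eu.
  by rewrite !mxE eq_sym (negPf jk) => ->; rewrite scale0r.
have aE k : a k = \sum_i E i k *: b i.
  under eq_bigr do rewrite scaler_sumr.
  rewrite exchange_big /= (bigD1 k) //= [X in _ + X]big1.
    under eq_bigr do rewrite scalerA mulrC.
    rewrite addr0 -scaler_suml; have /matrixP/(_ k k) := mulVmx Eu.
    by rewrite !mxE eqxx => ->; rewrite scale1r.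
  move=> j jk; under eq_bigr do rewrite scalerA mulrC.
  rewrite -scaler_suml; have /matrixP/(_ j k) := mulVmx Eu.
  by rewrite !mxE (negPf jk) => ->; rewrite scale0r.
have bg' : \sum_i b i * g' i = 0.
  rewrite -[RHS]af; under [in RHS]eq_bigr do rewrite fE mulr_sumr.
  rewrite exchange_big /=; apply: eq_bigr => i _.
  rewrite /b mulr_suml; apply: eq_bigr => k _.
  by rewrite -scalerAl -scalerAr.
have g'w i : g' (widen_ord (leqnSn n) i) = \sum_j Q i j *: L (lift ord0 j).
  under [RHS]eq_bigr do rewrite Ll scaler_sumr.
  rewrite exchange_big /=; apply: eq_bigr => k _.
  rewrite EQ scaler_suml; apply: eq_bigr => j _.
  by rewrite scalerA.
have g'I i : I (g' (widen_ord (leqnSn n) i)).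
  by rewrite g'w; apply: (subspace_sum sI) => j _; apply: (subspaceZ sI).
pose G := g' ord_max; have hG : G \is d.-1.-homog := hg' _.
have IbG : I (b ord_max * G).
  move: bg'; rewrite big_ord_recr /= => /eqP; rewrite addrC addr_eq0 => /eqP ->.
  apply: (subspaceN sI); apply: (subspace_sum sI) => i _.
  exact: idealM.
(* Otherwise the other [b i] would form a syzygy of the polar combinations in degree [r < d - 1];
   they would vanish, and [a] with them. *)
have bN0 : b ord_max != 0.
  apply: contraNneq aj0 => b0; rewrite aE big1 // => i _.
  suff -> : b i = 0 by rewrite scaler0.
  case: (unliftP ord_max i) => [k|] -> //.
  have -> : lift ord_max k = widen_ord (leqnSn n) k.
    by apply/val_inj/lift_max.
  pose x j := \sum_i Q i j *: b (widen_ord (leqnSn n) i).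
  have x0 j : x j = 0.
    apply: (syz x r) => //; first by move=> i'; apply: rpred_sum => k' _; apply: dhomogZ.
    move: bg'; rewrite big_ord_recr /= b0 mul0r addr0 => bg0; rewrite -[RHS]bg0.
    under [RHS]eq_bigr do rewrite g'w mulr_sumr.
    rewrite exchange_big /=; apply: eq_bigr => j' _.
    rewrite /x mulr_suml; apply: eq_bigr => k' _.
    by rewrite -scalerAl -scalerAr.
  have : \sum_j (invmx Q) j k *: x j = b (widen_ord (leqnSn n) k).
    under eq_bigr do rewrite scaler_sumr.
    rewrite exchange_big /= (bigD1 k) //= [X in _ + X]big1.
      under eq_bigr do rewrite scalerA mulrC.
      rewrite addr0 -scaler_suml; have /matrixP/(_ k k) := mulmxV Qu.
      by rewrite !mxE eqxx => ->; rewrite scale1r.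
    move=> j jk; under eq_bigr do rewrite scalerA mulrC.
    rewrite -scaler_suml; have /matrixP/(_ j k) := mulmxV Qu.
    by rewrite !mxE (negPf jk) => ->; rewrite scale0r.
  by move=> <-; rewrite big1 // => j _; rewrite x0 scaler0.
have sJ := hom_ideal_subspace (jacobian_hom hf).
have hA : hom_ideal (addI I G) := addI_hom hI hG.
have sA := hom_ideal_subspace hA.
have HFA k : (HF (addI I G) k <= HF (jacobian f) k)%N.
  apply: HF_le => // p _; apply: idl_min hA.1 _ => j _.
  rewrite fE; apply: (subspace_sum sA) => i _; apply: (subspaceZ sA).
  case: (unliftP ord_max i) => [k'|] ->; last first.
    by have := addI_gen G 1 iI; rewrite mul1r.
  have -> : lift ord_max k' = widen_ord (leqnSn n) k' by apply/val_inj/lift_max.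
  exact: addI_sub.
have hC : hom_ideal (colon I G) := colon_hom hI hG.
have sC := hom_ideal_subspace hC.
suff [N2 hN2] : exists N2, forall k, (N2 <= k)%N -> (HF (colon I G) k <= r * d.-1 ^ n.-1)%N.
  exists (N1 + N2 + d)%N => k hk; have dk : (d.-1 <= k)%N by lia.
  rewrite -(hN1 k) -1?(subnK dk); last by lia.
  rewrite (HF_addI _ hI hG); apply: leq_add; first exact: HFA.
  by apply: hN2; lia.
have exe : exists e, `[< exists2 q, q \is e.-homog & q != 0 /\ I (q * G) >].
  by exists r; apply/asboolP; exists (b ord_max).
case: (ex_minnP exe) => e /asboolP[q hq [qN0 IqG]] emin.
have er : (e <= r)%N by apply: emin; apply/asboolP; exists (b ord_max).
(* In degree 0 the multiplier is a nonzero constant, so [G] is in [I] and the colon ideal is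
   everything. *)
have [e0|e_gt0] := posnP e.
  exists 0%N => k _; rewrite (_ : HF _ _ = 0%N) //; apply/(HF_eq0 _ sC) => p hp.
  have qE : q = (q@_0%MM)%:MP.
    by apply: msize1_polyC; apply: leq_trans (homog_msize_le hq) _; rewrite e0.
  have q0N0 : q@_0%MM != 0 by apply: contraNneq qN0 => q0; rewrite qE q0 mpolyC0.
  rewrite /colon; apply: idealM => //; rewrite -[G](scalerK q0N0).
  by apply: (subspaceZ sI); rewrite -mul_mpolyC -qE.
(* Since [l] is regular modulo [I], a factor [l] of [q] could be cancelled, against the minimality
   of its degree. *)
have nlq q' : q <> q' * l.
  move=> qE; have qE' : q = pihomog mdeg e.-1 q' * l.
    by rewrite -(pihomogM _ _ hl) addn1 prednK // -qE pihomog_dE.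
  have : (e <= e.-1)%N.
    apply: emin; apply/asboolP; exists (pihomog mdeg e.-1 q'); first exact: pihomogP.
    split; first by apply: contraNneq qN0 => q'0; rewrite qE' q'0 mul0r.
    by apply: nl; rewrite mulrAC -qE'.
  by rewrite leqNgt ltn_predL e_gt0.
have [v lv qv] := exists_point nlq.
have [||L' [rL' lL' L'0 hL' L'i]] :=
  @second_family n (fun k => L (lift ord0 k)) q e v _ hq e_gt0 lv qv.
- move=> k; have := hL (lift ord0 k); rewrite /eL eq_sym (negPf (neq_lift _ _)) //.
- move=> w [i wi] lw; apply: contrapT => /forallNP Lw; case/eqP: wi.
  apply: (colength_zero lL) => j; first by exists (eL j).
  case: (unliftP ord0 j) => [k|] ->; last by rewrite L0.
  by apply/eqP; have /negP := Lw k; rewrite negbK.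
have /choice[eL' hL'2] := hL'.
pose I' := idl (~: [set ord0]) L'.
have hI' : hom_ideal I' := idl_hom _ hL'2.
have nl' : nzd I' l by rewrite -L'0; apply: rL'; rewrite !inE eqxx.
have lI' : colength (addI I' l) (d.-1 ^ n.-1 * e).
  by rewrite -L'0 -idl_setU1 ?finset.setUCr // !inE eqxx.
have [N2 hN2] := colength_HF hI' hl nl' lI'.
exists N2 => k N2k; apply: (@leq_trans (HF I' k)); last first.
  by rewrite hN2 // mulnC leq_mul2r er orbT.
apply: HF_le => //; first exact: hom_ideal_subspace.
move=> p _; apply: idl_min hC.1 _ => i; rewrite !inE => iN0.
have [->|[c ->]] := L'i i iN0; first exact: IqG.
apply: (subspace_sum sC) => j _; apply: (subspaceZ sC); rewrite /colon.
exact: idealMr.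
Qed.

End LowerBound.

(** There are finitely many normalized singular points, and each has a nonzero coordinate, so
    [generic_power] applies. *)
Lemma generic_form_at_singular (R : realType) (n d : nat) (f : {mpoly R[i][n.+1]}) :
  f \is d.-homog -> (0 < d)%N -> isolated_singularities f ->
  exists t : R[i], forall w, (exists i, w i != 0) ->
    (forall j, (f^`M(j)).@[w] = 0) -> (generic_linear_form n t).@[w] != 0.
Proof.
move=> hf d_gt0 hiso; have finD := singular_finite hf hiso.
pose s := finmap.enum_fset (fset_set [set p | normalized p /\ singular f p]%classic).
have sP p : p \in s <-> normalized p /\ singular f p.
  by rewrite /s in_fset_set // inE.
have [|t ht] := @generic_power _ (size s) n.+1 (fun a i => (nth 0 s a) 0 i).
  move=> a; have /sP[_ [/rV0Pn[i pi] _ _]] : nth 0 s a \in s by apply: mem_nth.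
  by exists i.
exists t => w [i0 wi0] dfw.
pose v : 'rV[R[i]]_n.+1 := \row_i w i.
have vi i : v 0 i = w i by rewrite mxE.
have vN0 : v != 0 by apply/rV0Pn; exists i0; rewrite vi.
have pvN0 := pivot_neq0 vN0; have ipN0 : (v 0 (pivot v))^-1 != 0 by rewrite invr_eq0.
pose p := (v 0 (pivot v))^-1 *: v.
have np : normalized p by rewrite /normalized /p pivotZ // mxE mulVf.
have pE : p 0 = fun i => (v 0 (pivot v))^-1 * w i.
  by apply/funext => i; rewrite mxE -(vi i).
have ev (q : {mpoly R[i][n.+1]}) e : q \is e.-homog ->
    q.@[p 0] = (v 0 (pivot v))^-1 ^+ e * q.@[w].
  by move=> hq; rewrite -(meval_homogZ _ _ hq) pE.
have ps : p \in s.
  apply/sP; split=> //; split.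
  - by rewrite scaler_eq0 negb_or ipN0.
  - by rewrite (ev f d) // (jacobian_vanish (jacobian_f hf d_gt0) dfw) mulr0.
  - by move=> j; rewrite (ev _ d.-1) ?mderiv_homog // dfw mulr0.
have sz : (index p s < size s)%N by rewrite index_mem.
apply: contraNneq (ht (Ordinal sz)) => lw.
rewrite /= nth_index //; have := ev _ 1%N (generic_linear_form_homog n t).
rewrite lw mulr0 raddf_sum /= => E; apply/eqP; rewrite -[RHS]E.
by apply: eq_bigr => i _; rewrite mevalZ mevalXU.
Qed.

Lemma tjurina_lower_bound (R : realType) (n d r : nat) (f : {mpoly R[i][n.+1]})
    (a : 'I_n.+1 -> {mpoly R[i][n.+1]}) :
  f \is d.-homog -> (1 < d)%N -> (0 < n)%N -> isolated_singularities f ->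
  AR_hom f r a -> (exists j, a j != 0) -> (r <= d.-1)%N ->
  (d.-1 * d.-1 ^ n.-1 <= total_tjurina f + r * d.-1 ^ n.-1)%N.
Proof.
(* For [r = d - 1] the term [r * d.-1 ^ n.-1] alone suffices; the Hilbert function argument requires
   [r < d - 1]. *)
move=> hf d_gt1 n_gt0 hiso ha aN0; rewrite leq_eqVlt => /orP[/eqP ->|rd].
  exact: leq_addl.
have d_gt0 : (0 < d)%N by apply: ltnW.
have [t ht] := generic_form_at_singular hf d_gt0 hiso.
have [k0 hk0] := jacobian_cofinite hf d_gt1 ht.
have [k1 hk1] := HF_jacobian_lower_bound hf d_gt1 ht n_gt0 rd ha aN0.
have [k2 hk2] := HF_jacobian_le_tjurina hf d_gt0 (generic_linear_form_homog n t) hk0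
  (singular_finite hf hiso).
rewrite -expnS prednK //; apply: leq_trans (hk1 (k1 + k2)%N (leq_addr _ _)) _.
by rewrite leq_add2r; apply: hk2; apply: leq_addl.
Qed.

Theorem proposition4p5 (R : realType) (n d : nat) (g : {mpoly R[i][n]})
    (f : {mpoly R[i][n.+1]})
    (hd : (2 <= d)%N)
    (hred : reduced g)
    (hdeg : msize g = d.+1)
    (hf : f = homogenize d g)
    (hiso : isolated_singularities f) :
  [/\ d%:R - 1 - (total_tjurina f)%:R / (d%:R - 1) ^+ n.-1
        <= (mdr_aff d g)%:R :> R,
      mdr_aff d g = mdr_hom f
    & (mdr_hom f <= d - 1)%N]
  /\ ((total_tjurina f < (d - 1) ^ n.-1)%N ->
        mdr_aff d g = mdr_hom f /\ mdr_hom f = (d - 1)%N).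
Proof.
have d_gt0 : (0 < d)%N by apply: ltnW.
have n_gt0 : (0 < n)%N.
  (* In zero variables [g] would be constant, against its degree [d >= 2]. *)
  rewrite lt0n; apply/eqP => n0; have : (msize g <= 1)%N.
    by rewrite (nvar0_mpolyC_eq g n0) msizeC; case: (_ != _).
  by rewrite hdeg; lia.
have homf : f \is d.-homog by rewrite hf; apply: homogenize_homog.
have [[a [ha aN0]] affE mdr_le] := mdr_spec d_gt0 hdeg n_gt0.
rewrite -hf in ha affE mdr_le.
have := tjurina_lower_bound homf hd n_gt0 hiso ha aN0 mdr_le.
rewrite affE -subn1 in mdr_le *; set tau := total_tjurina f; set r := mdr_hom f in mdr_le *.
set D := ((d - 1) ^ n.-1)%N => bound.
have D_gt0 : (0 < D)%N by rewrite expn_gt0; apply/orP; left; lia.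
split.
  split=> //.
  have -> : d%:R - 1 = (d - 1)%:R :> R by rewrite natrB.
  rewrite -natrX -/D lerBlDr -lerBlDl ler_pdivlMr ?ltr0n // mulrBl lerBlDl.
  by rewrite -!natrM -natrD ler_nat addnC.
move=> tauD; split=> //; apply/eqP; rewrite eqn_leq mdr_le /= leqNgt.
(* If [r < d - 1], the bound gives [(r + 1) D <= tau + r D], that is [D <= tau]. *)
apply/negP => rd; have : (r.+1 * D <= (d - 1) * D)%N by rewrite leq_mul2r rd orbT.
by rewrite mulSn; lia.
Qed.
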